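(* For every classical noncrossing partition $\pi$ for $D_n$ there exists a unique classical nonnesting partition $\pi'$ for $D_n$ with $a(\pi')=a(\pi)$, $\mu(\pi')=\mu(\pi)$ and $\sigma_D(\nu(\pi'),c(\pi'))=(\nu(\pi),\xi(\pi),c(\pi))$; for every classical nonnesting partition $\pi'$ for $D_n$ there exists a unique classical noncrossing partition $\pi$ for $D_n$ satisfying these equalities; and any two such $\pi,\pi'$ have the same type.
   Context: Let $\Lambda=\{1,\dots,n,-1,\dots,-n,0\}$. For a subspace $L\subseteq\mathbb R^n$ that is an intersection of (possibly zero) hyperplanes $x_i=x_j$, $x_i=-x_j$ ($i\ne j$), let $\mathrm{Part}(L)$ be the partition of $\Lambda$ where, with $x_{-i}:=-x_i$, $x_0:=0$, $s,t$ lie in the same block iff $x_s=x_t$ for all $x\in L$; these are the classical partitions for $D_n$. The type of $\mathrm{Part}(L)$ is the orbit of $L$ under signed permutations of coordinates with an even number of sign changes. For a partition $P$ and a (strict weak) order $<$ on a ground set (elements outside it, such as $0$, ignored), $G(P)$ has an edge $(s,s')$ when $s<s'$ lie in a common block and no element $s''$ of that block has $s<s''<s'$. Noncrossing: no edges $(a,c),(b,d)$ with $a<b<c<d$; nonnesting: no edges $(a,d),(b,c)$ with $a<b<c<d$. Classical nonnesting partitions for $D_n$: nonnesting w.r.t. the strict weak order on $\{\pm1,\dots,\pm n\}$ with $s<t$ iff $s<t$ as integers and $\{s,t\}\ne\{-1,1\}$. Classical noncrossing partitions for $D_n$: there is $c\in\{2,\dots,n\}$ such that the partition is noncrossing w.r.t.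 both orders $-2<\dots<-c<-1<-(c+1)<\dots<-n<2<\dots<c<1<c+1<\dots<n$ and $-2<\dots<-c<1<-(c+1)<\dots<-n<2<\dots<c<-1<c+1<\dots<n$. Type-B-style statistics of a partition $\tau$ of a symmetric set, where ''positive'' means in $\{2,\dots,n\}$ and every other element ($0$, $\pm1$, negatives) is nonpositive: a block is switching if it contains a positive and a nonpositive element, positive nonswitching if all elements are positive; $M_1,\dots,M_m$ positive nonswitching blocks ordered by least element give $a(\tau)=(\min M_i)_i$, $\mu(\tau)=(|M_i|)_i$; $P_1,\dots,P_k$ switching blocks ordered by least positive element give $\nu(\tau)=(\nu_i)_i$, $\nu_i$ the number of positive elements of $P_i$. For $\pi'$ nonnesting: $a(\pi'),\mu(\pi'),\nu(\pi')$ are these statistics of $\pi'$. For $\pi$ noncrossing: $a(\pi),\mu(\pi),\nu(\pi)$ are these statistics of $CM(\pi)$, the partition of $\{\pm2,\dots,\pm n\}\cup\{0\}$ obtained from $\pi$ by merging the blocks containing $1$, $-1$ and $0$ into one block and deleting $1,-1$. For any classical partition $\rho$ for $D_n$, let $R_1,\dots,R_l$ be its blocks containing an element of $\{2,\dots,n\}$ and an element of $\{1,-1\}$, ordered by increasing least element of $\{2,\dots,n\}$; $c(\rho)=(R_i\cap\{1,-1\})_{i=1}^l$ and (for noncrossing $\rho$) $\xi(\rho)=(|R_i\cap\{2,\dots,n\}|)_{i=1}^l$. The map $\sigma_D$: given $\nu=(\nu_1,\dots,\nu_k)$ and $c=(c_1,\dots,c_l)$, let $\xi=(\xi_1,\dots,\xi_l)$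 be the last $l$ entries of $\nu$. If $l=2$, $\sigma_D(\nu,c)=((\nu_1,\dots,\nu_{k/2-1},\nu_{k-1}+\nu_k,\nu_{k/2},\dots,\nu_{k-2}),(\xi_2,\xi_1),(c_2,c_1))$; if $l=1$, $\sigma_D(\nu,c)=((\nu_1,\dots,\nu_{(k-1)/2},\nu_k,\nu_{(k+1)/2},\dots,\nu_{k-1}),\xi,c)$; if $l=0$, $\sigma_D(\nu,c)=(\nu,\xi,c)$.
   Formalization: Proved for n ≥ 2 (for n = 1 no c exists), and the second claim only for nonnesting π' with σ_D(ν(π'),c(π')) defined, i.e. k even if l = 2 and k odd if l = 1; e.g. {±2,±4,0},{1,3},{-1,-3} for n = 4 has l = 1, k = 2, so σ_D is undefined. *)

(* Defs.v *)
From mathcomp Require Import all_boot all_order all_algebra all_fingroup.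
From mathcomp Require Import boolp classical_sets reals.

Set Implicit Arguments.
Unset Strict Implicit.
Unset Printing Implicit Defensive.

Import GRing.Theory Num.Theory.
Local Open Scope ring_scope.

(* The index set {1, ..., n, -1, ..., -n, 0}: [None] is 0, [Some (false, i)]
   is i.+1 and [Some (true, i)] is - i.+1 (as ['I_n] starts at 0). *)
Notation Lam n := (option (bool * 'I_n)).

Definition ival (n : nat) (s : Lam n) : int :=
  if s is Some (b, i) then (-1) ^+ b * (i.+1)%:Z else 0.

(* x_s for s in Lam n, with x_(-i) = - x_i and x_0 = 0. *)
Definition xcoord (R : realType) (n : nat) (x : 'rV[R]_n) (s : Lam n) : R :=
  if s is Some (b, i) then (-1) ^+ b * x 0 i else 0.

Section Classical.
Variables (R : realType) (n : nat).
Implicit Types (L : set 'rV[R]_n) (P : {set {set Lam n}}).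

(* (i, j, false) encodes x_i = x_j and (i, j, true) encodes x_i = - x_j. *)
Definition hyperplane (h : 'I_n * 'I_n * bool) : set 'rV[R]_n :=
  [set x | x 0 h.1.1 = (-1) ^+ h.2 * x 0 h.1.2]%classic.

Definition intersection_of_hyperplanes L : Prop :=
  exists2 H : {set 'I_n * 'I_n * bool},
    forall h, h \in H -> h.1.1 != h.1.2
    & L = (\bigcap_(h in [set` H]) hyperplane h)%classic.

Definition Part L : {set {set Lam n}} :=
  equivalence_partition
    (fun s t => `[< forall x, L x -> xcoord x s = xcoord x t >]) [set: Lam n].

Definition classical_partition P : Prop :=
  exists2 L, intersection_of_hyperplanes L & P = Part L.

Definition signed_perm (p : 'S_n) (e : {set 'I_n}) (x : 'rV[R]_n) : 'rV[R]_n :=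
  \row_i ((-1) ^+ (i \in e) * x 0 (p i)).

Definition orbitD L : set (set 'rV[R]_n) :=
  [set L' | exists p : 'S_n, exists2 e : {set 'I_n},
     ~~ odd #|e| & L' = (signed_perm p e @` L)%classic]%classic.

Definition is_type P (T : set (set 'rV[R]_n)) : Prop :=
  exists2 L, intersection_of_hyperplanes L & P = Part L /\ T = orbitD L.

Definition same_type P Q : Prop := exists T, is_type P T /\ is_type Q T.

End Classical.

Section Orders.
Variable n : nat.
Implicit Types (P : {set {set Lam n}}).

(* An order on a ground set included in [Lam n] is given as a relation on
   [Lam n] under which elements outside of the ground set are unrelated to
   everything, so that they are ignored by [edge]. *)
Definition edge (lt : rel (Lam n)) P (s s' : Lam n) : bool :=
  lt s s' &&
  [exists B in P, [&& s \in B, s' \in B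
                    & [forall s'' in B, ~~ (lt s s'' && lt s'' s')]]].

Definition noncrossing (lt : rel (Lam n)) P : Prop :=
  forall a b c d, lt a b -> lt b c -> lt c d ->
    ~ (edge lt P a c /\ edge lt P b d).

Definition nonnesting (lt : rel (Lam n)) P : Prop :=
  forall a b c d, lt a b -> lt b c -> lt c d ->
    ~ (edge lt P a d /\ edge lt P b c).

Definition lt_nonnesting : rel (Lam n) := fun s t =>
  [&& ival s != 0, ival t != 0, ival s < ival t
    & ~~ ((ival s == -1) && (ival t == 1))].

Definition lt_word (w : seq int) : rel (Lam n) := fun s t =>
  [&& ival s \in w, ival t \in w & (index (ival s) w < index (ival t) w)%N].

(* -2, ..., -c, -e, -(c+1), ..., -n, 2, ..., c, e, c+1, ..., n *)
Definition noncrossing_word (c : nat) (e : int) : seq int :=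
  let h := [seq k%:Z | k <- iota 2 c.-1]
             ++ e :: [seq k%:Z | k <- iota c.+1 (n - c)] in
  [seq - k | k <- h] ++ h.

End Orders.

Definition classical_nonnesting (R : realType) (n : nat)
    (P : {set {set Lam n}}) : Prop :=
  classical_partition R P /\ nonnesting (@lt_nonnesting n) P.

Definition classical_noncrossing (R : realType) (n : nat)
    (P : {set {set Lam n}}) : Prop :=
  classical_partition R P /\
  exists2 c : nat, (2 <= c <= n)%N
    & noncrossing (lt_word (noncrossing_word n c 1)) P /\
      noncrossing (lt_word (noncrossing_word n c (-1))) P.

Section Statistics.
Variable n : nat.
Implicit Types (B : {set Lam n}) (P : {set {set Lam n}}).

Definition positives : {set Lam n} := [set s | 2 <= ival s].
Definition ones : {set Lam n} := [set s | (ival s == 1) || (ival s == -1)].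

(* The default value [n] of the minimum is at least every ival, hence is
   irrelevant as soon as B has a positive element. *)
Definition least_positive B : nat :=
  \big[minn/n]_(s in B :&: positives) `|ival s|%N.

Definition ordered_blocks (q : pred {set Lam n}) P : seq {set Lam n} :=
  sort (fun B C => least_positive B <= least_positive C)%N
       (enum [set B in P | q B]).

Definition switching B : bool :=
  ~~ [disjoint B & positives] && ~~ (B \subset positives).

Definition positive_nonswitching B : bool := B \subset positives.

Definition a_stat P : seq nat :=
  [seq least_positive B | B <- ordered_blocks positive_nonswitching P].

Definition mu_stat P : seq nat :=
  [seq #|B| | B <- ordered_blocks positive_nonswitching P].

Definition nu_stat P : seq nat :=
  [seq #|B :&: positives| | B <- ordered_blocks switching P].

(* The blocks not meeting {1, -1, 0}, together with the merged block. *)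
Definition CM P : {set {set Lam n}} :=
  let Z := ones :|: [set s | ival s == 0] in
  ((\bigcup_(B in P | ~~ [disjoint B & Z]) B) :\: ones)
    |: [set B in P | [disjoint B & Z]].

Definition meets_positives_and_ones B : bool :=
  ~~ [disjoint B & positives] && ~~ [disjoint B & ones].

Definition c_stat P : seq {set Lam n} :=
  [seq B :&: ones | B <- ordered_blocks meets_positives_and_ones P].

Definition xi_stat P : seq nat :=
  [seq #|B :&: positives| | B <- ordered_blocks meets_positives_and_ones P].

End Statistics.

(* The displayed formulas make sense only if k = size nu is even when
   size c = 2, and odd when size c = 1: otherwise the value is [None].
   With k and l the sizes of nu and c, the entry nu_i is [nth 0 nu i.-1]. *)
Definition sigmaD (T : Type) (nu : seq nat) (c : seq T) :
    option (seq nat * seq nat * seq T) :=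
  let k := size nu in
  let l := size c in
  let xi := drop (k - l) nu in
  match l with
  | 0%N => Some (nu, xi, c)
  | 1%N =>
      if odd k then
        let h := (k.-1)./2 in
        Some (take h nu ++ nth 0%N nu k.-1 :: drop h (take k.-1 nu), xi, c)
      else None
  | 2%N =>
      if ~~ odd k then
        let h := (k./2).-1 in
        Some (take h nu ++ (nth 0 nu k.-2 + nth 0 nu k.-1)%N
                :: drop h (take k.-2 nu),
              rev xi, rev c)
      else None
  | _ => None
  end.

(* pi is the noncrossing partition and pi' the nonnesting one. *)
Definition corresponds (n : nat) (pi pi' : {set {set Lam n}}) : Prop :=
  [/\ a_stat pi' = a_stat (CM pi),
      mu_stat pi' = mu_stat (CM pi)
    & sigmaD (nu_stat pi') (c_stat pi')
        = Some (nu_stat (CM pi), xi_stat pi, c_stat pi)].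

(* Main.v *)
(** A classical partition is the kernel of an odd integer labelling of
    {-n, ..., n}, so it is a label of 1 together with a word [w] listing the
    labels of 2, ..., n.  Edges between positive elements are repetitions in
    [w], and the switching blocks behave like blocks opened before 2: writing
    their labels in front of [w], in a suitable order, turns "nonnesting" and
    "noncrossing" into the type A conditions on the resulting word.  In type A a
    word is determined by its letter counts and the positions of its new
    letters, since each other letter has to continue the block waiting longest
    (nonnesting) or shortest (noncrossing); and any admissible counts are
    realised by both rules.

    Reading -n, ..., n symmetrically shows that negation reverses the order of
    the switching blocks avoiding 1 and -1, and that the blocks of 1 and -1 come
    last among the switching blocks in the nonnesting case, but sit in the
    middle in the noncrossing case, in the opposite order.  This is exactly the
    rearrangement made by [sigmaD].  After normalising the labels the statistics
    are the letter counts and the new-letter positions, so corresponding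
    partitions have words that are permutations of each other with the same
    label of 1; hence they have the same type. *)

Require Import Defs.
From mathcomp Require Import all_boot all_order all_algebra all_fingroup.
From mathcomp Require Import boolp classical_sets reals zify.

Set Implicit Arguments.
Unset Strict Implicit.
Unset Printing Implicit Defensive.
Import GRing.Theory Num.Theory Order.TTheory.

(** * Noncrossing and nonnesting words *)

(** Labels are far from unique, and the noncrossing condition quantifies over a position [c] at
    which both 1 and -1 are inserted. Both obstacles are met by a normal form, [canonical], that
    records neither [c] nor the original labels. In the noncrossing case decreasing labels then
    coincide with the order of first occurrence, so negation reverses that order automatically, and
    [c] is recovered at the end by an explicit insertion point. Type D shows in two places. The
    hyperplanes [x_i = 0] are absent, so the zero block never contains exactly one coordinate; this
    is the condition [count_mem 0 v != 1]. The zero block may itself be a main letter; being its own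
    negative, it then sits in the middle of the main letters and makes their number [r] odd. In a
    noncrossing partition this excludes letters of 1 and -1, which have to occupy the same middle.
    In a nonnesting partition it does not, and the parity test inside [sigmaD] detects this. *)

Section Words.
Variable T : eqType.
Implicit Types (x y w I s t : seq T) (a b l : T).

(** The repetitions need not be consecutive: [crossing_edges] tightens any such pattern to two
    crossing edges. *)
Definition noncross x := forall a b, a != b -> ~~ subseq [:: a; b; a; b] x.

(** The two displayed [a] are consecutive occurrences, that is an edge, and a repetition inside [x2]
    always contains an edge nested under it. *)
Definition nonnest x :=
  forall x1 x2 x3 a, x = x1 ++ a :: x2 ++ a :: x3 -> a \notin x2 -> uniq x2.

Lemma subseq_catP s x y :
  subseq s (x ++ y) <-> exists s1 s2, [/\ s = s1 ++ s2, subseq s1 x & subseq s2 y].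
Proof.
split=> [/subseqP[m sz_m ->]|[s1 [s2 [-> h1 h2]]]]; last exact: cat_subseq.
exists (mask (take (size x) m) x), (mask (drop (size x) m) y).
rewrite !mask_subseq; split=> //.
by rewrite -mask_cat ?cat_take_drop // size_takel // sz_m size_cat leq_addr.
Qed.

Lemma subseq_split4 a b c d x y : subseq [:: a; b; c; d] (x ++ y) ->
  [\/ subseq [:: a; b; c; d] y, a \in x /\ subseq [:: b; c; d] y,
      subseq [:: a; b] x /\ subseq [:: c; d] y
    | subseq [:: a; b; c] x /\ d \in y \/ subseq [:: a; b; c; d] x].
Proof.
case/subseq_catP=> s1 [s2 [+ h1 h2]].
case: s1 h1 => [|a1 [|a2 [|a3 [|a4 [|a5 s1]]]]] h1 /=; last by case.
- by move=> ->; constructor 1.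
- by case=> -> ->; constructor 2; rewrite -sub1seq.
- by case=> -> -> ->; constructor 3.
- by case=> -> -> -> e; constructor 4; left; rewrite -sub1seq e.
- by case=> -> -> -> -> _; constructor 4; right.
Qed.

Lemma subseq_split2 a b x y : subseq [:: a; b] (x ++ y) ->
  [\/ subseq [:: a; b] y, a \in x /\ b \in y | subseq [:: a; b] x].
Proof.
case/subseq_catP=> s1 [s2 [+ h1 h2]].
case: s1 h1 => [|a1 [|a2 [|a3 s1]]] h1 /=; last by case.
- by move=> ->; constructor 1.
- by case=> -> e; constructor 2; rewrite -sub1seq h1 -sub1seq e.
- by case=> -> -> _; constructor 3.
Qed.

Lemma split_last a x : a \in x -> exists x1 x2, x = x1 ++ a :: x2 /\ a \notin x2.
Proof.
elim: x => // c x IH; rewrite inE.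
have [/IH[x1 [x2 [-> h]]] _|ax] := boolP (a \in x); first by exists (c :: x1), x2.
by rewrite orbF => /eqP <-; exists [::], x.
Qed.

Lemma split_first a x : a \in x -> exists x1 x2, x = x1 ++ a :: x2 /\ a \notin x1.
Proof.
elim: x => // c x IH; rewrite inE; have [<- _|ac /= /IH] := eqVneq a c.
  by exists [::], x.
move=> [x1 [x2 [-> h]]]; exists (c :: x1), x2.
by rewrite inE negb_or ac h.
Qed.

Lemma split_last_inj a x1 x2 y1 y2 :
  x1 ++ a :: x2 = y1 ++ a :: y2 -> a \notin x2 -> a \notin y2 -> x1 = y1 /\ x2 = y2.
Proof.
elim: x1 y1 => [|c x1 IH] [|d y1] /=.
- by case=> ->.
- by case=> -> -> ; rewrite mem_cat mem_head orbT.
- by case=> -> <- _; rewrite mem_cat mem_head orbT.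
- by case=> -> e h1 h2; have [-> ->] := IH _ e h1 h2.
Qed.

(* [index _ (rev x)] orders letters by last occurrence, latest first. *)
Lemma index_rev_subseq a b x : a \in x -> b \in x ->
  index b (rev x) < index a (rev x) ->
  exists x1 x2, [/\ x = x1 ++ a :: x2, a \notin x2 & b \in x2].
Proof.
move=> /split_last[x1 [x2 [-> ax2]]] bx lt; exists x1, x2; split=> //.
move: lt; rewrite rev_cat rev_cons cat_rcons !index_cat mem_rev mem_rev (negbTE ax2) /=.
by rewrite eqxx addn0; case: ifP => // _; rewrite ltnNge leq_addr.
Qed.

(** * Uniqueness of a word with prescribed counts and openers *)

Section Discipline.
Variable D : seq T -> Prop.
Variable later : seq T -> T -> T -> bool.
Hypothesis later_asym : forall x a b, later x a b -> ~~ later x b a.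
Hypothesis D_later : forall x l t b, D (x ++ l :: t) -> l \in x -> b \in x ->
  b \in t -> l != b -> later x l b.

(** At the first disagreement both next letters are already in [x], because the two words see the
    same letters at each length. Each of them recurs in the word that postponed it, so [D_later]
    ranks them in both ways, against [later_asym]. *)
Lemma discipline_uniq x w w' : D (x ++ w) -> D (x ++ w') -> perm_eq w w' ->
  (forall p, x ++ take p w =i x ++ take p w') -> w = w'.
Proof.
elim: w w' x => [|l t IH] [|l' t'] x; rewrite ?(perm_sym [::]).
- by [].
- by move=> _ _ /perm_size.
- by move=> _ _ /perm_size.
move=> Dw Dw' pw mw.
have m1 : x ++ [:: l] =i x ++ [:: l'] by move=> b; have := mw 1 b; rewrite /= !take0.
have [ll'|nll'] := eqVneq l l'.
  subst l'; congr cons; apply: (IH _ (rcons x l)); rewrite ?cat_rcons //.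
  - by rewrite perm_cons in pw.
  - by move=> p b; have := mw p.+1 b; rewrite !cat_rcons.
have lx : l \in x.
  have := m1 l; rewrite !mem_cat !inE eqxx (negbTE nll') orbT orbF.
  by move/esym.
have lx' : l' \in x.
  have := m1 l'; rewrite !mem_cat !inE eqxx eq_sym (negbTE nll') orbT orbF.
  by move=> ->.
have lt' : l \in t'.
  by have := perm_mem pw l; rewrite !inE eqxx (negbTE nll') /= => <-.
have lt : l' \in t.
  by have := perm_mem pw l'; rewrite !inE eqxx [l' == l]eq_sym (negbTE nll') /= => ->.
have := later_asym (D_later Dw lx lx' lt nll').
by rewrite (D_later Dw' lx' lx lt') // eq_sym.
Qed.
End Discipline.

(** An old letter [l] is continued only if no pending letter [b] occurred after it: otherwise [l],
    [b], the new [l] and a later [b] cross. *)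
Lemma noncross_uniq x w w' : noncross (x ++ w) -> noncross (x ++ w') ->
  perm_eq w w' -> (forall p, x ++ take p w =i x ++ take p w') -> w = w'.
Proof.
apply: (@discipline_uniq _ (fun x a b => index a (rev x) < index b (rev x))).
  by move=> y a b /ltnW; rewrite leqNgt.
move=> y l t b ncy ly bY bt nlb; rewrite ltnNge leq_eqVlt; apply/negP=> /orP[/eqP e|].
  have := nth_index l (s := rev y) (x := l); rewrite mem_rev => /(_ ly).
  by rewrite -e nth_index ?mem_rev // => /eqP; rewrite eq_sym (negbTE nlb).
move/(index_rev_subseq ly bY) => [y1 [y2 [ey _ by2]]].
have /negP[] := ncy _ _ nlb; rewrite ey -catA.
apply: (cat_subseq (s1 := [::])); rewrite ?sub0seq //= eqxx.
apply: (cat_subseq (s1 := [:: b])); rewrite ?sub1seq //=.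
by rewrite eqxx sub1seq.
Qed.

(** The pending letter seen least recently goes first: if [b] has waited longer than [l], the edge
    from its last occurrence to its next one encloses two letters [l]. *)
Lemma nonnest_uniq x w w' : nonnest (x ++ w) -> nonnest (x ++ w') ->
  perm_eq w w' -> (forall p, x ++ take p w =i x ++ take p w') -> w = w'.
Proof.
apply: (@discipline_uniq _ (fun x a b => index b (rev x) < index a (rev x))).
  by move=> y a b /ltnW; rewrite leqNgt.
move=> y l t b nny ly bY bt nlb; rewrite ltnNge leq_eqVlt; apply/negP=> /orP[/eqP e|].
  have := nth_index l (s := rev y) (x := l); rewrite mem_rev => /(_ ly).
  by rewrite e nth_index ?mem_rev // => /eqP; rewrite eq_sym (negbTE nlb).
move/(index_rev_subseq bY ly) => [y1 [y2 [ey by2 ly2]]].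
have [t1 [t2 [et bt1]]] := split_first bt.
have := nny y1 (y2 ++ l :: t1) t2 b.
rewrite ey et /= -!catA /= -?catA => /(_ erefl).
rewrite mem_cat inE !negb_or by2 eq_sym nlb bt1 => /(_ isT).
by rewrite cat_uniq /= ly2 /= andbF.
Qed.

(* [w] and [w'] get their letters outside of [I] at the same positions. *)
Definition same_openers I w w' := forall p, I ++ take p w =i I ++ take p w'.

(** * Existence of a word with prescribed counts and openers *)

Section Existence.
Variable Inv : seq T -> seq T -> Prop.
Hypothesis Inv_fresh : forall x rest a, Inv x rest -> a \notin x -> a \in rest ->
  Inv (rcons x a) (rem a rest).
Hypothesis Inv_old : forall x rest, Inv x rest -> has (mem rest) x ->
  exists l, [/\ l \in x, l \in rest & Inv (rcons x l) (rem l rest)].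

(** Greedy construction along [w]: a position where [w] opens a new letter gets that same letter,
    any other position gets the old letter supplied by [Inv_old]. *)
Lemma discipline_exists I w : Inv I w ->
  exists w', [/\ Inv (I ++ w') [::], perm_eq w' w & same_openers I w' w].
Proof.
move=> Inv0.
have H p : p <= size w -> exists q rest, [/\ size q = p, perm_eq (q ++ rest) w,
    Inv (I ++ q) rest & same_openers I q (take p w)].
  elim: p => [|p IH] pw.
    by exists [::], w; rewrite cats0 take0; split.
  have [q [rest [sq pq invq oq]]] := IH (ltnW pw).
  have mq : I ++ q =i I ++ take p w.
    by have := oq p; rewrite (take_oversize (s := q)) ?sq // take_takel.
  have ext l : l \in rest -> I ++ rcons q l =i I ++ take p.+1 w ->
    Inv (I ++ rcons q l) (rem l rest) ->
    exists q rest, [/\ size q = p.+1, perm_eq (q ++ rest) w,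
    Inv (I ++ q) rest & same_openers I q (take p.+1 w)].
    move=> lr ml invl; exists (rcons q l), (rem l rest); split=> //.
    - by rewrite size_rcons sq.
    - rewrite cat_rcons (perm_trans _ pq) // perm_cat2l.
      by rewrite perm_sym perm_to_rem.
    - move=> i; have [ip|pi] := leqP i p.
        rewrite -cats1 takel_cat ?sq // take_takel ?(leqW ip) //.
        by have := oq i; rewrite take_takel.
      by rewrite (take_oversize (s := rcons _ _)) ?size_rcons ?sq // take_oversize // size_takel.
  case: w pw pq oq mq ext {Inv0 IH} => [//|w0 w'] pw pq oq mq ext.
  set w := w0 :: w' in pw pq oq mq ext *.
  have et : take p.+1 w = rcons (take p w) (nth w0 w p) by rewrite -take_nth.
  set l0 := nth w0 w p in et.
  have [l0x|l0x] := boolP (l0 \in I ++ q); last first.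
    have l0r : l0 \in rest.
      have : l0 \in q ++ rest by rewrite (perm_mem pq) mem_nth.
      by move: l0x; rewrite !mem_cat negb_or => /andP[_ /negbTE ->].
    apply: (ext l0) => //; last by rewrite -rcons_cat; apply: Inv_fresh.
    by move=> b; rewrite et -!rcons_cat !mem_rcons !in_cons mq.
  (* If no seen letter remained, [q] would hold all occurrences in [w] of seen letters, hence at
     most [p] of them; but the first [p.+1] letters of [w] are all seen. *)
  have /(Inv_old invq) : has (mem rest) (I ++ q).
    apply/hasPn => no.
    have c1 : count (mem (I ++ q)) w = count (mem (I ++ q)) q.
      rewrite -(elimT seq.permP pq) count_cat -[RHS]addn0; congr addn.
      apply/eqP; rewrite -leqn0 leqNgt -has_count; apply/hasPn => b br.
      by apply/negP => /no /negP; apply.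
    have : p.+1 <= count (mem (I ++ q)) w.
      rewrite -[X in count _ X](cat_take_drop p.+1) count_cat.
      have -> : count (mem (I ++ q)) (take p.+1 w) = p.+1.
        rewrite -[RHS](@size_takel p.+1 _ w) //; apply/eqP; rewrite -all_count.
        apply/allP => b; rewrite et mem_rcons in_cons /= => /orP[/eqP -> //|bt].
        by rewrite mq mem_cat bt orbT.
      by rewrite leq_addr.
    rewrite c1 => /leq_trans /(_ (count_size _ _)); by rewrite sq ltnn.
  case=> l [lx lr invl]; apply: (ext l) => //; last by rewrite -rcons_cat.
  move=> b; rewrite et -!rcons_cat !mem_rcons !in_cons mq.
  by rewrite mq in lx; rewrite mq in l0x; do 2![case: eqVneq => [->|_] //=].
have [q [rest [sq pq invq oq]]] := H _ (leqnn _).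
have r0 : rest = [::].
  by have := perm_size pq; rewrite size_cat sq -[RHS]addn0 => /addnI/size0nil.
exists q; rewrite r0 cats0 in pq invq; split=> //.
by have := oq; rewrite take_size.
Qed.
End Existence.

(* [rest] holds the letters still to be placed: an enclosed letter can no longer
   be continued. *)
Definition nc_inv x (rest : seq T) := noncross x /\
  forall a b, a != b -> b \in rest -> ~~ subseq [:: a; b; a] x.

Lemma rcons_subseq s x a b : subseq (rcons s a) (rcons x b) ->
  (a == b /\ subseq s x) \/ subseq (rcons s a) x.
Proof.
rewrite -2!cats1 => /subseq_catP[s1 [s2 [e h1]]].
case: s2 e => [|c [|d s2]] e /=; first by rewrite cats0 in e; rewrite e; right.
  case: (eqVneq c b) => // ecb _; left; move: e; rewrite !cats1 => /rcons_inj[es ea].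
  by split; [apply/eqP; rewrite ea | rewrite es].
by case: ifP.
Qed.

Lemma noncross_exists I w : uniq I -> exists w',
  [/\ noncross (I ++ w'), perm_eq w' w & same_openers I w' w].
Proof.
move=> uI.
have [x rest a [nc b3] ax ar|x rest [nc b3] hx||w' [[nc _] pw ow]] :=
  @discipline_exists nc_inv _ _ I w; last by exists w'.
- have sr b : b \in rem a rest -> b \in rest by move/mem_rem.
  split=> [c d cd|c d cd /sr dr]; apply/negP.
    rewrite -[[:: _; _; _; _]]/(rcons [:: c; d; c] d) => /rcons_subseq[[/eqP e]|].
      by move/mem_subseq/(_ d); rewrite e (negbTE ax) !inE eqxx orbT => /(_ isT).
    by apply/negP; apply: nc.
  rewrite -[[:: _; _; _]]/(rcons [:: c; d] c) => /rcons_subseq[[/eqP e]|].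
    by move/mem_subseq/(_ c); rewrite e (negbTE ax) inE eqxx => /(_ isT).
  by apply/negP; apply: b3.
(* The letter to continue is the one nearest the end of [x] among those still to be placed; all
   letters after it are finished. *)
- have [x1 [l [x2 [ex lr nr]]]] : exists x1 l x2,
    [/\ x = x1 ++ l :: x2, l \in rest & forall b, b \in x2 -> b \notin rest].
    elim: (x) hx => //= c y IH.
    have [/IH[x1 [l [x2 [-> lr h]]]] _|nh] := boolP (has (mem rest) y).
      by exists (c :: x1), l, x2.
    rewrite orbF => cr; exists [::], c, y; split=> // b bY.
    by apply: contra nh => br; apply/hasP; exists b.
  exists l; split=> //; first by rewrite ex mem_cat mem_head orbT.
  have sr b : b \in rem l rest -> b \in rest by move/mem_rem.
  split=> [c d cd|c d cd /sr dr]; apply/negP.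
    rewrite -[[:: _; _; _; _]]/(rcons [:: c; d; c] d) => /rcons_subseq[[/eqP e]|].
      by apply/negP; apply: b3; rewrite // e.
    by apply/negP; apply: nc.
  rewrite -[[:: _; _; _]]/(rcons [:: c; d] c) => /rcons_subseq[[/eqP e]|]; last first.
    by apply/negP; apply: b3.
  (* Here [c = l]. As [d] is still to be placed, it lies before the chosen [l], so [c], [d], [l] is
     already an enclosing pattern in [x]. *)
  move=> h; have /negP[] := b3 _ _ cd dr; rewrite ex -e -cat_rcons.
  have : subseq [:: c; d] (rcons x1 l).
    move: h; rewrite ex -cat_rcons => /subseq_split2[h|[_ h]|//].
      by have /nr := mem_subseq h (mem_last c [:: d]); rewrite /= dr.
    by have := nr _ h; rewrite dr.
  rewrite -e -!cats1 => /subseq_split2[|[h0]|h0].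
  + by rewrite /=; case: ifP.
  + by rewrite mem_seq1 => /eqP edc; rewrite edc eqxx in cd.
  + by rewrite -catA; apply: (cat_subseq (s1 := [:: c; d])) => //=; rewrite eqxx sub0seq.
- split=> [a b ab|a b ab _]; apply/negP => /subseq_uniq/(_ uI) /=.
  + by rewrite !inE eqxx /= orbT.
  + by rewrite !inE eqxx /= orbT.
Qed.

(** After the last occurrence of a letter still to be placed nothing may repeat, since its next
    occurrence would enclose the repetition. *)
Definition nn_inv x (rest : seq T) := nonnest x /\
  forall x1 x2 a, x = x1 ++ a :: x2 -> a \notin x2 -> a \in rest -> uniq x2.

Lemma nonnest_exists I w : uniq I -> exists w',
  [/\ nonnest (I ++ w'), perm_eq w' w & same_openers I w' w].
Proof.
move=> uI.
have step x rest l : nn_inv x rest ->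
  (l \in x -> l \in rest) ->
  (forall x1 x2 a, x = x1 ++ a :: x2 -> a \notin x2 -> a \in rest -> a != l -> l \notin x2) ->
  nn_inv (rcons x l) (rem l rest).
  move=> [nn b2] lr hl; split=> [y1 y2 y3 a|y1 y2 a].
    case/lastP: y3 => [|y3 c].
      rewrite -[a :: y2 ++ _]/((a :: y2) ++ [:: a]) catA cats1 => /rcons_inj[e ea].
      by move=> ay2; apply: (b2 _ _ a e) => //; rewrite -?ea lr // e mem_cat ea mem_head orbT.
    rewrite -!rcons_cons -!rcons_cat -rcons_cons -rcons_cat => /rcons_inj[e _].
    exact: nn e.
  case/lastP: y2 => [//|y2 c]; rewrite -rcons_cons -rcons_cat => /rcons_inj[e <-].
  rewrite mem_rcons inE negb_or rcons_uniq => /andP[ac ay2] /mem_rem ar.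
  by rewrite (b2 _ _ _ e) // andbT (hl _ _ _ e).
have [x rest a inv ax ar|x rest inv hx||w' [[nc _] pw ow]] :=
  @discipline_exists nn_inv _ _ I w; last by exists w'.
- apply: step => // x1 x2 c ex _ _ _.
  by apply: contra ax; rewrite ex mem_cat inE => ->; rewrite !orbT.
(* The letter to continue is the one whose last occurrence is earliest: every other letter of [x]
   still to be placed occurs again after it. *)
- have [x1 [l [x2 [ex lr lx2 hl]]]] : exists x1 l x2,
    [/\ x = x1 ++ l :: x2, l \in rest, l \notin x2 &
        forall b, b \in x1 -> b \in rest -> b \in l :: x2].
    elim: (x) hx => //= c y IH.
    have [/andP[cr cy] _|ncy hy] := boolP ((c \in rest) && (c \notin y)).
      by exists [::], c, y.
    have /IH[x1 [l [x2 [ey lr lx2 h]]]] : has (mem rest) y.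
      case/orP: hy => // cr; rewrite negb_and cr /= negbK in ncy.
      by apply/hasP; exists c.
    exists (c :: x1), l, x2; split=> // [|b]; first by rewrite ey.
    rewrite inE => /orP[/eqP -> cr|]; last exact: h.
    move: ncy; rewrite negb_and cr /= negbK ey.
    by have := h c; rewrite mem_cat; case: (c \in x1) => //= ->.
  exists l; split=> //; first by rewrite ex mem_cat mem_head orbT.
  apply: step => // y1 y2 a ey ay2 ar al.
  have ax2 : a \in x2.
    have : a \in x by rewrite ey mem_cat mem_head orbT.
    rewrite ex mem_cat => /orP[/hl/(_ ar)|]; rewrite inE (negbTE al) //.
  have [z1 [z2 [ez az2]]] := split_last ax2.
  have := ey; rewrite ex ez -cat_rcons catA => /split_last_inj/(_ az2 ay2)[_ <-].
  by apply: contra lx2; rewrite ez mem_cat inE => ->; rewrite !orbT.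
- split=> [x1 x2 x3 a e|x1 x2 a e _ _]; move: uI; rewrite e.
    by rewrite cat_uniq /= mem_cat inE eqxx !orbT /= !andbF.
  by rewrite cat_uniq /= => /and3P[_ _ /andP[]].
Qed.
End Words.

(** * Classical partitions as kernels of labellings *)

Section Kernel.
Variable n : nat.
Implicit Types (s t u : Lam n) (v : seq int).
Local Open Scope ring_scope.

Definition oppL s : Lam n := if s is Some (b, i) then Some (~~ b, i) else None.

Definition vval v s : int :=
  if s is Some (b, i) then (if b then - v`_i else v`_i) else 0.

Definition ker_partition v : {set {set Lam n}} :=
  [set [set t | vval v t == vval v s] | s : Lam n].

Lemma oppLK : involutive oppL.
Proof. by case=> [[[] i]|]. Qed.

Lemma vval_opp v s : vval v (oppL s) = - vval v s.
Proof. by case: s => [[[] i]|] //=; rewrite ?opprK ?oppr0. Qed.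

Lemma ival_opp s : ival (oppL s) = - ival s.
Proof. by case: s => [[[] i]|] /=; rewrite ?expr0 ?expr1 ?mul1r ?mulN1r ?opprK ?oppr0. Qed.

Lemma ival_inj : injective (@ival n).
Proof.
move=> [[b i]|] [[c j]|] //=.
- move=> h; have /andP[/eqP -> /eqP/val_inj -> //] : (b == c) && (i == j :> nat).
  by case: b c h => [] [] /=; rewrite ?expr0 ?expr1 ?mul1r ?mulN1r; lia.
- by case: b; rewrite ?expr0 ?expr1 ?mul1r ?mulN1r; lia.
- by case: c; rewrite ?expr0 ?expr1 ?mul1r ?mulN1r; lia.
Qed.

Lemma ker_partitionP v B : reflect (exists s, B = [set t | vval v t == vval v s]) (B \in ker_partition v).
Proof.
apply: (iffP imsetP) => [[s _ ->]|[s ->]]; by exists s.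
Qed.

Lemma equivalence_partition_ker_partition (E : rel (Lam n)) v :
  (forall s t, E s t = (vval v s == vval v t)) ->
  equivalence_partition E [set: Lam n] = ker_partition v.
Proof.
move=> h; rewrite /equivalence_partition /ker_partition.
have -> : [set [set y in [set: Lam n] | E x y] | x in [set: Lam n]] =
   [set [set y in [set: Lam n] | E x y] | x : Lam n].
  by apply/setP => B; apply/imsetP/imsetP => -[x _ ->]; exists x; rewrite ?inE.
apply: eq_imset => x; apply/setP => y; rewrite !inE h eq_sym.
by [].
Qed.

Lemma eq_ker_partition v v' : (forall s t, (vval v s == vval v t) = (vval v' s == vval v' t)) ->
  ker_partition v = ker_partition v'.
Proof.
by move=> h; apply: eq_imset => s; apply/setP => t; rewrite !inE h.
Qed.

(** Used with [a = 0], this is the positional form of the type D condition: a zero coordinate always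
    has a companion. *)
Lemma count_neq1P (T : eqType) (x0 a : T) (x : seq T) : count_mem a x != 1%N <->
  forall i, (i < size x)%N -> nth x0 x i = a ->
    exists j, [/\ (j < size x)%N, j != i & nth x0 x j = a].
Proof.
split=> [c i ix xi|h].
  have ex := cat_take_drop i x; rewrite (drop_nth x0 ix) xi in ex.
  have : a \in take i x ++ drop i.+1 x.
    rewrite -has_pred1 has_count count_cat; move: c; rewrite -{1}ex count_cat /= eqxx.
    by lia.
  rewrite mem_cat => /orP[] /(nthP x0)[j]; rewrite ?size_take ?size_drop.
    rewrite ix => ji; rewrite nth_take // => e; exists j.
    by split; rewrite ?(ltn_trans ji) // neq_ltn ji.
  move=> jx; rewrite nth_drop => e; exists (i.+1 + j)%N; split=> //; lia.
apply/eqP => c1.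
have ax : a \in x by rewrite -has_pred1 has_count c1.
have [x1 [x2 [ex ax1]]] := split_first ax.
move: c1 h; rewrite ex count_cat /= eqxx => c1 h.
have := h (size x1); rewrite nth_cat ltnn subnn size_cat /= => /(_ _ erefl)[].
  by rewrite addnS leq_addr.
move=> j [jx jn]; rewrite nth_cat.
have nx1 : count_mem a x1 = 0%N by lia.
have nx2 : count_mem a x2 = 0%N by lia.
case: ltnP => j1 e.
  by move: ax1; rewrite -e mem_nth.
have : a \in x2.
  rewrite -e; have -> : (j - size x1 = (j - size x1).-1.+1)%N by lia.
  by rewrite /= mem_nth //; lia.
by rewrite -has_pred1 has_count nx2.
Qed.

Section Real.
Variable R : realType.
Implicit Types (x : 'rV[R]_n) (L : set 'rV[R]_n).

Lemma xcoord_opp x s : xcoord x (oppL s) = - xcoord x s.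
Proof. by case: s => [[[] i]|] /=; rewrite ?expr0 ?expr1 ?mul1r ?mulN1r ?opprK ?oppr0. Qed.

(** Only relations between distinct coordinates are kept, because [x_i = 0] is not one of the
    hyperplanes. *)
Definition Lker v : set 'rV[R]_n :=
  [set x : 'rV[R]_n | forall (i j : 'I_n) (b : bool), i != j -> v`_i = (-1) ^+ b * v`_j ->
     x 0 i = (-1) ^+ b * x 0 j]%classic.

Lemma Lker_intersection v : intersection_of_hyperplanes (Lker v).
Proof.
exists [set h : 'I_n * 'I_n * bool | (h.1.1 != h.1.2) &&
    (v`_(h.1.1) == (-1) ^+ h.2 * v`_(h.1.2))].
  by move=> h; rewrite inE => /andP[].
rewrite predeqE => x; split=> [Lx [[i j] b]|Lx i j b ij e].
  by rewrite /= inE /= => /andP[ij /eqP e]; apply: Lx.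
by apply: (Lx (i, j, b)); rewrite /= inE /= ij e eqxx.
Qed.

Lemma Lker_xcoord v x s t : size v = n -> count_mem 0 v != 1%N -> Lker v x ->
  vval v s = vval v t -> xcoord x s = xcoord x t.
Proof.
move=> sv /(count_neq1P 0) h Lx.
(* Two zero labels give both [x_i = x_j] and [x_i = - x_j], which forces 0; a lone zero label would
   force nothing. *)
have z (i : 'I_n) : v`_i = 0 -> x 0 i = 0.
  move=> vi; have [|j [jv ji vj]] := h i _ vi; first by rewrite sv.
  rewrite sv in jv; pose j' := Ordinal jv.
  have ij : i != j' by apply: contra ji => /eqP ->.
  have e1 := Lx i j' false ij; have e2 := Lx i j' true ij.
  rewrite /= vi vj mulr0 in e1 e2.
  have {}e1 : x 0 i = x 0 j' by rewrite e1 // mul1r.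
  have {}e2 : x 0 i = - x 0 j' by rewrite e2 // mulN1r.
  by apply/eqP; rewrite -eqNr {1}e2 opprK e1.
case: s t => [[b i]|] [[c j]|] //=.
- have [<- e|ij] := eqVneq i j.
    have [->//|bc] := eqVneq b c.
    have vi : v`_i = 0 by case: b c bc e => [] [] //= _; lia.
    by rewrite z // !mulr0.
  move=> e; have := Lx i j (b (+) c) ij.
  rewrite signr_addb => ->; last by case: b c e => [] [] /=; rewrite ?expr0 ?expr1; lia.
  by rewrite signr_addb -mulrA signrMK.
- by move=> e; rewrite z ?mulr0 //; case: b e => /=; lia.
- by move=> e; rewrite z ?mulr0 //; case: c e => /=; lia.
Qed.

(** A generic point of [Lker v]: its coordinates are the labels themselves, so it separates any two
    different labels. *)
Definition rowv v : 'rV[R]_n := \row_i (v`_i)%:~R.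

Lemma rowv_Lker v : Lker v (rowv v).
Proof. by move=> i j b _ e; rewrite !mxE e intrM rmorphXn rmorphN. Qed.

Lemma xcoord_rowv v s : xcoord (rowv v) s = (vval v s)%:~R.
Proof.
case: s => [[[] i]|] //=; rewrite mxE ?expr0 ?expr1 ?mul1r ?mulN1r //.
by rewrite rmorphN.
Qed.

Lemma Part_Lker v : size v = n -> count_mem 0 v != 1%N -> Part (Lker v) = ker_partition v.
Proof.
move=> sv cv; apply: equivalence_partition_ker_partition => s t.
apply/asboolP/eqP => [/(_ _ (@rowv_Lker v))|e x Lx]; last exact: Lker_xcoord e.
by rewrite !xcoord_rowv => /intr_inj.
Qed.

(** From [L] to labels: each element is labelled by the member of its block of least absolute value.
    This choice is unique, hence odd: two different minimisers would be opposite, so their block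
    would contain 0, which is smaller. *)
Lemma classical_ker_partition P : classical_partition R P <->
  exists v, [/\ size v = n, count_mem 0 v != 1%N & P = ker_partition v].
Proof.
split=> [[L [H hH eL] ->]|[v [sv cv ->]]]; last first.
  by exists (Lker v); [exact: Lker_intersection|rewrite Part_Lker].
pose E s t := `[< forall x, L x -> xcoord x s = xcoord x t >].
have Es s : E s s by apply/asboolP.
have Esym s t : E s t -> E t s by move/asboolP => h; apply/asboolP => x /h.
have Etr s t u : E s t -> E t u -> E s u.
  by move=> /asboolP h1 /asboolP h2; apply/asboolP => x Lx; rewrite h1 // h2.
have Eopp s t : E s t -> E (oppL s) (oppL t).
  by move=> /asboolP h; apply/asboolP => x Lx; rewrite !xcoord_opp h.
have E0 s : E s (oppL s) -> E s None.
  move=> /asboolP h; apply/asboolP => x /h; rewrite xcoord_opp /= => /eqP.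
  by rewrite eq_sym eqNr => /eqP.
pose rep s := [arg min_(t < s | E s t) `|ival t|%N]%N.
have repP s : E s (rep s) /\ forall u, E s u -> (`|ival (rep s)| <= `|ival u|)%N.
  by rewrite /rep; case: arg_minnP => // t.
have repU s t : E s t -> (forall u, E s u -> (`|ival t| <= `|ival u|)%N) -> t = rep s.
  move=> st mt; have [sr mr] := repP s.
  have e : `|ival t|%N = `|ival (rep s)|%N by apply/eqP; rewrite eqn_leq mt // mr.
  have [/ival_inj //|e2] : ival t = ival (rep s) \/ ival t = - ival (rep s) by lia.
  have e3 : t = oppL (rep s) by apply: ival_inj; rewrite ival_opp.
  have r0 : E (rep s) None.
    by apply: E0; rewrite -e3; apply: Etr st; apply: Esym.
  have := mr _ (Etr _ _ _ sr r0); rewrite /= => r00.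
  by apply: ival_inj; lia.
have repE s t : E s t -> rep s = rep t.
  move=> st; apply: repU => [|u tu]; last by apply: (repP s).2; apply: Etr tu.
  by apply: Etr (repP s).1; apply: Esym.
have rep_opp s : oppL (rep s) = rep (oppL s).
  apply: repU => [|u su]; first by apply: Eopp; exact: (repP s).1.
  rewrite ival_opp abszN; have := (repP s).2 (oppL u); rewrite ival_opp abszN.
  by apply; rewrite -[s]oppLK; apply: Eopp.
pose v := [seq ival (rep (Some (false, i))) | i <- enum 'I_n].
have sv : size v = n by rewrite size_map size_enum_ord.
have vi (i : 'I_n) : v`_i = ival (rep (Some (false, i))).
  by rewrite (nth_map i) ?size_enum_ord // nth_ord_enum.
have vE s : vval v s = ival (rep s).
  case: s => [[[] i]|] //=; rewrite ?vi //.
    by rewrite -ival_opp rep_opp.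
  by have := rep_opp None; case: (rep None) => [[[] i]|].
exists v; split=> //.
  apply/(count_neq1P 0) => i iv vi0.
  rewrite sv in iv; pose i' := Ordinal iv.
  have vE0 (j : 'I_n) : (v`_j = 0) <-> E (Some (false, j)) None.
    rewrite vi; split=> [e|e].
      by rewrite -[None](@ival_inj (rep (Some (false, j))) None) //; exact: (repP _).1.
    by have := (repP (Some (false, j))).2 _ e => /=; lia.
  have Ei0 : E (Some (false, i')) None by apply/vE0.
  have [//|nj] := pselect (exists j, [/\ (j < size v)%N, j != i & v`_j = 0]).
  have nz (j : 'I_n) : j != i' -> ~ E (Some (false, j)) None.
    by move=> ji /vE0 vj; apply: nj; exists j; rewrite sv ltn_ord.
  (* The unit vector of the lone zero coordinate [i']. A hyperplane of [H] involving [i'] would make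
     its other coordinate vanish on [L] too, so there is none and [d] lies in [L]. *)
  pose d : 'rV[R]_n := \row_j (j == i')%:R.
  have Ld : L d.
    rewrite eL => -[[a b] e] /= hin; rewrite /hyperplane /= !mxE.
    have ab := hH _ hin; rewrite /= in ab.
    have Lh x : L x -> x 0 a = (-1) ^+ e * x 0 b by rewrite eL => /(_ _ hin).
    have Li x : L x -> x 0 i' = 0.
      by move/asboolP: Ei0 => h /h; rewrite /= expr0 mul1r.
    have [ai|_] := eqVneq a i'; last have [bi|_] := eqVneq b i'; last by rewrite mulr0.
      case: (@nz b); first by apply: contra ab => /eqP ->; rewrite ai.
      apply/asboolP => x Lx; have := Lh _ Lx; rewrite ai (Li _ Lx) /= => e0.
      by rewrite expr0 mul1r -[LHS](signrMK e) -e0 mulr0.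
    case: (@nz a); first by apply: contra ab => /eqP ->; rewrite bi.
    by apply/asboolP => x Lx; have := Lh _ Lx; rewrite bi (Li _ Lx) mulr0 /= expr0 mul1r.
  move/asboolP: Ei0 => /(_ _ Ld); rewrite /= mxE eqxx expr0 mul1r => /eqP.
  by rewrite oner_eq0.
apply: equivalence_partition_ker_partition => s t; rewrite !vE.
apply/idP/eqP => [/repE -> //|/ival_inj e].
apply: (Etr _ _ _ (repP s).1); rewrite e; apply: Esym; exact: (repP t).1.
Qed.

Lemma signed_perm_comp p q e x :
  signed_perm q e (signed_perm p finset.set0 x) = signed_perm (q * p)%g e x.
Proof. by apply/rowP => i; rewrite !mxE inE expr0 mul1r permM. Qed.

Lemma orbitD_perm_sub L p : (orbitD (signed_perm p finset.set0 @` L) `<=` orbitD L)%classic.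
Proof.
move=> L' [q [e oe ->]]; exists (q * p)%g, e => //.
rewrite image_comp; apply: eq_imagel => x _ /=; exact: signed_perm_comp.
Qed.

Lemma orbitD_perm L p : orbitD (signed_perm p finset.set0 @` L)%classic = orbitD L.
Proof.
apply/seteqP; split; first exact: orbitD_perm_sub.
have {1}-> : L = (signed_perm p^-1 finset.set0 @` (signed_perm p finset.set0 @` L))%classic.
  rewrite image_comp -[LHS]image_id; apply: eq_imagel => x _ /=.
  by rewrite signed_perm_comp mulVg; apply/rowP => i; rewrite !mxE inE expr0 mul1r perm1.
exact: orbitD_perm_sub.
Qed.

(** A permutation of the labels is a permutation of coordinates with no sign change at all, so the
    number of sign changes is even. *)
Lemma perm_same_type v v' : size v = n -> count_mem 0 v != 1%N -> perm_eq v' v ->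
  same_type R (ker_partition v) (ker_partition v').
Proof.
move=> sv cv pv.
have sv' : size v' = n by rewrite (perm_size pv).
have cv' : count_mem 0 v' != 1%N by rewrite (elimT seq.permP pv).
have [p ep] : exists p : 'S_n, forall i : 'I_n, v'`_i = v`_(p i).
  move/eqP: (sv) => sv2; have := pv; rewrite -[v]/(val (Tuple sv2)).
  case/tuple_permP => p e; exists p => i.
  have := congr1 (fun x : seq int => x`_i) e.
  rewrite (nth_map i) ?size_enum_ord // nth_ord_enum => ->.
  by rewrite (tnth_nth 0).
exists (orbitD (Lker v)); split.
  by exists (Lker v); [exact: Lker_intersection|rewrite Part_Lker].
exists (Lker v'); first exact: Lker_intersection.
rewrite Part_Lker //; split=> //.
have -> : Lker v' = (signed_perm p finset.set0 @` Lker v)%classic.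
  apply/seteqP; split=> [y Ly|_ [x Lx <-]].
    exists (\row_i y 0 (p^-1 i)%g).
      move=> i j b ij e; rewrite !mxE; apply: Ly; first by rewrite (inj_eq perm_inj).
      by rewrite !ep !permKV.
    by apply/rowP => i; rewrite !mxE inE expr0 mul1r permK.
  move=> i j b ij; rewrite !ep !mxE !inE !expr0 !mul1r.
  by apply: Lx; rewrite (inj_eq perm_inj).
by rewrite orbitD_perm.
Qed.
End Real.
End Kernel.

(** * Noncrossing partitions as words *)

Lemma edge_ker_partition n (lt : rel (Lam n)) v s s' : edge lt (ker_partition n v) s s' <->
  [/\ lt s s', vval v s = vval v s' &
      forall u, vval v u = vval v s -> ~~ (lt s u && lt u s')].
Proof.
rewrite /edge; split=> [/andP[ss' /exists_inP[B /ker_partitionP[t ->]]]|[ss' e h]].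
  rewrite !inE => /and3P[/eqP e /eqP e' /forall_inP h]; split=> // [|u eu].
    by rewrite e.
  by apply: h; rewrite inE eu e.
rewrite ss'; apply/exists_inP; exists [set t | vval v t == vval v s]%SET.
  by apply/ker_partitionP; exists s.
rewrite !inE eqxx -e eqxx /=; apply/forall_inP => u; rewrite inE => /eqP; exact: h.
Qed.

(** Occurrences are replaced by nearest ones: the last and first [a] around a [b], then the last and
    first [b] around the second [a]. Both pairs become consecutive and still cross. *)
Lemma crossing_edges (T : eqType) (a b : T) x : a != b -> subseq [:: a; b; a; b] x ->
  exists u1 s1 s2 t1 t2, [/\ x = u1 ++ a :: s1 ++ b :: s2 ++ a :: t1 ++ b :: t2,
    a \notin s1 ++ b :: s2 & b \notin s2 ++ a :: t1].
Proof.
move=> ab /(subseq_split4 (x := [::]) (y := x)).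
have cons2 (c : T) s y : subseq (c :: s) y -> exists y1 y2, y = y1 ++ c :: y2 /\ subseq s y2.
  elim: y => //= d y IH; have [<- h|cd /IH[y1 [y2 [-> h]]]] := eqVneq d c.
    by exists [::], y.
  by exists (d :: y1), y2.
case=> [|[]//|[]//|[[]//|//]] /cons2[x1 [x2 [-> /cons2[x3 [x4 [-> ]]]]]].
move=> /cons2[x5 [x6 [-> ]]]; rewrite sub1seq => bx6.
have /split_last[u1 [u2 [eu au2]]] : a \in x1 ++ a :: x3 by rewrite mem_cat mem_head orbT.
have /split_first[v1 [v2 [ev av1]]] : a \in x5 ++ a :: x6 by rewrite mem_cat mem_head orbT.
have bv2 : b \in v2.
  have : x6 = v2 \/ exists z, v2 = z ++ a :: x6.
    elim: x5 v1 ev av1 {bx6} => [|c x5 IH] [|d v1] /=.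
    - by case=> ->; left.
    - by case=> <-; rewrite mem_head.
    - by case=> _ <-; right; exists x5.
    - by case=> <- e; rewrite inE negb_or => /andP[_]; exact: IH e.
  by case=> [<- //|[z ->]]; rewrite mem_cat inE bx6 !orbT.
have /split_last[s1 [s2 [es bs2]]] : b \in u2 ++ b :: v1 by rewrite mem_cat mem_head orbT.
have [t1 [t2 [et bt1]]] := split_first bv2.
exists u1, s1, s2, t1, t2; split.
- have -> : x1 ++ a :: x3 ++ b :: x5 ++ a :: x6 = (x1 ++ a :: x3) ++ b :: (x5 ++ a :: x6).
    by rewrite -catA.
  rewrite eu ev -catA /= -[b :: v1 ++ _]/((b :: v1) ++ _) catA es et.
  by rewrite -!catA.
- by rewrite -es mem_cat inE !negb_or au2 ab av1.
- by rewrite mem_cat inE !negb_or bs2 eq_sym ab bt1.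
Qed.

Lemma map_cat_split (T U : Type) (f : T -> U) s x1 a x2 :
  map f s = x1 ++ a :: x2 -> exists s1 z s2,
    [/\ s = s1 ++ z :: s2, map f s1 = x1, f z = a & map f s2 = x2].
Proof.
elim: x1 s => [|c x1 IH] [|z s] //= [].
  by move=> <- <-; exists [::], z, s.
by move=> <- /IH[s1 [z' [s2 [-> <- <- <-]]]]; exists (z :: s1), z', s2.
Qed.

Lemma index_between (T : eqType) (X Y Z : seq T) A C z :
  let s := X ++ A :: Y ++ C :: Z in uniq s ->
  index A s < index z s < index C s -> z \in Y.
Proof.
move=> s; rewrite /s cat_uniq /= has_cat /= !negb_or mem_cat inE !negb_or cat_uniq /=.
rewrite !negb_or.
move=> /and4P[_ /and4P[AX YX CX ZX] /and3P[AY AC AZ] /and4P[_ /andP[CY _] _ _]].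
rewrite !index_cat /= (negbTE AX) (negbTE CX) eqxx (negbTE AC) !index_cat.
rewrite (negbTE CY) /= eqxx addn0.
have := index_mem z X; case: (z \in X); first by lia.
case: eqVneq => [|_]; first by lia.
by case: (z \in Y) => //; lia.
Qed.

Lemma index_after (T : eqType) (X Y : seq T) A z :
  let s := X ++ A :: Y in uniq s -> z \in Y -> index A s < index z s.
Proof.
move=> s; rewrite /s cat_uniq /= !negb_or => /and3P[_ /andP[AX YX] /andP[AY _]] zY.
rewrite !index_cat (negbTE AX) /= eqxx.
have /negbTE -> : z \notin X by apply: contra YX => zX; apply/hasP; exists z.
case: eqVneq => [e|]; first by rewrite e zY in AY.
by lia.
Qed.

Lemma subseq_index4 (T : eqType) (a b c d : T) s :
  a \in s -> b \in s -> c \in s -> d \in s ->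
  index a s < index b s -> index b s < index c s -> index c s < index d s ->
  subseq [:: a; b; c; d] s.
Proof.
have step (e : T) t j : (e \in s) -> j <= index e s -> subseq t (drop (index e s).+1 s) ->
    subseq (e :: t) (drop j s).
  move=> es js ts; rewrite -(cat_take_drop (index e s - j) (drop j s)).
  rewrite drop_drop subnK //.
  apply: (subseq_trans _ (suffix_subseq _ _)).
  by rewrite (drop_nth e) ?index_mem // nth_index //= eqxx.
move=> a_s b_s c_s d_s ab bc cd; rewrite -[s]drop0.
by do 4!(apply: (step) => //); rewrite sub0seq.
Qed.

Section NonCrossing.
Variable n : nat.
Implicit Types (s t u : Lam n) (v : seq int).
Local Open Scope ring_scope.

(* The label of the integer [z]. *)
Definition zval v (z : int) : int := sgz z * v`_(`|z|%N.-1).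

Lemma zval_ival v s : zval v (ival s) = vval v s.
Proof.
case: s => [[[] i]|]; rewrite /zval.
- rewrite (_ : ival _ = - (i.+1)%:Z) ?sgzN ?abszN //=; first by rewrite mulN1r.
  by rewrite expr1 mulN1r.
- rewrite (_ : ival _ = (i.+1)%:Z) //=; first by rewrite mul1r.
  by rewrite expr0 mul1r.
- by rewrite /= sgz0 mul0r.
Qed.

(** Tightened patterns are edges. Conversely, crossing edges carry different labels, since the
    second starts strictly inside the first, where the block of the first has no element. *)
Lemma noncrossing_word_iff v (W : seq int) : uniq W ->
  (forall z, z \in W -> exists s : Lam n, ival s = z) ->
  noncrossing (lt_word (n := n) W) (ker_partition n v) <-> noncross (map (zval v) W).
Proof.
move=> uW hW; split=> [nc a b ab|nc a b c d ab bc cd [/edge_ker_partition[_ ac hac]]].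
  apply/negP => /(crossing_edges ab)[u1 [s1 [s2 [t1 [t2 [e a_s b_s]]]]]].
  have [U1 [A [V1 [eW _ fA e1]]]] := map_cat_split e.
  have [S1 [B [V2 [eV1 fS1 fB e2]]]] := map_cat_split e1.
  have [S2 [C [V3 [eV2 fS2 fC e3]]]] := map_cat_split e2.
  have [T1 [D [T2 [eV3 fT1 fD _]]]] := map_cat_split e3.
  subst V1 V2 V3.
  have inW z : z \in [:: A; B; C; D] -> z \in W.
    rewrite eW !(inE, mem_cat).
    by move=> /or4P[] ->; rewrite ?orbT.
  have [A' eA] := hW A (inW A ltac:(by rewrite !inE eqxx ?orbT)).
  have [B' eB] := hW B (inW B ltac:(by rewrite !inE eqxx ?orbT)).
  have [C' eC] := hW C (inW C ltac:(by rewrite !inE eqxx ?orbT)).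
  have [D' eD] := hW D (inW D ltac:(by rewrite !inE eqxx ?orbT)).
  have AB : (index A W < index B W)%N.
    by rewrite eW; apply: index_after; rewrite -?eW // mem_cat mem_head orbT.
  have BC : (index B W < index C W)%N.
    move: uW; rewrite eW -cat_rcons catA => uW.
    by apply: index_after; rewrite // mem_cat mem_head orbT.
  have CD : (index C W < index D W)%N.
    move: uW; rewrite eW -cat_rcons catA -[_ ++ B :: S2 ++ _]cat_rcons catA => uW.
    by apply: index_after; rewrite // mem_cat mem_head orbT.
  apply: (nc A' B' C' D'); rewrite /lt_word ?eA ?eB ?eC ?eD;
    rewrite ?AB ?BC ?CD ?inW ?inE ?eqxx ?orbT //.
  split; apply/edge_ker_partition; rewrite /lt_word -!zval_ival ?eA ?eB ?eC ?eD.
    split; rewrite ?fA ?fC //.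
      by rewrite !inW ?inE ?eqxx ?orbT // (ltn_trans AB).
    move=> u; rewrite -zval_ival => fu; apply/negP => /andP[/and3P[_ uW' lt1] /and3P[_ _ lt2]].
    have : ival u \in S1 ++ B :: S2.
      apply: (@index_between _ U1 _ (T1 ++ D :: T2) A C); rewrite -!catA /= -?catA /= -?eW //.
      by rewrite lt1 lt2.
    move/(map_f (zval v)); rewrite map_cat /= fS1 fB fS2 fu.
    by rewrite (negbTE a_s).
  split; rewrite ?fB ?fD //.
    by rewrite !inW ?inE ?eqxx ?orbT // (ltn_trans BC).
  move=> u; rewrite -zval_ival => fu; apply/negP => /andP[/and3P[_ uW' lt1] /and3P[_ _ lt2]].
  have : ival u \in S2 ++ C :: T1.
    have eW2 : W = (U1 ++ A :: S1) ++ B :: (S2 ++ C :: T1) ++ D :: T2.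
      by rewrite eW -!catA /= -?catA.
    move: uW lt1 lt2; rewrite eW2 => uW lt1 lt2.
    by apply: (index_between uW); rewrite lt1 lt2.
  move/(map_f (zval v)); rewrite map_cat /= fS2 fC fT1 fu.
  by rewrite (negbTE b_s).
move=> /edge_ker_partition[_ bd _].
have nab : vval v a != vval v b.
  by apply/negP => /eqP e; have := hac b (esym e); rewrite ab bc.
have /negP[] := nc _ _ nab.
case/and3P: ab => aW bW ab; case/and3P: bc => _ cW bc; case/and3P: cd => _ dW cd.
have := subseq_index4 aW bW cW dW ab bc cd => /(map_subseq (zval v)) /=.
by rewrite !zval_ival -ac -bd.
Qed.

Definition sym (h : seq int) := [seq - k | k <- h] ++ h.
Definition ins j (e : int) (w : seq int) := take j w ++ e :: drop j w.

(** Position [p] of [w] stands for the element [p + 2], so inserting after the element [c] means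
    inserting after [c.-1] letters. *)
Lemma zval_noncrossing_word y1 w c e : size w = n.-1 -> (2 <= c <= n)%N ->
  (e == 1) || (e == -1) ->
  map (zval (y1 :: w)) (noncrossing_word n c e) = sym (ins c.-1 (e * y1) w).
Proof.
move=> sw cn e1.
have ez : zval (y1 :: w) e = e * y1 by rewrite /zval; case/orP: e1 => /eqP ->.
have zp k : (2 <= k)%N -> zval (y1 :: w) k%:Z = w`_(k - 2).
  by case: k => [|[|k]] // _; rewrite /zval (_ : sgz _ = 1) // mul1r subn2.
have zN z : zval (y1 :: w) (- z) = - zval (y1 :: w) z.
  by rewrite /zval sgzN abszN mulNr.
have e0 : map (zval (y1 :: w)) ([seq k%:Z | k <- iota 2 c.-1]
             ++ e :: [seq k%:Z | k <- iota c.+1 (n - c)]) = ins c.-1 (e * y1) w.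
  rewrite map_cat /= ez /ins -!map_comp; congr (_ ++ _ :: _).
    apply: (@eq_from_nth _ 0); rewrite size_map size_iota; first by rewrite size_takel // sw; lia.
    move=> i ic; rewrite (nth_map 0%N) ?size_iota // nth_iota //= zp; last by lia.
    by rewrite nth_take //; congr nth; lia.
  apply: (@eq_from_nth _ 0); rewrite size_map size_iota; first by rewrite size_drop sw; lia.
  move=> i ic; rewrite (nth_map 0%N) ?size_iota // nth_iota //= zp; last by lia.
  by rewrite nth_drop; congr nth; lia.
rewrite /noncrossing_word map_cat e0 /sym; congr (_ ++ _).
by rewrite -e0 -!map_comp; apply: eq_map => z /=; rewrite zN.
Qed.

Lemma noncrossing_word_uniq c e : (2 <= c <= n)%N -> (e == 1) || (e == -1) ->
  uniq (noncrossing_word n c e).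
Proof.
move=> cn e1; rewrite /noncrossing_word.
set h := _ ++ _ :: _.
have nh z : z \in h -> (z == e) || (2 <= z)%R.
  rewrite mem_cat inE => /or3P[/mapP[k + ->]|->//|/mapP[k + ->]]; rewrite mem_iota => hk;
  apply/orP; right; lia.
have uh : uniq h.
  rewrite cat_uniq /= !map_inj_uniq ?iota_uniq /=; try by move=> ? ? [].
  rewrite negb_or andbT -andbA; apply/and3P; split.
  - by apply/negP => /mapP[k]; rewrite mem_iota; case/orP: e1 => /eqP ->; lia.
  - apply/hasPn => z /mapP[k + ->]; rewrite mem_iota => hk.
    by apply/negP => /mapP[k']; rewrite mem_iota; lia.
  - by apply/negP => /mapP[k]; rewrite mem_iota; case/orP: e1 => /eqP ->; lia.
rewrite cat_uniq uh map_inj_uniq ?uh ?andbT /=; last exact: oppr_inj.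
apply/hasPn => z zh; apply/negP => /mapP[z' /nh zh' e2].
have := nh _ zh; case/orP: e1 zh' => /eqP ->; lia.
Qed.

Lemma noncrossing_word_ival c e z : (2 <= c <= n)%N -> (e == 1) || (e == -1) ->
  z \in noncrossing_word n c e -> exists s : Lam n, ival s = z.
Proof.
move=> cn e1 zW.
have {zW} zb : (1 <= `|z| <= n)%N.
  rewrite mem_cat in zW.
  have h k : k \in [seq k%:Z | k <- iota 2 c.-1] ++ e :: [seq k%:Z | k <- iota c.+1 (n - c)] ->
     (1 <= `|k| <= n)%N.
    rewrite mem_cat inE => /or3P[/mapP[i + ->]|/eqP ->|/mapP[i + ->]]; rewrite ?mem_iota; try lia.
  by case/orP: zW => [/mapP[k /h hk ->]|/h //]; rewrite abszN.
have zn : (`|z|.-1 < n)%N by lia.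
exists (Some (z < 0, Ordinal zn)) => /=.
by case: ltP => z0; rewrite ?expr0 ?expr1; lia.
Qed.

Definition ncword y1 w := exists j, [/\ (1 <= j <= size w)%N,
  noncross (sym (ins j y1 w)) & noncross (sym (ins j (- y1) w))].

Lemma ncword_iff y1 w : size w = n.-1 ->
  (exists2 c : nat, (2 <= c <= n)%N
    & noncrossing (lt_word (noncrossing_word n c 1)) (ker_partition n (y1 :: w)) /\
      noncrossing (lt_word (noncrossing_word n c (-1))) (ker_partition n (y1 :: w)))
  <-> ncword y1 w.
Proof.
move=> sw; split.
  case=> c cn [].
  rewrite !noncrossing_word_iff; try exact: noncrossing_word_uniq;
    try by move=> z; exact: noncrossing_word_ival.
  rewrite !zval_noncrossing_word // mul1r mulN1r => h1 h2.
  by exists c.-1; split=> //; lia.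
case=> j [jn h1 h2]; exists j.+1; first by lia.
rewrite !noncrossing_word_iff; try (apply: noncrossing_word_uniq => //; lia);
  try (move=> z; apply: noncrossing_word_ival => //; lia).
by rewrite !zval_noncrossing_word //=; try lia; rewrite mul1r mulN1r.
Qed.
End NonCrossing.

(** * Nonnesting partitions as words *)

Section Letters.
Variables (y1 : int) (w : seq int).
Local Open Scope ring_scope.

(* [w]`_p is the label of p + 2, and [y1] the label of 1. A main letter labels a
   switching block avoiding 1 and -1. *)
Definition main_letter l := [&& l \in w, - l \in w, l != y1 & l != - y1].
Definition one_letter l := (l \in w) && ((l == y1) || (l == - y1)).

(** The clauses forbid, in order, the nesting of two edges between positives, of such an edge under
    one ending at the first occurrence of a switching letter, of two edges from negative to
    positive, and of an edge leaving 1 or -1 under one from negative to positive. Negation reduces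
    the other nestings to these; edges leaving 1 and -1 never nest, as 1 and -1 are incomparable. *)
Definition nnword := [/\ nonnest w,
  forall l, main_letter l || one_letter l -> uniq (take (index l w) w),
  forall l l', main_letter l -> main_letter l' ->
    (index l w < index l' w)%N -> (index (- l') w < index (- l) w)%N
  & forall l e, main_letter l -> one_letter e -> (index l w < index e w)%N].

Lemma main_letterN l : main_letter (- l) = main_letter l.
Proof.
rewrite /main_letter opprK [- l == - y1]eqr_opp eqr_oppLR.
by rewrite andbCA [X in _ && (_ && X)]andbC.
Qed.
End Letters.

Section Positional.
Variable T : eqType.
Variable x0 : T.
Implicit Types x : seq T.

Lemma index_nth_le x i : i < size x -> index (nth x0 x i) x <= i.
Proof.
elim: x i => // a x IH [|i] //=; first by rewrite eqxx.
by case: ifP => // _ /IH.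
Qed.

Lemma next_occ x i j : i < j -> j < size x -> nth x0 x i = nth x0 x j ->
  exists k, [/\ i < k, k <= j, nth x0 x k = nth x0 x i &
    forall r, i < r -> r < k -> nth x0 x r != nth x0 x i].
Proof.
move=> ij jx e.
have ex : exists k, (i < k) && (nth x0 x k == nth x0 x i) by exists j; rewrite ij e eqxx.
case: (ex_minnP ex) => k /andP[ik /eqP ek] mk; exists k; split=> //.
  by apply: mk; rewrite ij e eqxx.
move=> r ir rk; apply/negP => /eqP er.
by have := mk r; rewrite ir er eqxx => /(_ isT); rewrite leqNgt rk.
Qed.

Lemma nonnest_nthP x : nonnest x <->
  forall i j j' i', i < j -> j < j' -> j' < i' -> i' < size x ->
   nth x0 x i = nth x0 x i' -> (forall r, i < r -> r < i' -> nth x0 x r != nth x0 x i) ->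
   nth x0 x j != nth x0 x j'.
Proof.
split=> [nn i j j' i' ij jj' j'i' i's e h|h x1 x2 x3 a ex ax2].
  have ex : x = take i x ++ nth x0 x i :: (drop i.+1 (take i' x)) ++ nth x0 x i :: drop i'.+1 x.
    rewrite -{1}(cat_take_drop i x); congr cat.
    rewrite (drop_nth x0); last by lia.
    congr cons; rewrite -{1}(cat_take_drop i' x) drop_cat size_take i's.
    have -> : i.+1 < i' by lia.
    by congr cat; rewrite (drop_nth x0) // e.
  have ni : nth x0 x i \notin drop i.+1 (take i' x).
    apply/negP => /(nthP x0)[r]; rewrite size_drop size_take i's => ri.
    rewrite nth_drop nth_take; last by lia.
    by move/eqP; apply/negP; apply: h; lia.
  have := nn _ _ _ _ ex ni => /(uniqP x0)/(_ (j - i.+1) (j' - i.+1)).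
  rewrite !inE !size_drop size_take i's !nth_drop !nth_take; try lia.
  have -> : i.+1 + (j - i.+1) = j by lia.
  have -> : i.+1 + (j' - i.+1) = j' by lia.
  move=> u; apply/negP => /eqP e'.
  suff: (j - i.+1 = j' - i.+1) by lia.
  by apply: u => //; lia.
apply/(uniqP x0) => j j'; rewrite !inE.
wlog jj' : j j' / j < j'.
  move=> W jx j'x e; have [lt|lt|//] := ltngtP j j'; first exact: W.
  by apply/esym/W.
move=> jx j'x e.
have nx k : k < size x2 -> nth x0 x (size x1 + k.+1) = nth x0 x2 k.
  move=> kx; rewrite ex nth_cat ltnNge leq_addr /= addKn /= nth_cat kx.
  by [].
have na : nth x0 x (size x1) = a by rewrite ex nth_cat ltnn subnn.
have := h (size x1) (size x1 + j.+1) (size x1 + j'.+1) (size x1 + (size x2).+1).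
rewrite (nx j) // (nx j') // e eqxx na => F; suff: ~~ true by []; apply: F; try lia.
- by rewrite ex !size_cat /= size_cat /=; lia.
- by rewrite ex nth_cat ltnNge leq_addr /= addKn /= nth_cat ltnn subnn.
- move=> r r1 r2; have -> : r = size x1 + (r - size x1).-1.+1 by lia.
  rewrite nx; last by lia.
  by apply: contra ax2 => /eqP <-; rewrite mem_nth //; lia.
Qed.

Lemma uniq_take_index x a : uniq (take (index a x) x) <->
  forall j j', j < j' -> j' < index a x -> nth x0 x j != nth x0 x j'.
Proof.
have sz : size (take (index a x) x) = index a x by rewrite size_takel // index_size.
split=> [/(uniqP x0) u j j' jj' j'a|h].
  have := u j j'; rewrite !inE sz !nth_take //; last by lia.
  move=> v; apply/negP => /eqP e; suff: j = j' by lia.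
  by apply: v => //; lia.
apply/(uniqP x0) => j j'; rewrite !inE sz => ja j'a; rewrite !nth_take // => e.
have [lt|lt|//] := ltngtP j j'.
  by have := h _ _ lt j'a; rewrite e eqxx.
by have := h _ _ lt ja; rewrite e eqxx.
Qed.

Lemma neq_before_index x a r : a \in x -> r < index a x -> nth x0 x r != a.
Proof.
move=> ax ra; apply/negP => /eqP e.
have rx : r < size x by apply: leq_trans ra (index_size _ _).
by have := index_nth_le rx; rewrite e leqNgt ra.
Qed.

Lemma eq_indexP x a r : r < size x -> nth x0 x r = a ->
  (forall r', r' < r -> nth x0 x r' != a) -> index a x = r.
Proof.
move=> rx e h; have := index_nth_le rx; rewrite e leq_eqVlt => /orP[/eqP //|lt].
have := h _ lt; rewrite nth_index ?eqxx // -e mem_nth //.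
Qed.
End Positional.

Section NonNesting.
Variable m : nat.
Local Notation n := m.+1.
Implicit Types (s t u : Lam n) (p q r : nat).
Local Open Scope ring_scope.

(* The elements p + 2, -(p + 2), and 1 or -1. *)
Definition epos p : Lam n := Some (false, inord p.+1).
Definition eneg p : Lam n := Some (true, inord p.+1).
Definition eone b : Lam n := Some (b, ord0).

Variant LamSpec : Lam n -> Type :=
 | LamNone : LamSpec None
 | LamOne b : LamSpec (eone b)
 | LamPos p of (p < m)%N : LamSpec (epos p)
 | LamNeg p of (p < m)%N : LamSpec (eneg p).

Lemma LamP s : LamSpec s.
Proof.
case: s => [[b [[|i] i_n]]|]; last by constructor.
  rewrite (_ : Ordinal i_n = ord0); first by constructor.
  exact: val_inj.
rewrite (_ : Ordinal i_n = inord i.+1); last by apply: val_inj; rewrite /= inordK.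
by case: b; constructor.
Qed.

Lemma oppL_pos p : oppL (epos p) = eneg p. Proof. by []. Qed.
Lemma oppL_neg p : oppL (eneg p) = epos p. Proof. by []. Qed.
Lemma oppL_one b : oppL (eone b) = eone (~~ b). Proof. by []. Qed.

Lemma ival_pos p : (p < m)%N -> ival (epos p) = (p.+2)%:Z.
Proof. by move=> pm; rewrite /= inordK // expr0 mul1r. Qed.
Lemma ival_neg p : (p < m)%N -> ival (eneg p) = - (p.+2)%:Z.
Proof. by move=> pm; rewrite /= inordK // expr1 mulN1r. Qed.
Lemma ival_one b : ival (eone b) = (-1) ^+ b.
Proof. by rewrite /= mulr1. Qed.

Lemma lt_opp s t : lt_nonnesting (oppL t) (oppL s) = lt_nonnesting s t.
Proof.
by rewrite /lt_nonnesting !ival_opp; lia.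
Qed.

Section Word.
Variables (y1 : int) (w : seq int).
Hypothesis sw : size w = m.
Let v := y1 :: w.
Local Notation lt := (@lt_nonnesting n).
Local Notation E := (edge lt (ker_partition n v)).

Lemma vval_pos p : (p < m)%N -> vval v (epos p) = w`_p.
Proof. by move=> pm; rewrite /= inordK. Qed.
Lemma vval_neg p : (p < m)%N -> vval v (eneg p) = - w`_p.
Proof. by move=> pm; rewrite /= inordK. Qed.
Lemma vval_one b : vval v (eone b) = (-1) ^+ b * y1.
Proof. by case: b; rewrite /= ?expr0 ?expr1 ?mul1r ?mulN1r. Qed.
Lemma vval_oneE b : (vval v (eone b) == y1) || (vval v (eone b) == - y1).
Proof. by case: b; rewrite /= eqxx ?orbT. Qed.

Lemma lt_pp p q : (p < m)%N -> (q < m)%N -> lt (epos p) (epos q) = (p < q)%N.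
Proof. by move=> pm qm; rewrite /lt_nonnesting !ival_pos //; lia. Qed.
Lemma lt_nn p q : (p < m)%N -> (q < m)%N -> lt (eneg p) (eneg q) = (q < p)%N.
Proof. by move=> pm qm; rewrite /lt_nonnesting !ival_neg //; lia. Qed.
Lemma lt_np p q : (p < m)%N -> (q < m)%N -> lt (eneg p) (epos q).
Proof. by move=> pm qm; rewrite /lt_nonnesting ival_neg // ival_pos //; lia. Qed.
Lemma lt_pn p q : (p < m)%N -> (q < m)%N -> lt (epos p) (eneg q) = false.
Proof. by move=> pm qm; rewrite /lt_nonnesting ival_neg // ival_pos //; lia. Qed.
Lemma lt_op b q : (q < m)%N -> lt (eone b) (epos q).
Proof. by move=> qm; rewrite /lt_nonnesting ival_one ival_pos //; case: b; rewrite ?expr0 ?expr1; lia. Qed.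
Lemma lt_po b q : (q < m)%N -> lt (epos q) (eone b) = false.
Proof. by move=> qm; rewrite /lt_nonnesting ival_one ival_pos //; case: b; rewrite ?expr0 ?expr1; lia. Qed.
Lemma lt_no b q : (q < m)%N -> lt (eneg q) (eone b).
Proof. by move=> qm; rewrite /lt_nonnesting ival_one ival_neg //; case: b; rewrite ?expr0 ?expr1; lia. Qed.
Lemma lt_on b q : (q < m)%N -> lt (eone b) (eneg q) = false.
Proof. by move=> qm; rewrite /lt_nonnesting ival_one ival_neg //; case: b; rewrite ?expr0 ?expr1; lia. Qed.
Lemma lt_oo b c : lt (eone b) (eone c) = false.
Proof. by rewrite /lt_nonnesting !ival_one; case: b c => [] []; rewrite ?expr0 ?expr1; lia. Qed.
Lemma lt_0s s : lt None s = false. Proof. by []. Qed.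
Lemma lt_s0 s : lt s None = false. Proof. by rewrite /lt_nonnesting andbF. Qed.

Definition ltE := (lt_pp, lt_nn, lt_np, lt_pn, lt_op, lt_po, lt_no, lt_on, lt_oo, lt_0s, lt_s0).

Lemma edge_opp s t : E s t -> E (oppL t) (oppL s).
Proof.
case/edge_ker_partition=> st e h; apply/edge_ker_partition.
rewrite lt_opp !vval_opp e; split=> // u eu.
have := h (oppL u); rewrite vval_opp eu opprK e => /(_ erefl).
by rewrite -(lt_opp _ (oppL u)) -(lt_opp (oppL u)) oppLK andbC.
Qed.

Lemma edge_pos p q : (p < m)%N -> (q < m)%N -> E (epos p) (epos q) <->
  [/\ (p < q)%N, w`_p = w`_q & forall r, (p < r)%N -> (r < q)%N -> w`_r != w`_p].
Proof.
move=> pm qm; split=> [/edge_ker_partition|[pq e h]].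
  rewrite lt_pp // !vval_pos // => -[pq e h]; split=> // r pr rq.
  apply/negP => /eqP er; have rm := ltn_trans rq qm.
  by have := h (epos r); rewrite vval_pos // er !lt_pp // pr rq => /(_ erefl).
apply/edge_ker_partition; rewrite lt_pp // !vval_pos //; split=> // u.
case: (LamP u) => [|b|r rm|r rm]; rewrite ?ltE // ?andbF //.
by rewrite vval_pos // => er; apply/negP => /andP[pr rq]; have := h r pr rq; rewrite er eqxx.
Qed.

(** Between [-(p + 2)] and [q + 2] lie 1, -1, the smaller positives and the negatives closer to 0.
    So such an edge joins first occurrences, and its block avoids 1 and -1. *)
Lemma edge_cross p q : (p < m)%N -> (q < m)%N -> E (eneg p) (epos q) <->
  [/\ main_letter y1 w w`_q, q = index w`_q w & p = index (- w`_q) w].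
Proof.
move=> pm qm; split=> [/edge_ker_partition|[ml eq ep]].
  rewrite lt_np // vval_pos // vval_neg // => -[_ e h].
  have iq : index w`_q w = q.
    apply: (eq_indexP (x0 := 0)); rewrite ?sw // => r rq; apply/negP => /eqP er.
    have rm := ltn_trans rq qm.
    by have := h (epos r); rewrite vval_pos // er e lt_np // lt_pp // rq => /(_ erefl).
  have ip : index (- w`_q) w = p.
    apply: (eq_indexP (x0 := 0)); rewrite ?sw // -?e ?opprK // => r rp; apply/negP => /eqP er.
    have rm := ltn_trans rp pm.
    by have := h (eneg r); rewrite vval_neg // er lt_np // lt_nn // rp => /(_ erefl).
  split=> //; rewrite /main_letter -!index_mem iq ip sw pm qm /=.
  apply/andP; split; apply/negP => /eqP e1.
    have := h (eone false); rewrite vval_one expr0 mul1r -e1 e lt_no // lt_op //.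
    by move=> /(_ erefl).
  have := h (eone true); rewrite vval_one expr1 mulN1r -e1 e lt_no // lt_op //.
  by move=> /(_ erefl).
case/and4P: ml => lw nlw ly1 lny1.
apply/edge_ker_partition; rewrite lt_np // vval_pos // vval_neg //.
have e : w`_p = - w`_q by rewrite ep nth_index.
rewrite e opprK; split=> // u; case: (LamP u) => [|b|r rm|r rm]; rewrite ?ltE // ?andbF //.
- by move=> eb; have := vval_oneE b; rewrite eb (negbTE ly1) (negbTE lny1).
- rewrite vval_pos // => er; apply/negP; rewrite eq => rq.
  by have := neq_before_index 0 lw rq; rewrite er eqxx.
- rewrite vval_neg // andbT => er; apply/negP; rewrite ep => rp.
  by have := neq_before_index 0 nlw rp; rewrite -er opprK eqxx.
Qed.

(** Since 1 and -1 are incomparable, only positives lie strictly between the two ends. *)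
Lemma edge_one b q : (q < m)%N -> E (eone b) (epos q) <->
  vval v (eone b) = w`_q /\ q = index w`_q w.
Proof.
move=> qm; split=> [/edge_ker_partition|[e eq]].
  rewrite vval_pos // => -[_ e h]; split=> //; apply/esym.
  apply: (eq_indexP (x0 := 0)); rewrite ?sw // => r rq; apply/negP => /eqP er.
  have rm := ltn_trans rq qm.
  by have := h (epos r); rewrite vval_pos // er e lt_op // lt_pp // rq => /(_ erefl).
apply/edge_ker_partition; rewrite vval_pos // lt_op //; split=> // u.
case: (LamP u) => [|c|r rm|r rm]; rewrite ?ltE // ?andbF //.
rewrite vval_pos // => er; apply/negP; rewrite eq => /= rq.
have lw : w`_q \in w by rewrite mem_nth ?sw.
by have := neq_before_index 0 lw rq; rewrite er e eqxx.
Qed.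

Lemma nnword_iff : nonnesting lt (ker_partition n v) <-> nnword y1 w.
Proof.
split=> [nn|[n1 n2 n3 n4]].
  (* The position [j'] need not be the next occurrence after [j]; the next one, [k <= j'], gives the
     edge nested under that from [a] to [d]. *)
  have dup j j' a d : (j < j')%N -> (j' < m)%N -> w`_j = w`_j' -> lt a (epos j) ->
      (forall k, (j < k)%N -> (k <= j')%N -> lt (epos k) d) -> ~ E a d.
    move=> jj' j'm e aj hd ead; have [k [jk kj' ek hk]] := @next_occ _ 0 w j j' jj' ltac:(by rewrite sw) e.
    have km : (k < m)%N by lia.
    have jm : (j < m)%N by lia.
    apply: (nn a (epos j) (epos k) d) => //; [by rewrite lt_pp|exact: hd|].
    by split=> //; apply/edge_pos.
  have idx l : l \in w -> (index l w < m)%N by rewrite -sw index_mem.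
  have crossE l : main_letter y1 w l -> E (eneg (index (- l) w)) (epos (index l w)).
    by move=> ml; case/and4P: (ml) => lw nlw _ _; apply/edge_cross; rewrite ?idx // nth_index.
  have oneE l : one_letter y1 w l -> exists b, E (eone b) (epos (index l w)).
    case/andP=> lw /orP[] /eqP e; [exists false|exists true];
    by apply/edge_one; rewrite ?idx // nth_index // vval_one e ?expr0 ?expr1 ?mul1r ?mulN1r.
  split.
  - apply/(nonnest_nthP 0) => i j j' i' ij jj' j'i'; rewrite sw => i'm e h.
    apply/negP => /eqP ej.
    have j'm : (j' < m)%N by lia.
    apply: (dup j j' (epos i) (epos i') jj' j'm ej).
    + by rewrite lt_pp //; lia.
    + by move=> k jk kj'; rewrite lt_pp //; lia.
    + by apply/edge_pos; [lia|lia|split; [lia|exact: e|exact: h]].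
  - move=> l hl; apply/(uniq_take_index 0) => j j' jj' j'l; apply/negP => /eqP ej.
    have lm : (index l w < m)%N by case/orP: hl => [/and4P[]|/andP[]] /idx.
    have j'm : (j' < m)%N := ltn_trans j'l lm.
    have jm : (j < m)%N by lia.
    have kl k : (k <= j')%N -> (k < m)%N /\ (k < index l w)%N.
      by move=> kj'; split; [lia|exact: leq_ltn_trans j'l].
    case/orP: hl => [ml|/oneE[b eb]].
      have := crossE _ ml; apply: (dup j j' _ _ jj' j'm ej).
      + by case/and4P: ml => _ /idx *; rewrite lt_np.
      + by move=> k _ /kl[km kl']; rewrite lt_pp.
    move: eb; apply: (dup j j' _ _ jj' j'm ej).
    + by rewrite lt_op.
    + by move=> k _ /kl[km kl']; rewrite lt_pp.
  - move=> l l' ml ml' ll'; rewrite ltnNge leq_eqVlt; apply/negP.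
    case/and4P: (ml) => lw nlw _ _; case/and4P: (ml') => lw' nlw' _ _.
    case/orP=> [/eqP/(index_inj 0 nlw nlw')/oppr_inj e|lt2]; first by rewrite e ltnn in ll'.
    apply: (nn (eneg (index (- l') w)) (eneg (index (- l) w)) (epos (index l w)) (epos (index l' w)));
      rewrite ?ltE ?idx //.
    by split; apply: crossE.
  - move=> l e ml el; rewrite ltnNge leq_eqVlt; apply/negP.
    case/and4P: (ml) => lw nlw ly lny.
    case/andP: (el) => ew eor.
    case/orP=> [/eqP/(index_inj 0 ew lw) e'|lt2].
      by move: eor; rewrite e' (negbTE ly) (negbTE lny).
    have [b eb] := oneE _ el.
    apply: (nn (eneg (index (- l) w)) (eone b) (epos (index e w)) (epos (index l w)));
      rewrite ?ltE ?idx //.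
    by split=> //; apply: crossE.
have hP a q1 q2 q3 : (q1 < q2)%N -> (q2 < q3)%N -> (q3 < m)%N ->
    main_letter y1 w w`_q3 || one_letter y1 w w`_q3 -> q3 = index w`_q3 w ->
    E a (epos q3) -> E (epos q1) (epos q2) -> False.
  move=> q12 q23 q3m hl eq3 _; rewrite edge_pos; try lia; case=> _ e _.
  have := n2 _ hl => /(uniq_take_index 0)/(_ q1 q2 q12); rewrite -eq3 => /(_ q23).
  by rewrite e eqxx.
(* The letters [N], [O], [P] in these names give the kinds of [a], [b], [c], [d]: negative, 1 or -1,
   positive. Five of the nine possible patterns are treated; negation gives the other four. *)
have PPPP q0 q1 q2 q3 : (q0 < q1)%N -> (q1 < q2)%N -> (q2 < q3)%N -> (q3 < m)%N ->
    E (epos q0) (epos q3) -> E (epos q1) (epos q2) -> False.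
  move=> q01 q12 q23 q3m; rewrite !edge_pos; try lia; case=> _ e h [_ e' _].
  by move/(nonnest_nthP 0): n1 => /(_ q0 q1 q2 q3 q01 q12 q23); rewrite sw e' eqxx => /(_ q3m e h).
have oneL b q : (q < m)%N -> vval v (eone b) = w`_q -> one_letter y1 w w`_q.
  by move=> qm e; rewrite /one_letter mem_nth ?sw // -e vval_oneE.
have OPPP b q1 q2 q3 : (q1 < q2)%N -> (q2 < q3)%N -> (q3 < m)%N ->
    E (eone b) (epos q3) -> E (epos q1) (epos q2) -> False.
  move=> q12 q23 q3m ed; case/edge_one: (ed) => // e eq.
  by apply: hP ed => //; rewrite (oneL b) ?orbT.
have NPPP q0 q1 q2 q3 : (q0 < m)%N -> (q1 < q2)%N -> (q2 < q3)%N -> (q3 < m)%N ->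
    E (eneg q0) (epos q3) -> E (epos q1) (epos q2) -> False.
  move=> q0m q12 q23 q3m ed; case/edge_cross: (ed) => // ml eq _.
  by apply: hP ed => //; rewrite ml.
have NOPP q0 b q2 q3 : (q0 < m)%N -> (q2 < q3)%N -> (q3 < m)%N ->
    E (eneg q0) (epos q3) -> E (eone b) (epos q2) -> False.
  move=> q0m q23 q3m; rewrite edge_cross // edge_one; try lia; case=> ml eq _ [e eq'].
  have := n4 _ _ ml (oneL _ _ _ e); rewrite -eq -eq' => /(_ ltac:(lia)); lia.
have NNPP q0 q1 q2 q3 : (q1 < q0)%N -> (q0 < m)%N -> (q2 < q3)%N -> (q3 < m)%N ->
    E (eneg q0) (epos q3) -> E (eneg q1) (epos q2) -> False.
  move=> q10 q0m q23 q3m; rewrite !edge_cross; try lia; case=> ml eq eq' [ml2 eq2 eq2'].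
  by have := n3 _ _ ml2 ml; rewrite -eq -eq' -eq2 -eq2' => /(_ q23); lia.
have opp a b : E a b -> E (oppL b) (oppL a) := @edge_opp a b.
move=> a b c d ab bc cd [ead ebc].
have := opp _ _ ebc; have := opp _ _ ead; move: ab bc cd ead ebc.
case: (LamP a) => [|b0|q0 q0m|q0 q0m]; case: (LamP b) => [|b1|q1 q1m|q1 q1m];
  rewrite ?ltE //.
all: case: (LamP c) => [|b2|q2 q2m|q2 q2m]; rewrite ?ltE //.
all: case: (LamP d) => [|b3|q3 q3m|q3 q3m]; rewrite ?ltE //.
all: rewrite ?oppL_pos ?oppL_neg ?oppL_one => h1 h2 h3 e1 e2 e3 e4.
- exact: (OPPP _ _ _ _ h2 h3 q3m e1 e2).
- exact: (PPPP _ _ _ _ h1 h2 h3 q3m e1 e2).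
- exact: (NOPP _ _ _ _ q0m h3 q3m e1 e2).
- exact: (NPPP _ _ _ _ q0m h2 h3 q3m e1 e2).
- exact: (NOPP _ _ _ _ q3m h1 q0m e3 e4).
- exact: (NNPP _ _ _ _ h1 q0m h3 q3m e1 e2).
- exact: (OPPP _ _ _ _ h2 h1 q0m e3 e4).
- exact: (NPPP _ _ _ _ q3m h2 h1 q0m e3 e4).
- exact: (PPPP _ _ _ _ h3 h2 h1 q0m e3 e4).
Qed.
End Word.
End NonNesting.

(** * Words preceded by a list of switching letters *)

Lemma noncross_map (T U : eqType) (f : T -> U) x :
  {in x &, injective f} -> noncross x -> noncross (map f x).
Proof.
move=> inj nc a b ab; apply/negP => /subseqP[k sk]; rewrite -map_mask.
have : subseq (mask k x) x by rewrite mask_subseq.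
case: (mask k x) => [|a1 [|b1 [|a2 [|b2 [|? ?]]]]] //= sub [ea1 eb1 ea2 eb2].
have inx c : c \in [:: a1; b1; a2; b2] -> c \in x by apply: mem_subseq.
have ea : a1 = a2 by apply: inj; rewrite ?inx ?inE ?eqxx ?orbT // -ea1.
have eb : b1 = b2 by apply: inj; rewrite ?inx ?inE ?eqxx ?orbT // -eb1.
have ab1 : a1 != b1 by apply: contra ab => /eqP e; rewrite ea1 eb1 e.
by have := nc _ _ ab1; rewrite {2}ea {2}eb sub.
Qed.

Lemma nonnest_map (T U : eqType) (f : T -> U) x :
  {in x &, injective f} -> nonnest x -> nonnest (map f x).
Proof.
move=> inj nn x1 x2 x3 a e ax2.
have [X1 [A [Y [eX _ fA e1]]]] := map_cat_split e.
have [X2 [A' [X3 [eY fX2 fA' _]]]] := map_cat_split e1.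
have eA : A = A'.
  by apply: inj; rewrite ?fA ?fA' // eX eY !(mem_cat, inE) eqxx ?orbT.
subst A'; rewrite -fX2 map_inj_in_uniq; last first.
  move=> b c bX cX; apply: inj; rewrite eX eY !(mem_cat, inE) ?bX ?cX ?orbT //.
apply: (nn X1 X2 X3 A); first by rewrite eX eY.
by apply: contra ax2 => AX; rewrite -fX2 -fA map_f.
Qed.

Lemma sorted_split (T : eqType) (e : rel T) (s : seq T) a b :
  transitive e -> irreflexive e -> sorted e s -> a \in s -> b \in s -> e a b ->
  exists s1 s2, s = s1 ++ a :: s2 /\ b \in s2.
Proof.
move=> tr irr + ass; case/splitPr: ass => s1 s2.
rewrite (sorted_pairwise tr) pairwise_cat => /and3P[/allrelP h _ _].
rewrite mem_cat inE => /or3P[bs1|/eqP ->|bs2] ab.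
- by have := tr _ _ _ ab (h _ _ bs1 (mem_head _ _)); rewrite irr.
- by rewrite irr in ab.
- by exists s1, s2.
Qed.

Section NonnestList.
Variables (T : eqType) (I w : seq T).
Hypothesis uI : uniq I.
Hypothesis Iw : {subset I <= w}.

(** Otherwise the edge from [l] in [I] to its first occurrence in [w] encloses [l'] twice, once in
    [I] and once in [w]. *)
Lemma nonnest_index I1 I2 l l' : nonnest (I ++ w) -> I = I1 ++ l :: I2 -> l' \in I2 ->
  index l w < index l' w.
Proof.
move=> nn eI l'I.
have lw : l \in w by apply: Iw; rewrite eI mem_cat mem_head orbT.
have [x2 [x3 [ew lx2]]] := split_first lw.
have lI2 : l \notin I2 by move: uI; rewrite eI cat_uniq /= => /and4P[].
have := nn I1 (I2 ++ x2) x3 l; rewrite eI ew -!catA /= -?catA => /(_ erefl).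
rewrite mem_cat negb_or lI2 lx2 => /(_ isT); rewrite cat_uniq => /and3P[_ /hasPn h _].
have l'x2 : l' \notin x2 by apply/negP => /h; rewrite /= l'I.
rewrite ?ew !index_cat (negbTE lx2) (negbTE l'x2) /= eqxx addn0.
by case: eqVneq => [e|_]; [rewrite -e (negbTE lI2) in l'I|rewrite -addSnnS leq_addr].
Qed.

Lemma nonnest_uniq_take l : nonnest (I ++ w) -> l \in I -> uniq (take (index l w) w).
Proof.
move=> nn lI; have lw := Iw lI.
have [x2 [x3 [ew lx2]]] := split_first lw.
have [I1 [I2 [eI lI2]]] := split_last lI.
have := nn I1 (I2 ++ x2) x3 l; rewrite eI ew -!catA /= -?catA => /(_ erefl).
rewrite mem_cat negb_or lI2 lx2 => /(_ isT); rewrite cat_uniq => /and3P[_ _ ux2].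
by rewrite index_cat (negbTE lx2) /= eqxx addn0 take_size_cat.
Qed.

Lemma nonnest_suffix : nonnest (I ++ w) -> nonnest w.
Proof. by move=> nn x1 x2 x3 a ew; apply: (nn (I ++ x1) x2 x3); rewrite ew catA. Qed.

(** A window between consecutive [a] that starts in [I] consists of the rest of [I] and the prefix
    of [w] before the first [a]. The first-occurrence order makes these two pieces disjoint. *)
Lemma nonnest_prepend : sorted (relpre (index^~ w) ltn) I ->
  (forall l, l \in I -> uniq (take (index l w) w)) -> nonnest w -> nonnest (I ++ w).
Proof.
move=> sI hI nn x1 x2 x3 a ex ax2.
have [le|lt] := leqP (size I) (size x1).
  have ew : w = drop (size I) x1 ++ a :: x2 ++ a :: x3.
    by rewrite -(drop_size_cat (s1 := I) w erefl) ex drop_cat ltn_neqAle le andbT;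
       case: eqP => // e; rewrite e subnn drop0 drop_size.
  exact: nn ew ax2.
have eI : I = x1 ++ a :: drop (size x1).+1 I.
  rewrite -{1}(cat_take_drop (size x1) I).
  have := congr1 (take (size x1)) ex; rewrite [RHS]take_size_cat // takel_cat ?(ltnW lt) // => ->.
  have -> := drop_nth a lt; congr (_ ++ _ :: _).
  by have := congr1 (fun s => nth a s (size x1)) ex; rewrite !nth_cat lt ltnn subnn.
set I2 := drop _ I in eI.
have e2 : I2 ++ w = x2 ++ a :: x3.
  by move: ex; rewrite {1}eI -catA /= => /eqP; rewrite eqseq_cat // => /andP[_ /eqP[]].
have aI : a \in I by rewrite eI mem_cat mem_head orbT.
have aI2 : a \notin I2 by move: uI; rewrite eI cat_uniq /= => /and4P[].
have le2 : size I2 <= size x2.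
  rewrite leqNgt; apply/negP => lt2.
  have := congr1 (fun s => nth a s (size x2)) e2; rewrite !nth_cat lt2 ltnn subnn /=.
  by move=> e; rewrite -e mem_nth in aI2.
have ex2 : x2 = I2 ++ drop (size I2) x2.
  rewrite -{1}(cat_take_drop (size I2) x2); congr cat.
  by have := congr1 (take (size I2)) e2; rewrite [LHS]take_size_cat // takel_cat.
set x2' := drop _ x2 in ex2.
have ew : w = x2' ++ a :: x3.
  by move: e2; rewrite {1}ex2 -catA => /eqP; rewrite eqseq_cat // => /andP[_ /eqP].
have ax2' : a \notin x2' by move: ax2; rewrite ex2 mem_cat negb_or => /andP[].
have iw : index a w = size x2' by rewrite ew index_cat (negbTE ax2') /= eqxx addn0.
rewrite ex2 cat_uniq; apply/and3P; split.
- by move: uI; rewrite eI cat_uniq /= => /and4P[].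
- apply/hasPn => b bx; apply/negP => bI2.
  have : index a w < index b w.
    move: sI; rewrite eI sorted_pairwise; last by move=> ? ? ? /=; exact: ltn_trans.
    rewrite pairwise_cat /= => /and4P[_ _ /allP h _]; exact: h.
  by rewrite iw ew index_cat bx ltnNge ltnW // index_mem.
- by have := hI a aI; rewrite iw ew take_size_cat.
Qed.
End NonnestList.

Section NoncrossList.
Variables (T : eqType) (I w : seq T).
Hypothesis uI : uniq I.

Lemma noncross_sub (x y : seq T) : subseq x y -> noncross y -> noncross x.
Proof. by move=> xy nc a b ab; apply: contra (nc a b ab) => /subseq_trans; apply. Qed.

(** The list is prepended in reverse, so [l'] precedes [l] in front of [w]; the same order inside
    [w] would repeat the pair. *)
Lemma noncross_order I1 I2 l l' : noncross (rev I ++ w) -> I = I1 ++ l :: I2 ->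
  l' \in I2 -> ~~ subseq [:: l'; l] w.
Proof.
move=> nc eI l'I; apply/negP => h.
have lI2 : l \notin I2 by move: uI; rewrite eI cat_uniq /= => /and4P[].
have ll' : l' != l by apply: contra lI2 => /eqP <-.
have /negP[] := nc _ _ ll'; rewrite -[[:: _; _; _; _]]/([:: l'; l] ++ [:: l'; l]).
apply: cat_subseq => //; rewrite eI rev_cat rev_cons -cats1 -!catA.
rewrite -[[:: l'; l]]/([:: l'] ++ [:: l]); apply: cat_subseq.
  by rewrite sub1seq mem_rev.
by rewrite /= eqxx sub0seq.
Qed.

Lemma noncross_no_enclosed l b : noncross (rev I ++ w) -> l \in I -> b != l ->
  ~~ subseq [:: b; l; b] w.
Proof.
move=> nc lI bl; rewrite eq_sym in bl; apply: contra (nc _ _ bl) => h.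
by rewrite -[[:: l; _; _; _]]/([:: l] ++ [:: b; l; b]) cat_subseq // sub1seq mem_rev.
Qed.

Lemma noncross_prepend :
  (forall l b, l \in I -> b != l -> ~~ subseq [:: b; l; b] w) ->
  sorted (relpre (index^~ w) ltn) I -> {subset I <= w} ->
  noncross w -> noncross (rev I ++ w).
Proof.
move=> h sI Iw nc a b ab; apply/negP => /subseq_split4[].
- by apply/negP; apply: nc.
- by rewrite mem_rev => -[aI]; apply/negP; apply: h; rewrite // eq_sym.
(* In [I] the letter [b] precedes [a], so its first occurrence in [w] does too; with [a], [b] in [w]
   this completes an enclosed [b], [a], [b]. *)
- case=> sab sab'.
  have sba : subseq [:: b; a] I by rewrite -[I]revK -[[:: b; a]]revK subseq_rev.
  have ib : index b w < index a w.
    have := subseq_sorted _ sba sI; rewrite /= andbT; apply.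
    by move=> ? ? ?; apply: ltn_trans.
  have bw : b \in w by apply: Iw; apply: (mem_subseq sba); rewrite mem_head.
  have aI : a \in I by apply: (mem_subseq sba); rewrite !inE eqxx orbT.
  have : subseq [:: b; a; b] w.
    have [x1 [x2 [ew bx1]]] := split_first bw.
    have ax1 : a \notin x1.
      move: ib; rewrite ew !index_cat (negbTE bx1) /= eqxx addn0.
      by case: ifP => // ax; rewrite ltnNge ltnW // index_mem.
    move: sab'; rewrite ew => /subseq_split2[|[ax _]|/mem_subseq/(_ a (mem_head _ _))].
    + rewrite /=; case: eqVneq => [e|_ sx]; first by rewrite e eqxx in ab.
      by apply: (cat_subseq (s1 := [::])); rewrite ?sub0seq //= eqxx.
    + by rewrite ax in ax1.
    + by rewrite (negbTE ax1).
  by apply/negP; apply: h; rewrite // eq_sym.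
- case=> [[s _]|s].
    by have := subseq_uniq s; rewrite rev_uniq => /(_ uI) /=; rewrite !inE eqxx orbT.
  by have := subseq_uniq s; rewrite rev_uniq => /(_ uI) /=; rewrite !inE eqxx orbT.
Qed.
End NoncrossList.

(** * Canonical words *)

Section Canonical.
Local Open Scope ring_scope.

(* The position of the block of 1: {1} is a block; 1 lies in the zero block; of
   the blocks of 1 and -1, one or both contain elements of {2, ..., n}. The
   boolean is the sign of the element of {1, -1} labelled 1. *)
Inductive one_type := OneAlone | OneZero | OneOneSided of bool | OneTwoSided of bool.

Definition one_labels R : seq int :=
  match R with OneAlone => [::] | OneZero => [:: 0] | OneOneSided _ => [:: 1] | OneTwoSided _ => [:: 1; -1] end.

Definition one_label R : int :=
  match R with OneAlone => 1 | OneZero => 0 | OneOneSided b | OneTwoSided b => if b then -1 else 1 end.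

Definition is_alone R := if R is OneAlone then true else false.
Definition is_zero R := if R is OneZero then true else false.

(* The main letters get even labels, decreasing by 4 and symmetric about 0, so
   that the labels 1 and -1 of the ones fit in the middle; nonswitching blocks
   get larger labels given by the position of their least element. *)
Definition main_label (r j : nat) : int := 2 * (r%:Z - 1 - 2 * j%:Z).
Definition main_labels r : seq int := [seq main_label r j | j <- iota 0 r].
Definition nc_letters r R := take r./2 (main_labels r) ++ one_labels R ++ drop r./2 (main_labels r).
Definition nn_letters r R := main_labels r ++ rev (one_labels R).
Definition opener_label (m p : nat) : int := (2 * m + 2 + p)%:Z.

Lemma mainlP r l : reflect (exists2 j, (j < r)%N & l = main_label r j) (l \in main_labels r).
Proof.
apply: (iffP mapP) => -[j jr ->]; exists j => //.
  by rewrite mem_iota add0n in jr.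
by rewrite mem_iota.
Qed.

Lemma size_main_labels r : size (main_labels r) = r. Proof. by rewrite size_map size_iota. Qed.

Lemma main_labels_uniq r : uniq (main_labels r).
Proof. by rewrite map_inj_uniq ?iota_uniq // => i j; rewrite /main_label; lia. Qed.

Lemma mainlN r l : (- l \in main_labels r) = (l \in main_labels r).
Proof.
apply/mainlP/mainlP => -[j jr e]; exists (r.-1 - j)%N; rewrite /main_label in e *; lia.
Qed.

Lemma main_labels_bound r l : l \in main_labels r -> (`|l| < 2 * r)%N.
Proof. by case/mainlP=> j jr ->; rewrite /main_label; lia. Qed.

Lemma main_labels_odd r l : l \in main_labels r -> (l != 1) && (l != -1).
Proof. by case/mainlP=> j jr ->; rewrite /main_label; lia. Qed.

Lemma mainl0 r : (0 \in main_labels r) = odd r.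
Proof.
apply/mainlP/idP => [[j jr]|o]; rewrite /main_label; first by lia.
by exists r./2; lia.
Qed.

Lemma sorted_main_labels r : sorted >%R (main_labels r).
Proof.
rewrite /main_labels; have := iota_ltn_sorted 0 r; rewrite sorted_map.
by apply: sub_sorted => i j /=; rewrite /main_label; lia.
Qed.

Lemma mem_one_labels R l : l \in one_labels R -> (l == one_label R) || (l == - one_label R).
Proof.
by case: R => [||[]|[]] //=; rewrite ?inE; lia.
Qed.

Lemma mem_nc_letters r R l : (l \in nc_letters r R) = (l \in main_labels r) || (l \in one_labels R).
Proof.
by rewrite !mem_cat orbCA -mem_cat cat_take_drop orbC.
Qed.

Lemma mem_nn_letters r R l : (l \in nn_letters r R) = (l \in nc_letters r R).
Proof. by rewrite mem_nc_letters mem_cat mem_rev. Qed.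

Lemma one_labels_bound R l : l \in one_labels R -> (`|l| < 2)%N.
Proof. by case: R => [||[]|[]] //=; rewrite ?inE; lia. Qed.

Lemma one_labels_uniq R : uniq (one_labels R). Proof. by case: R. Qed.

Section Can.
Variables (m r : nat) (R : one_type) (w : seq int).

(** A letter outside the list names its block by the position where it opens. The last clause
    prevents 0 from labelling both the block of 1 and a main block. *)
Definition canonical := [/\ size w = m, {subset nc_letters r R <= w},
  (forall l, l \in w -> (l \in nc_letters r R) || (l == opener_label m (index l w))) &
  is_zero R -> ~~ odd r].

Hypothesis cw : canonical.

Lemma canonical_r : (r <= m)%N.
Proof.
case: cw => <- sub _ _; rewrite -(size_main_labels r); apply: uniq_leq_size (main_labels_uniq r) _.
by move=> l lr; apply: sub; rewrite mem_nc_letters lr.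
Qed.

Lemma one_labels_main_labels l : l \in one_labels R -> l \notin main_labels r.
Proof.
case: cw => _ _ _; case: (R) => [||b|b] //= hr; rewrite !inE.
- by move/eqP => ->; rewrite mainl0 hr.
- by move/eqP => ->; apply/negP => /main_labels_odd.
- by move=> /orP[] /eqP ->; apply/negP => /main_labels_odd.
Qed.

Lemma nn_letters_uniq : uniq (nn_letters r R).
Proof.
rewrite cat_uniq main_labels_uniq rev_uniq one_labels_uniq andbT; apply/hasPn => l.
by rewrite mem_rev => /one_labels_main_labels.
Qed.

Lemma nc_letters_perm : perm_eq (nc_letters r R) (nn_letters r R).
Proof.
by rewrite /nc_letters perm_catCA cat_take_drop /nn_letters perm_catC perm_cat2l perm_sym perm_rev.
Qed.

Lemma nc_letters_uniq : uniq (nc_letters r R).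
Proof. by rewrite (perm_uniq nc_letters_perm) nn_letters_uniq. Qed.

(** In absolute value main labels stay below [2 * r], with [r <= m]. Hence opener labels, which
    start at [2 * m + 2], meet neither the listed letters nor their negatives. *)
Lemma nc_letters_bound l : l \in nc_letters r R -> (`|l| < 2 * m + 2)%N.
Proof.
have := canonical_r; rewrite mem_nc_letters => rm /orP[/main_labels_bound|/one_labels_bound]; lia.
Qed.

Lemma canonical_big l : l \in w -> l \notin nc_letters r R -> l = opener_label m (index l w).
Proof. by case: cw => _ _ h _ /h /orP[->//|/eqP]. Qed.

Lemma canonical_neg l : l \in w -> - l \in w -> l \in nc_letters r R.
Proof.
move=> lw nlw; apply/idPn => lI; have e := canonical_big lw lI.
case: cw => _ _ h _; case/orP: (h _ nlw) => [/nc_letters_bound|/eqP]; rewrite /opener_label in e *; lia.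
Qed.

Lemma canonical_main_labels l : main_letter (one_label R) w l = (l \in main_labels r).
Proof.
apply/and4P/idP => [[lw nlw h1 h2]|lr].
  have := canonical_neg lw nlw; rewrite mem_nc_letters => /orP[//|/mem_one_labels].
  by rewrite (negbTE h1) (negbTE h2).
have sub : {subset nc_letters r R <= w} by case: cw.
split; rewrite ?sub ?mem_nc_letters ?mainlN ?lr //.
  case: cw lr => _ _ _; case: (R) => [||[]|[]] //= h lr; try by case/andP: (main_labels_odd lr).
  by apply: contraTN lr => /eqP ->; rewrite mainl0 h.
case: cw lr => _ _ _; case: (R) => [||[]|[]] //= h lr; try by case/andP: (main_labels_odd lr).
by apply: contraTN lr => /eqP ->; rewrite oppr0 mainl0 h.
Qed.

Lemma canonical_one_labels l : one_letter (one_label R) w l = (l \in one_labels R).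
Proof.
apply/andP/idP => [[lw h]|lr]; last first.
  split; last exact: mem_one_labels.
  by case: cw => _ sub _ _; apply: sub; rewrite mem_nc_letters lr orbT.
have : l \in nc_letters r R.
  apply/idPn => lI; have := canonical_big lw lI; rewrite /opener_label.
  by case: (R) h => [||[]|[]] //=; lia.
rewrite mem_nc_letters => /orP[lm|//].
by move: lm; rewrite -canonical_main_labels => /and4P[_ _ h1 h2]; move: h; rewrite (negbTE h1) (negbTE h2).
Qed.

(** First occurrences follow the list. Its main labels decrease, so negation reverses them, which is
    the third clause of [nnword]; the ones come last, which is the fourth. *)
Lemma canonical_nnword : nonnest (nn_letters r R ++ w) -> nnword (one_label R) w.
Proof.
move=> nn; have sub : {subset nn_letters r R <= w}.
  by move=> l; rewrite mem_nn_letters; case: cw => _ sub _ _; exact: sub.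
have mo l l' : l \in main_labels r -> l' \in main_labels r -> l' < l -> (index l w < index l' w)%N.
  move=> lr lr' ll'; have [||s1 [s2 [e h]]] := sorted_split _ _ (sorted_main_labels r) lr lr' ll'.
  - by move=> a b c /= ab bc; exact: lt_trans bc ab.
  - by move=> a /=; rewrite ltxx.
  apply: (@nonnest_index _ _ _ nn_letters_uniq sub s1 (s2 ++ rev (one_labels R))) => //.
    by rewrite /nn_letters e -catA.
  by rewrite mem_cat h.
split.
- exact: nonnest_suffix nn.
- move=> l; rewrite canonical_main_labels canonical_one_labels -mem_nc_letters -mem_nn_letters => lI.
  exact: nonnest_uniq_take sub _ nn lI.
- move=> l l'; rewrite !canonical_main_labels => lr lr' ll'.
  have [lt|lt|e] := ltgtP l l'; last by rewrite e ltnn in ll'.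
    by have := mo _ _ lr' lr lt; lia.
  by apply: mo; rewrite ?mainlN // ltrN2.
- move=> l e; rewrite canonical_main_labels canonical_one_labels => lr eI; have [s1 [s2 [em _]]] := split_first lr.
  apply: (@nonnest_index _ _ _ nn_letters_uniq sub s1 (s2 ++ rev (one_labels R))) => //.
    by rewrite /nn_letters em -catA.
  by rewrite mem_cat mem_rev eI orbT.
Qed.
End Can.
End Canonical.

Lemma index_map_inj_in (T U : eqType) (f : T -> U) x a :
  {in x &, injective f} -> a \in x -> index (f a) (map f x) = index a x.
Proof.
elim: x => //= b x IH inj; rewrite inE; have [-> _|nab /= ax] := eqVneq b a.
  by rewrite eqxx.
case: eqP => [/inj e'|_].
  by move: nab; rewrite e' ?mem_head ?eqxx // inE ax orbT.
by rewrite IH // => c d cx dx; apply: inj; rewrite inE ?cx ?dx orbT.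
Qed.

Lemma nth_opp_rev (M : seq int) j : rev (map (-%R)%R M) = M -> j < size M ->
  (- M`_j = M`_((size M).-1 - j))%R.
Proof.
move=> oM jr; have := congr1 (fun s => s`_((size M).-1 - j))%R oM.
have E k : j < k -> k - (k.-1 - j).+1 = j by clear; lia.
have F k : j < k -> k.-1 - j < k by clear; lia.
by rewrite nth_rev size_map ?F // E // (nth_map 0%R) // => <-.
Qed.

(** * Normalising the labels *)

Section Relabel.
Local Open Scope ring_scope.
Variables (m : nat) (y1 : int) (w Mn : seq int) (e : int).
Hypotheses (sw : size w = m) (uM : uniq Mn).
Hypothesis hM : forall l, (l \in Mn) = main_letter y1 w l.
Hypothesis oM : rev (map -%R Mn) = Mn.
Hypothesis he : (y1 == e) || (y1 == - e).
Hypothesis hew : (e \in w) || (e == y1) && (- e \notin w).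
Hypothesis hc : count_mem 0 (y1 :: w) != 1%N.

Let r := size Mn.

Definition relabel l : int :=
  if l \in Mn then main_label r (index l Mn) else
  if l == e then (e != 0)%:Z else if l == - e then -1 else opener_label m (index l w).

(** By [hew], [e] occurs in [w] as soon as [- e] does, so the first test decides whether neither
    does. The boolean records that 1 itself received the label -1. *)
Definition relabel_type : one_type :=
  if e \notin w then OneAlone else if e == 0 then OneZero else
  if - e \in w then OneTwoSided (y1 != e) else OneOneSided (y1 != e).

Definition one_list := [seq l <- (if e == 0 then [:: e] else [:: e; - e]) | l \in w].

Local Notation G := relabel.
Local Notation R := relabel_type.

Lemma Mn_w l : l \in Mn -> [/\ l \in w, - l \in w, l != e & l != - e].
Proof.
rewrite hM => /and4P[lw nlw h1 h2]; split=> //.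
  by case/orP: he h1 h2 => /eqP -> //; rewrite opprK.
by case/orP: he h1 h2 => /eqP -> //; rewrite opprK.
Qed.

Lemma size_Mn : (r <= m)%N.
Proof. by rewrite /r -sw; apply: uniq_leq_size => // l /Mn_w[]. Qed.

Lemma Mn_opp j : (j < r)%N -> - Mn`_j = Mn`_(r.-1 - j).
Proof. exact: nth_opp_rev. Qed.

Variant relabel_spec u : int -> Prop :=
 | RelMain j of (j < r)%N & u = Mn`_j : relabel_spec u (main_label r j)
 | RelE of u = e & e \notin Mn & - e \notin Mn : relabel_spec u (e != 0)%:Z
 | RelNE of u = - e & e != 0 & e \notin Mn & - e \notin Mn : relabel_spec u (-1)
 | RelBig of u \in w & - u \notin w & u != e & u != - e & u != 0 & u \notin Mn & - u \notin Mn :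
     relabel_spec u (opener_label m (index u w)).

Lemma relabelP u : u \in y1 :: w -> relabel_spec u (G u).
Proof.
have eM : e \notin Mn by apply/negP => /Mn_w[]; rewrite eqxx.
have neM : - e \notin Mn by apply/negP => /Mn_w[]; rewrite eqxx.
move=> uw; rewrite /relabel; case: ifPn => [uM'|uM'].
  by constructor; rewrite ?index_mem ?nth_index.
have [e1|ue] := eqVneq u e; first exact: RelE.
have [e1|une] := eqVneq u (- e).
  by apply: RelNE => //; apply: contra ue => /eqP e0; rewrite e1 e0 oppr0.
have uw' : u \in w.
  move: uw; rewrite inE => /orP[/eqP uy|//].
  by case/orP: he => /eqP y1e; rewrite -uy in y1e; rewrite y1e eqxx in ue une.
have yy : (u != y1) && (u != - y1).
  by case/orP: he => /eqP ->; rewrite ?opprK ue une.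
have nuw : - u \notin w.
  by apply: contra uM' => nuw; rewrite hM /main_letter uw' nuw.
apply: RelBig => //.
  by apply: contra nuw => /eqP u0; rewrite u0 oppr0 -u0.
by apply/negP => /Mn_w[]; rewrite (negbTE nuw).
Qed.

Lemma main_label_eq j k : (main_label r j == main_label r k) = (j == k).
Proof. by rewrite /main_label; lia. Qed.
Lemma main_label_opp j k : (j < r)%N -> (k < r)%N -> (main_label r j == - main_label r k) = (j == r.-1 - k)%N.
Proof. by rewrite /main_label; lia. Qed.

(** An integer is 0 exactly when it is its own negative, and negation is reversal of positions both
    for [Mn] and for the new labels. *)
Lemma mlab0 j : (j < r)%N -> (main_label r j == 0) = (Mn`_j == 0).
Proof.
move=> jr; have -> : (Mn`_j == 0) = (Mn`_j == - Mn`_j).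
  by apply/eqP/eqP => [->|]; [rewrite oppr0|lia].
by rewrite Mn_opp // nth_uniq -/r //; rewrite /main_label; lia.
Qed.

(** Respecting both equality and equality up to sign makes the kernels agree on all signed elements;
    the case [u = v] handles 0. *)
Lemma relabel_both u v : u \in y1 :: w -> v \in y1 :: w ->
  ((G u == G v) = (u == v)) /\ ((G u == - G v) = (u == - v)).
Proof.
move=> /relabelP hu /relabelP hv.
have nM a j : (j < r)%N -> a \notin Mn -> (Mn`_j == a) = false.
  by move=> jr aM; apply/negbTE; apply: contra aM => /eqP <-; rewrite mem_nth.
have rm := size_Mn.
have ME j : (j < r)%N -> e \notin Mn -> - e \notin Mn ->
    [/\ Mn`_j != e, Mn`_j != - e & (main_label r j == 0) = (Mn`_j == 0)].
  by move=> jr eM neM; rewrite (nM e) // (nM (- e)) // mlab0.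
have MB j a : (j < r)%N -> a \notin Mn -> - a \notin Mn -> Mn`_j != a /\ Mn`_j != - a.
  by move=> jr aM naM; rewrite (nM a) // (nM (- a)).
case: hu => [j jr ->|-> eM neM|-> e0 eM neM|uw nuw ue une u0 uM' nuM];
  case: hv => [k kr ->|-> eM' neM'|-> e0' eM' neM'|vw nvw ve vne v0 vM nvM].
- split; first by rewrite main_label_eq nth_uniq.
  by rewrite main_label_opp // Mn_opp // nth_uniq // -/r; lia.
- by have [h1 h2 h3] := ME j jr eM' neM'; clear -h1 h2 h3 jr; rewrite /main_label in h3 *; split; lia.
- by have [h1 h2 h3] := ME j jr eM' neM'; clear -h1 h2 h3 jr; rewrite /main_label in h3 *; split; lia.
- by have [h1 h2] := MB j v jr vM nvM; clear -h1 h2 jr rm; rewrite /main_label /opener_label; split; lia.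
- by have [h1 h2 h3] := ME k kr eM neM; clear -h1 h2 h3 kr; rewrite /main_label in h3 *; split; lia.
- by clear; split; lia.
- by clear -e0'; split; lia.
- by clear -ve vne; rewrite /opener_label; split; lia.
- by have [h1 h2 h3] := ME k kr eM neM; clear -h1 h2 h3 kr; rewrite /main_label in h3 *; split; lia.
- by clear -e0; split; lia.
- by clear -e0; split; lia.
- by clear -ve vne v0; rewrite /opener_label; split; lia.
- by have [h1 h2] := MB k u kr uM' nuM; clear -h1 h2 kr rm; rewrite /main_label /opener_label; split; lia.
- by clear -ue une; rewrite /opener_label; split; lia.
- by clear -ue une; rewrite /opener_label; split; lia.
- split.
    apply/eqP/eqP => [|-> //]; rewrite /opener_label => h.
    by apply: (index_inj 0 uw vw); move: h; clear; lia.
  have -> : (u == - v) = false by apply/negbTE; apply: contra nvw => /eqP <-.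
  by rewrite /opener_label; lia.
Qed.

Lemma relabel_eq u v : u \in y1 :: w -> v \in y1 :: w -> (G u == G v) = (u == v).
Proof. by move=> uw vw; case: (relabel_both uw vw). Qed.

Lemma relabel_opp u v : u \in y1 :: w -> v \in y1 :: w -> (G u == - G v) = (u == - v).
Proof. by move=> uw vw; case: (relabel_both uw vw). Qed.

Lemma relabel0 u : u \in y1 :: w -> (G u == 0) = (u == 0).
Proof. by move=> uw; have := relabel_opp uw uw; lia. Qed.

Lemma relabel_inj : {in w &, injective G}.
Proof.
move=> u v uw vw /eqP; rewrite relabel_eq ?inE ?uw ?vw ?orbT //; exact/eqP.
Qed.

Lemma relabel_main : map G Mn = main_labels r.
Proof.
apply: (@eq_from_nth _ 0); rewrite size_map ?size_main_labels // -/r => j jr.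
rewrite (nth_map 0) // /main_labels (nth_map 0%N) ?size_iota // nth_iota // /relabel.
by rewrite mem_nth // index_uniq.
Qed.

Lemma e_notin_Mn : e \notin Mn /\ - e \notin Mn.
Proof. by split; apply/negP => /Mn_w[]; rewrite eqxx. Qed.

Lemma relabel_e : G e = (e != 0)%:Z.
Proof. by rewrite /relabel (negbTE e_notin_Mn.1) eqxx. Qed.

Lemma relabel_ne : e != 0 -> G (- e) = -1.
Proof.
move=> e0; rewrite /relabel (negbTE e_notin_Mn.2) eqxx.
by rewrite ifN //; lia.
Qed.

Lemma e_notin_w : e \notin w -> [/\ y1 = e, e != 0 & - e \notin w].
Proof.
move=> ew; case/orP: hew => [ew'|/andP[/eqP ey new]]; first by rewrite ew' in ew.
(* If [e] were 0, the label 0 would occur at 1 and nowhere in [w], exactly once, which [hc]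
   excludes. *)
split=> //; apply/negP => /eqP e0; move: hc.
rewrite /= -ey e0 eqxx; rewrite e0 in ew.
by rewrite (count_memPn ew).
Qed.

Lemma relabel_one_list : map G one_list = one_labels R.
Proof.
rewrite /one_list /relabel_type; have [ew|ew] := boolP (e \in w); last first.
  have [_ e0 new] := e_notin_w ew.
  by rewrite (negbTE e0) /= (negbTE ew) (negbTE new).
have [e0|e0] := boolP (e == 0); first by rewrite /= ew /= relabel_e e0.
by rewrite /= ew; case: ifPn => new /=; rewrite relabel_e e0 ?relabel_ne.
Qed.

Lemma relabel_y1 : G y1 = one_label R.
Proof.
rewrite /relabel_type; case: ifPn => [ew|].
  by have [-> e0 _] := e_notin_w ew; rewrite relabel_e e0.
rewrite negbK => ew; case: ifPn => [e0|e0] /=.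
  by rewrite (_ : y1 = e) ?relabel_e ?e0 //; lia.
have : G y1 = if y1 != e then -1 else 1.
  case: eqVneq => [->|ye] /=; first by rewrite relabel_e e0.
  by rewrite (_ : y1 = - e) ?relabel_ne //; lia.
by case: (- e \in w).
Qed.

Lemma relabel_canonical : canonical m r R (map G w).
Proof.
have sub : {subset nc_letters r R <= map G w}.
  move=> l; rewrite mem_nc_letters -relabel_main -relabel_one_list => /orP[] /mapP[u uM' ->].
    by apply: map_f; case/Mn_w: uM'.
  by apply: map_f; move: uM'; rewrite mem_filter => /andP[].
split=> //; first by rewrite size_map.
- move=> _ /mapP[u uw ->]; rewrite index_map_inj_in //; last exact: relabel_inj.
  rewrite mem_nc_letters -relabel_main -relabel_one_list.
  rewrite /relabel; case: ifPn => [uM'|uM'].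
    have -> : main_label r (index u Mn) = G u by rewrite /relabel uM'.
    by rewrite map_f.
  have ue : (u == e) || (u == - e) -> G u \in [seq G i | i <- one_list].
    move=> h; apply: map_f; rewrite mem_filter uw /=.
    by case: ifP h => e0; rewrite !inE //; lia.
  move: ue; rewrite /relabel (negbTE uM').
  have [-> /(_ isT) ->|_] := eqVneq u e; first by rewrite orbT.
  by have [-> /(_ isT) ->|_] := eqVneq u (- e); rewrite ?orbT // eqxx orbT.
- rewrite /relabel_type; case: ifP => //; case: ifPn => [/eqP e0 _ _|_ _]; last by case: ifP.
  rewrite -mainl0 -relabel_main; apply/negP => /mapP[u uM' /esym/eqP].
  have [uw _ ue _] := Mn_w uM'; rewrite relabel0 ?inE ?uw ?orbT //.
  by rewrite -e0 (negbTE ue).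
Qed.

Lemma relabel_count0 : count_mem 0 (one_label R :: map G w) != 1%N.
Proof.
rewrite -relabel_y1 -[_ :: _]/(map G (y1 :: w)) count_map.
rewrite (eq_in_count (a2 := pred1 0)) // => u uw /=; exact: relabel0.
Qed.

Lemma relabel_ker : ker_partition m.+1 (one_label R :: map G w) = ker_partition m.+1 (y1 :: w).
Proof.
rewrite -relabel_y1 -[_ :: _]/(map G (y1 :: w)).
have vG (i : 'I_m.+1) : (map G (y1 :: w))`_i = G (y1 :: w)`_i.
  by rewrite (nth_map 0) //= sw.
have iw (i : 'I_m.+1) : (y1 :: w)`_i \in y1 :: w by rewrite mem_nth //= sw.
apply: eq_ker_partition => -[[b i]|] [[c j]|] //; rewrite /vval ?vG.
- move: (relabel_eq (iw i) (iw j)) (relabel_opp (iw i) (iw j)).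
  move: {vG iw}((y1 :: w)`_i) ((y1 :: w)`_j) => a' b'.
  move: (G a') => A; move: (G b') => B; clear.
  by case: b c => [] []; lia.
- move: (relabel0 (iw i)); move: ((y1 :: w)`_i) => a'; move: (G a') => A; clear.
  by case: b; lia.
- move: (relabel0 (iw j)); move: ((y1 :: w)`_j) => a'; move: (G a') => A; clear.
  by case: c; lia.
Qed.

Lemma relabelS : let w' := map G w in
  [/\ canonical m r R w', count_mem 0 (one_label R :: w') != 1%N,
      ker_partition m.+1 (one_label R :: w') = ker_partition m.+1 (y1 :: w) &
  [/\ map G Mn = main_labels r, map G one_list = one_labels R & {in w &, injective G}]].
Proof.
by split; [exact: relabel_canonical|exact: relabel_count0|exact: relabel_ker|split;
  [exact: relabel_main|exact: relabel_one_list|exact: relabel_inj]].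
Qed.
End Relabel.

Lemma index_subseq2 (T : eqType) (a b : T) s :
  a \in s -> b \in s -> index a s < index b s -> subseq [:: a; b] s.
Proof.
move=> /split_first[s1 [s2 [-> as1]]] bs lt.
apply: (cat_subseq (s1 := [::])); rewrite ?sub0seq //= eqxx sub1seq.
move: bs lt; rewrite !index_cat (negbTE as1) /= eqxx addn0 mem_cat inE.
case: ifP => [bs1 _|_ /=]; first by rewrite ltnNge ltnW // index_mem.
by case/orP=> // /eqP ->; rewrite eqxx addn0 ltnn.
Qed.

Section Symmetric.
Local Open Scope ring_scope.
Implicit Types (h s : seq int).

Lemma subseq_opp s h : subseq s (map -%R h) = subseq (map -%R s) h.
Proof.
have E t : map -%R (map -%R t) = t :> seq int.
  by rewrite -map_comp map_id_in // => a _ /=; rewrite opprK.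
by apply/idP/idP => /(map_subseq -%R); rewrite E.
Qed.

Lemma mem_opp (a : int) h : (a \in map -%R h) = (- a \in h).
Proof. by rewrite -sub1seq subseq_opp sub1seq. Qed.

Lemma sym_no_enclosed h a b : noncross (sym h) -> - a \in h -> b != a ->
  ~~ subseq [:: b; a; b] h.
Proof.
move=> nc na ba; rewrite eq_sym in ba; apply: contra (nc _ _ ba) => hb.
by rewrite -[[:: a; _; _; _]]/([:: a] ++ [:: b; a; b]) cat_subseq // sub1seq mem_opp.
Qed.

Lemma sym_reverse h a b : noncross (sym h) -> a != b -> subseq [:: a; b] h ->
  ~~ subseq [:: - a; - b] h.
Proof.
move=> nc ab hab; apply: contra (nc _ _ ab) => hab'.
by rewrite -[[:: a; _; _; _]]/([:: a; b] ++ [:: a; b]) cat_subseq // subseq_opp.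
Qed.

Lemma ins_sub j e (w : seq int) : subseq w (ins j e w).
Proof.
by rewrite -{1}(cat_take_drop j w) cat_subseq //= ?subseq_refl //; exact: subseq_cons.
Qed.
End Symmetric.

(** * From partitions to canonical words *)

Section Structure.
Local Open Scope ring_scope.
Variables (m : nat) (y1 : int) (w : seq int).
Hypotheses (sw : size w = m) (hc : count_mem 0 (y1 :: w) != 1%N).

Local Notation before := (relpre (index^~ w) ltn).

Definition mains := sort (fun a b => index a w <= index b w)%N
  [seq l <- undup w | main_letter y1 w l].

Lemma mem_mains l : (l \in mains) = main_letter y1 w l.
Proof.
rewrite mem_sort mem_filter mem_undup /main_letter.
by case: (l \in w); rewrite ?andbF // andbT.
Qed.

Lemma mains_uniq : uniq mains.
Proof. by rewrite sort_uniq filter_uniq ?undup_uniq. Qed.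

Lemma mains_sorted : sorted before mains.
Proof.
rewrite -sorted_map ltn_sorted_uniq_leq map_inj_in_uniq ?mains_uniq /=.
  by rewrite sorted_map; apply: sort_sorted => a b; apply: leq_total.
by move=> a b; rewrite !mem_mains => /and4P[aw _ _ _] /and4P[bw _ _ _] /(index_inj 0 aw bw).
Qed.

Lemma before_trans : transitive before.
Proof. by move=> a b c /=; apply: ltn_trans. Qed.

Lemma before_irr : irreflexive before.
Proof. by move=> a /=; rewrite ltnn. Qed.

(** Negation followed by reversal preserves the order of first occurrence, and a strictly sorted
    list is determined by its members. *)
Lemma mains_opp : (forall l l', main_letter y1 w l -> main_letter y1 w l' ->
    (index l w < index l' w)%N -> (index (- l') w < index (- l) w)%N) ->
  rev (map -%R mains) = mains.
Proof.
move=> main_rev.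
apply: (irr_sorted_eq before_trans before_irr); last 2 first.
- exact: mains_sorted.
- move=> l; rewrite mem_rev mem_mains; apply/mapP/idP => [[l' + ->]|ml].
    by rewrite mem_mains main_letterN.
  by exists (- l); rewrite ?opprK // mem_mains main_letterN.
rewrite rev_sorted sorted_map.
apply: (@sub_in_sorted _ (mem mains) before) mains_sorted; last exact/allP.
move=> a b; rewrite /= !mem_mains; exact: main_rev.
Qed.

(* Taking [b := ltn] picks the letter of [y1; -y1] occurring first in [w], and
   [b := gtn] the one occurring last. *)
Definition one_choice (b : rel nat) : int :=
  if y1 \in w then
    if (- y1 \in w) && b (index (- y1) w) (index y1 w) then - y1 else y1
  else if - y1 \in w then - y1 else y1.

Lemma one_choice_eq b : (y1 == one_choice b) || (y1 == - one_choice b).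
Proof.
by rewrite /one_choice; do !case: ifP => _; rewrite ?opprK eqxx ?orbT.
Qed.

Lemma one_choice_in b : (one_choice b \in w) ||
  (one_choice b == y1) && (- one_choice b \notin w).
Proof.
rewrite /one_choice; case: ifP => [yw|yw]; last by case: ifPn => h; rewrite ?h ?eqxx ?orbT.
by case: ifP => [/andP[-> _]|_]; rewrite ?yw.
Qed.

Lemma mem_one_list b l : (l \in one_list w (one_choice b)) = one_letter y1 w l.
Proof.
rewrite mem_filter /one_letter; congr andb.
have := one_choice_eq b; set e := one_choice b => h.
by case: ifP => e0; rewrite !inE; move: h e0; clear; lia.
Qed.

Lemma one_list_cases b : one_list w (one_choice b) = [::] \/
  (exists e, one_list w (one_choice b) = [:: e]) \/
  exists e, [/\ one_list w (one_choice b) = [:: e; - e], e != 0, e \in w, - e \in w &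
     e = one_choice b].
Proof.
have := one_choice_in b; rewrite /one_list; set e := one_choice b => h.
case: ifPn => e0 /=; first by case: ifP; [right; left; exists e|left].
case: ifPn => ew; case: ifPn => new; [|by right; left; exists e|by right; left; exists (- e)|by left].
by right; right; exists e.
Qed.

Lemma one_choice_lt b e : (forall i j, i != j -> b i j = ~~ b j i) ->
  e = one_choice b -> e != 0 -> e \in w -> - e \in w ->
  b (index e w) (index (- e) w).
Proof.
move=> bt -> + + + ; rewrite /one_choice.
have nb e' : e' != 0 -> e' \in w -> - e' \in w -> index e' w != index (- e') w.
  move=> e0 ew new; apply/negP => /eqP /(index_inj 0 ew new); move: e0; clear; lia.
case: ifP => [yw|yw].
  case: ifPn => [/andP[nyw h] e0 _ _|h e0 _ nyw]; first by rewrite opprK.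
  by rewrite nyw /= in h; rewrite bt ?nb.
by case: ifP => nyw; rewrite ?opprK ?yw ?nyw.
Qed.

(** When both letters of 1 and -1 occur and differ, [e] is the one occurring last, as [nn_letters]
    ends with [one_labels] reversed. The swap made by [sigmaD] is thus built into the labels. *)
Lemma nn_structure : nnword y1 w -> exists r R w',
  [/\ canonical m r R w', nonnest (nn_letters r R ++ w'), count_mem 0 (one_label R :: w') != 1%N &
      ker_partition m.+1 (y1 :: w) = ker_partition m.+1 (one_label R :: w')].
Proof.
move=> [n1 n2 n3 n4]; pose e := one_choice gtn.
have he : (y1 == e) || (y1 == - e) := one_choice_eq gtn.
have hew := one_choice_in gtn; rewrite -/e in hew.
have oM := mains_opp n3.
pose I := mains ++ rev (one_list w e).
have oneP l : l \in one_list w e -> one_letter y1 w l by rewrite mem_one_list.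
have sI : sorted before I.
  rewrite (sorted_pairwise before_trans) pairwise_cat -!(sorted_pairwise before_trans).
  rewrite mains_sorted; apply/and3P; split=> //.
    apply/allrelP => l l'; rewrite mem_mains mem_rev => ml /oneP ol; exact: n4.
  rewrite rev_sorted; have := one_list_cases gtn; rewrite -/e.
  case=> [->//|[[e' ->//]|[e' [-> e0 ew new ee]]]]; rewrite /= andbT.
  by have := @one_choice_lt gtn e' _ ee e0 ew new; apply; move=> i j ij /=; rewrite ltn_neqAle eq_sym ij leqNgt.
have uI : uniq I := sorted_uniq before_trans before_irr sI.
have hI l : l \in I -> main_letter y1 w l || one_letter y1 w l.
  by rewrite mem_cat mem_mains mem_rev mem_one_list.
have nn : nonnest (I ++ w).
  by apply: nonnest_prepend => // l /hI; apply: n2.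
pose G := relabel m w mains e.
have [cG c0 kG [GM GR Ginj]] := relabelS sw mains_uniq mem_mains oM he hew hc.
exists (size mains), (relabel_type y1 w e), (map G w); split=> //.
have -> : nn_letters (size mains) (relabel_type y1 w e) ++ map G w = map G (I ++ w).
  by rewrite map_cat /I map_cat map_rev GM GR.
have sub c : c \in I ++ w -> c \in w.
  by rewrite mem_cat => /orP[/hI/orP[/and4P[]|/andP[]]|].
by apply: nonnest_map nn => a b /sub aw /sub bw; apply: Ginj.
Qed.

Lemma nc_structure : ncword y1 w -> exists r R w',
  [/\ canonical m r R w', is_alone R || ~~ odd r, noncross (rev (nc_letters r R) ++ w'),
      count_mem 0 (one_label R :: w') != 1%N &
      ker_partition m.+1 (y1 :: w) = ker_partition m.+1 (one_label R :: w')].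
Proof.
case=> j [jw nc1 nc2].
have nce e : (e == y1) || (e == - y1) ->
    noncross (sym (ins j e w)) /\ noncross (sym (ins j (- e) w)).
  by case/orP=> /eqP ->; rewrite ?opprK.
have wh e := mem_subseq (ins_sub j e w).
have sub2 e s : subseq s w -> subseq s (ins j e w).
  by move=> h; apply: subseq_trans h (ins_sub j e w).
have eh e : e \in ins j e w by rewrite mem_cat mem_head orbT.
(* The negative half of the symmetric word contains [l]: for a main letter [- l] is in [w],
   otherwise [- l] is the inserted letter. *)
have C1 l b : main_letter y1 w l || one_letter y1 w l -> b != l -> ~~ subseq [:: b; l; b] w.
  case/orP=> [/and4P[_ nlw _ _]|/andP[_ /nce[_ nc]]] bl.
    by have := sym_no_enclosed nc1 (wh _ _ nlw) bl; apply: contra => /sub2.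
  by have := sym_no_enclosed nc (eh _) bl; apply: contra => /sub2.
have C2 l l' : main_letter y1 w l -> main_letter y1 w l' ->
    (index l w < index l' w)%N -> (index (- l') w < index (- l) w)%N.
  move=> /and4P[lw nlw _ _] /and4P[lw' nlw' _ _] lt.
  have ll' : l != l' by apply/negP => /eqP e; rewrite e ltnn in lt.
  have := sym_reverse nc1 ll' (sub2 _ _ (index_subseq2 lw lw' lt)).
  rewrite ltnNge leq_eqVlt negb_or => h; apply/andP; split.
    by apply: contra ll' => /eqP/(index_inj 0 nlw nlw')/oppr_inj ->.
  by apply: contra h => h; apply: sub2; apply: index_subseq2.
(* A letter of 1 or -1 falls between [l] and [- l]. If [e] follows both, [sym_reverse] with [- e]
   inserted keeps both out of the first [j] letters, so inserting [e] produces the forbidden [e],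
   [l], [e]. The other half is the mirror image. *)
have C3 l e : main_letter y1 w l -> one_letter y1 w e ->
    ~ ((index l w < index e w)%N /\ (index (- l) w < index e w)%N) /\
    ~ ((index e w < index l w)%N /\ (index e w < index (- l) w)%N).
  move=> /and4P[lw nlw ly lny] /andP[ew ey].
  have [nce1 nce2] := nce _ ey.
  have el : e != l by move: ey ly lny; clear; lia.
  have enl : e != - l by move: ey ly lny; clear; lia.
  have noenc : ~~ subseq [:: e; l; e] (ins j e w).
    by apply: (sym_no_enclosed nce1) => //; apply: wh.
  split=> -[i1 i2].
    have h1 : subseq [:: l; e] w by apply: index_subseq2.
    have h2 : subseq [:: - l; e] w by apply: index_subseq2.
    have k1 : - l \notin take j w.
      have := sym_reverse nce2 _ (sub2 (- e) _ h1); rewrite eq_sym => /(_ el); apply: contra => h.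
      by rewrite /ins -[[:: - l; - e]]/([:: - l] ++ [:: - e]) cat_subseq ?sub1seq ?mem_head.
    have k2 : l \notin take j w.
      have := sym_reverse nce2 _ (sub2 (- e) _ h2); rewrite eq_sym => /(_ enl); apply: contra => h.
      by rewrite opprK /ins -[[:: l; - e]]/([:: l] ++ [:: - e]) cat_subseq ?sub1seq ?mem_head.
    move/negP: noenc; apply; rewrite /ins -[[:: e; l; e]]/([::] ++ [:: e; l; e]).
    apply: cat_subseq; rewrite ?sub0seq //= eqxx.
    move: h1; rewrite -{1}(cat_take_drop j w) => /subseq_split2[//|[h _]|h].
      by rewrite h in k2.
    by have := mem_subseq h (mem_head _ _); rewrite (negbTE k2).
  have h1 : subseq [:: e; l] w by apply: index_subseq2.
  have h2 : subseq [:: e; - l] w by apply: index_subseq2.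
  have k1 : - l \notin drop j w.
    have := sym_reverse nce2 el (sub2 (- e) _ h1); apply: contra => h.
    by rewrite /ins (cat_subseq (s1 := [::])) ?sub0seq //= eqxx sub1seq.
  have k2 : l \notin drop j w.
    have := sym_reverse nce2 enl (sub2 (- e) _ h2); apply: contra => h.
    by rewrite opprK /ins (cat_subseq (s1 := [::])) ?sub0seq //= eqxx sub1seq.
  move/negP: noenc; apply; rewrite /ins -[[:: e; l; e]]/([:: e; l] ++ [:: e]).
  apply: cat_subseq; rewrite /= ?eqxx ?sub0seq //.
  move: h1; rewrite -{1}(cat_take_drop j w) => /subseq_split2[h|[_ h]|//].
    by have := mem_subseq h (mem_last e [:: l]); rewrite /= (negbTE k2).
  by rewrite h in k2.
have oM := mains_opp C2.
pose e := one_choice ltn.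
have he : (y1 == e) || (y1 == - e) := one_choice_eq ltn.
have hew := one_choice_in ltn; rewrite -/e in hew.
have [cG c0 kG [GM GR Ginj]] := relabelS sw mains_uniq mem_mains oM he hew hc.
set G := relabel m w mains e in cG c0 kG GM GR Ginj.
set r := size mains in cG GM.
set R := relabel_type y1 w e in cG c0 kG GR.
have oneP l : l \in one_list w e -> one_letter y1 w l by rewrite mem_one_list.
have neq l e' : main_letter y1 w l -> one_letter y1 w e' -> index l w != index e' w.
  move=> /and4P[lw _ ly lny] /andP[ew ey]; apply/negP => /eqP/(index_inj 0 lw ew) le.
  by move: ey; rewrite -le (negbTE ly) (negbTE lny).
(* For odd [r] the middle main letter is 0, its own negative, and no letter [e'] can fall between it
   and itself. *)
have par : one_list w e != [::] -> ~~ odd r.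
  case ee: (one_list w e) => [//|e' t] _.
  have /oneP oe' : e' \in one_list w e by rewrite ee mem_head.
  rewrite -mainl0 -GM; apply/negP => /mapP[l lM /esym/eqP].
  have ml : main_letter y1 w l by rewrite -mem_mains.
  rewrite (relabel0 sw mains_uniq mem_mains oM he hew hc); last first.
    by case/and4P: ml => lw _ _ _; rewrite inE lw orbT.
  move=> /eqP l0; have [] := C3 _ _ ml oe'; rewrite l0 oppr0 -l0.
  by have := neq _ _ ml oe'; rewrite neq_ltn => /orP[] h h1 h2; [case: h1|case: h2].
have parR : is_alone R || ~~ odd r.
  move: par GR; case: (one_list w e) => [_|e' t -> //]; last by rewrite orbT.
  by case: (R).
pose I := take r./2 mains ++ one_list w e ++ drop r./2 mains.
have sI : sorted before I.
  have [e0|ne0] := eqVneq (one_list w e) [::].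
    by rewrite /I e0 cat_take_drop mains_sorted.
  have rE := par ne0.
  have idx i : (i < r)%N -> main_letter y1 w mains`_i.
    by move=> ir; rewrite -mem_mains mem_nth.
  have opp i : (i < r)%N -> - mains`_i = mains`_(r.-1 - i) .
    exact: nth_opp_rev.
  have ord i i' : (i < i')%N -> (i' < r)%N -> (index (mains`_i)%R w < index (mains`_i')%R w)%N.
    move=> ii' i'r; have := mains_sorted; rewrite (sorted_pairwise before_trans).
    by move/(pairwiseP 0)/(_ i i'); apply; rewrite // inE; apply: ltn_trans i'r.
  rewrite (sorted_pairwise before_trans) !pairwise_cat -!(sorted_pairwise before_trans).
  rewrite allrel_catr !take_sorted ?drop_sorted ?mains_sorted //; try exact: mains_sorted.
  (* A letter [e'] preceding a main letter of the first half would also precede its negative, which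
     comes later, against [C3]. *)
  have T1 : allrel before (take r./2 mains) (one_list w e).
    apply/allrelP => l e' /(nthP 0)[i]; rewrite size_takel; last by rewrite -/r; lia.
    move=> ir; rewrite nth_take // => <- /oneP oe'; rewrite /=.
    have ir' : (i < r)%N by lia.
    have := neq _ _ (idx _ ir') oe'; rewrite neq_ltn => /orP[//|lt].
    have [_ []] := C3 _ _ (idx _ ir') oe'; split=> //; rewrite opp //.
    by apply: ltn_trans lt _; apply: ord; lia.
  have T2 : allrel before (one_list w e) (drop r./2 mains).
    apply/allrelP => e' l /oneP oe' /(nthP 0)[i]; rewrite size_drop -/r => ir.
    rewrite nth_drop => <- /=; set k := (r./2 + i)%N.
    have kr : (k < r)%N by lia.
    have := neq _ _ (idx _ kr) oe'; rewrite neq_ltn => /orP[lt|//].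
    have [[]] := C3 _ _ (idx _ kr) oe'; split=> //; rewrite opp //.
    by apply: ltn_trans _ lt; apply: ord; lia.
  have T3 : allrel before (take r./2 mains) (drop r./2 mains).
    have := mains_sorted; rewrite -{1}(cat_take_drop r./2 mains).
    by rewrite (sorted_pairwise before_trans) pairwise_cat => /and3P[].
  rewrite T1 T2 T3 /=.
  have -> // : sorted before (one_list w e).
  have := one_list_cases ltn; rewrite -/e.
  case=> [->//|[[e' ->//]|[e' [-> e0 ew new ee]]]]; rewrite /= andbT.
  apply: (@one_choice_lt ltn e' _ ee e0 ew new) => i k ik /=.
  by rewrite ltn_neqAle ik leqNgt.
have hI l : l \in I -> main_letter y1 w l || one_letter y1 w l.
  by rewrite !mem_cat orbCA -mem_cat cat_take_drop mem_mains mem_one_list orbC.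
have sub c : c \in I -> c \in w by case/hI/orP => [/and4P[]|/andP[]].
have uI : uniq I := sorted_uniq before_trans before_irr sI.
have nc : noncross (rev I ++ w).
  apply: noncross_prepend => //.
  - by move=> l b /hI hl bl; apply: C1.
  - apply: noncross_sub nc1; apply: subseq_trans (ins_sub j y1 w) _.
    exact: suffix_subseq.
exists r, R, (map G w); split=> //.
have -> : rev (nc_letters r R) ++ map G w = map G (rev I ++ w).
  by rewrite map_cat map_rev /I !map_cat map_take map_drop GM GR.
have sub' c : c \in rev I ++ w -> c \in w by rewrite mem_cat mem_rev => /orP[/sub|].
by apply: noncross_map nc => a b /sub' aw /sub' bw; apply: Ginj.
Qed.
End Structure.

(** * Inserting a letter into a noncrossing word *)

Section Insertion.
Variable T : eqType.
Implicit Types (x y A B D : seq T) (a b c : T).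

Lemma noncross_filter x p a b : noncross (filter p x) -> p a -> p b -> a != b ->
  ~~ subseq [:: a; b; a; b] x.
Proof.
by move=> nc pa pb /nc; apply: contra => h; rewrite subseq_filter /= pa pb.
Qed.

Lemma subseq_cons_neq a b s x : a != b -> subseq (a :: s) (b :: x) -> subseq (a :: s) x.
Proof. by move=> ab /=; case: eqVneq => // e; rewrite e eqxx in ab. Qed.

Lemma noncross_fresh x y c : c \notin x ++ y -> noncross (x ++ y) -> noncross (x ++ c :: y).
Proof.
move=> cxy nc a b ab.
have [c_ab|] := boolP (c \in [:: a; b]); last first.
  rewrite !inE negb_or => /andP[ca cb].
  apply: (@noncross_filter _ (predC1 c)) => //=; try by rewrite eq_sym.
  rewrite filter_cat /= eqxx -filter_cat; apply: noncross_sub nc; exact: filter_subseq.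
apply/negP => /(leq_count_subseq (pred1 c)).
move: cxy; rewrite mem_cat negb_or => /andP[cx cy].
rewrite count_cat /= eqxx (count_memPn cx) (count_memPn cy).
by move: c_ab; rewrite !inE => /orP[] /eqP ->; rewrite eqxx; case: eqP.
Qed.

Lemma noncross_dup x y c : noncross (x ++ c :: y) -> noncross (x ++ c :: c :: y).
Proof.
move=> nc a b ab; apply/negP => h; have /negP[] := nc _ _ ab; move: h.
have ba : b != a by rewrite eq_sym.
have dup d d' s : d != d' -> subseq (d :: d' :: s) (c :: c :: y) -> subseq (d :: d' :: s) (c :: y).
  move=> dd'; have [e0|dc] := eqVneq d c; last exact: subseq_cons_neq.
  subst d; rewrite /= eqxx; case: eqVneq => // e.
  by rewrite e eqxx in dd'.
have mem d : d \in c :: c :: y -> d \in c :: y by rewrite !inE orbA orbb.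
case/subseq_split4 => [h|[h1 h2]|[h1 h2]|[[h1 /mem h2]|h1]].
- by rewrite (cat_subseq (s1 := [::])) ?sub0seq // dup.
- by rewrite (cat_subseq (s1 := [:: a])) ?sub1seq // dup.
- by rewrite (cat_subseq (s1 := [:: a; b])) // dup.
- by rewrite (cat_subseq (s1 := [:: a; b; a]) (s2 := [:: b])) ?sub1seq.
- by rewrite -[[:: a; b; a; b]]cats0 cat_subseq ?sub0seq.
Qed.

(** A crossing involves two letters, so only the subword on [c] and one other letter [b] matters.
    Either [b] is absent from [B], and the new [c] doubles the old one, or [b] is confined to [B],
    between the two [c]. *)
Lemma noncross_insert A B D c : c \notin A -> c \notin B ->
  noncross (A ++ c :: B ++ D) ->
  (forall b, b != c -> (b \notin D) && (b \notin A) || (b \notin B)) ->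
  noncross (A ++ c :: B ++ c :: D).
Proof.
move=> cA cB nc hb.
suff main b : b != c -> noncross (filter (mem [:: c; b]) (A ++ c :: B ++ c :: D)).
  move=> a b ab.
  have [ac|ac] := eqVneq a c.
    apply: (noncross_filter (main b _)); rewrite //= ?inE ?ac ?eqxx ?orbT //.
    by rewrite -ac eq_sym.
  have [bc|bc] := eqVneq b c.
    by apply: (noncross_filter (main a _)); rewrite //= ?inE ?bc ?eqxx ?orbT.
  apply: (@noncross_filter _ (predC1 c)) => //=.
  have : noncross (filter (predC1 c) (A ++ c :: B ++ D)).
    by apply: noncross_sub nc; apply: filter_subseq.
  by rewrite !filter_cat /= eqxx /= !filter_cat /= eqxx.
move=> bc; have [p p_mem] : exists p : pred T, p =1 mem [:: c; b] by exists (mem [:: c; b]).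
have pE d : p d = (d == c) || (d == b) by rewrite p_mem /= !inE.
have pc : p c by rewrite pE eqxx.
rewrite -(eq_filter p_mem).
case/orP: (hb _ bc) => [/andP[bD bA]|bB]; last first.
  have eB : filter p B = [::].
    apply/eqP; rewrite -[_ == _]negbK -has_filter; apply/hasPn => d dB.
    by rewrite pE; apply/norP; split; apply: contraTneq dB => ->.
  have : noncross (filter p (A ++ c :: B ++ D)).
    by apply: noncross_sub nc; apply: filter_subseq.
  rewrite !filter_cat /= pc !filter_cat /= pc eB; exact: noncross_dup.
have eA : filter p A = [::].
  apply/eqP; rewrite -[_ == _]negbK -has_filter; apply/hasPn => d dA.
  by rewrite pE; apply/norP; split; apply: contraTneq dA => ->.
rewrite !filter_cat /= pc !filter_cat /= pc eA /=.
set B' := filter p B; set D' := filter p D.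
have cB' : c \notin B' by rewrite mem_filter negb_and cB orbT.
have inD d : d \in c :: D' -> d = c.
  rewrite inE mem_filter pE => /orP[/eqP//|/andP[/orP[/eqP//|/eqP ->]]].
  by rewrite (negbTE bD).
have k1 : ~~ subseq [:: c; b; c; b] (c :: B' ++ c :: D').
  rewrite -cat_cons; apply/negP => /subseq_split4.
  have nb s : b \in s -> ~~ subseq s (c :: D').
    by move=> bs; apply/negP => /mem_subseq/(_ b bs)/inD bc'; rewrite bc' eqxx in bc.
  case=> [|[_]|[_]|[[_ /inD bc']|]]; try by apply/negP/nb; rewrite !inE eqxx ?orbT.
    by rewrite bc' eqxx in bc.
  move/(leq_count_subseq (pred1 c)); rewrite /= eqxx (count_memPn cB').
  by case: eqP.
have k2 : ~~ subseq [:: b; c; b; c] (c :: B' ++ c :: D').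
  apply/negP => /(subseq_cons_neq bc)/subseq_split4.
  have nb s : b \in s -> ~~ subseq s (c :: D').
    by move=> bs; apply/negP => /mem_subseq/(_ b bs)/inD bc'; rewrite bc' eqxx in bc.
  have nB s : c \in s -> ~~ subseq s B'.
    by move=> cs; apply/negP => /mem_subseq/(_ c cs); rewrite (negbTE cB').
  case=> [|[_]|[]|[[]|]].
  - by apply/negP/nb; rewrite !inE eqxx.
  - by apply/negP/nb; rewrite !inE eqxx orbT.
  - by move=> + _; apply/negP/nB; rewrite !inE eqxx orbT.
  - by move=> + _; apply/negP/nB; rewrite !inE eqxx orbT.
  - by apply/negP/nB; rewrite !inE eqxx orbT.
move=> a a' aa'; apply/negP => h.
have inx d : d \in [:: a; a'] -> (d == c) || (d == b).
  move=> dx; have : d \in c :: B' ++ c :: D'.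
    by apply: (mem_subseq h); move: dx; rewrite !inE => /orP[] ->; rewrite ?orbT.
  rewrite inE mem_cat => /or3P[->//| |/inD ->]; last by rewrite eqxx.
  by rewrite mem_filter pE => /andP[].
have /orP[/eqP ea|/eqP ea] := inx a (mem_head _ _);
have /orP[/eqP ea'|/eqP ea'] := inx a' (mem_last a [:: a']);
  move: h aa'; rewrite ea ea' ?eqxx ?(negbTE k1) ?(negbTE k2) //.
Qed.
End Insertion.

(** * From canonical noncrossing words back to partitions *)

Section CanNoncrossing.
Local Open Scope ring_scope.

(** Letters shared by both halves have their negatives in [h], so [hI] puts them in [I]. A pattern
    split as 1 + 3 or 3 + 1 encloses such a letter. A pattern split as 2 + 2 needs [a], [b] and
    [- a], [- b] in this order in [h], while of two letters of [I] no smaller one may precede a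
    larger one. *)
Lemma sym_noncross (I h : seq int) : sorted >%R I -> noncross (rev I ++ h) ->
  (forall l, l \in h -> - l \in h -> l \in I) -> noncross (sym h).
Proof.
move=> sI nc hI.
have gt_trans : transitive (>%R : rel int) by move=> a b c /= ab bc; exact: lt_trans bc ab.
have gt_irr : irreflexive (>%R : rel int) by move=> a /=; rewrite ltxx.
have uI := sorted_uniq gt_trans gt_irr sI.
have nch : noncross h by apply: noncross_sub nc; apply: suffix_subseq.
have ord a b : a \in I -> b \in I -> b < a -> ~~ subseq [:: b; a] h.
  move=> aI bI ba; have [s1 [s2 [eI bs2]]] := sorted_split gt_trans gt_irr sI aI bI ba.
  exact: noncross_order eI bs2.
move=> a b ab; apply/negP; rewrite /sym => /subseq_split4[|[]|[]|[[]|]];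
  rewrite ?mem_opp ?subseq_opp /=.
- by apply/negP; apply: nch.
- move=> na h3; have aI : a \in I.
    by apply: hI => //; apply: (mem_subseq h3); rewrite !inE eqxx orbT.
  by move: h3; apply/negP; apply: (noncross_no_enclosed nc aI); rewrite eq_sym.
- move=> h1 h2.
  have aI : a \in I.
    apply: hI; first by apply: (mem_subseq h2); rewrite !inE eqxx.
    by apply: (mem_subseq h1); rewrite !inE eqxx.
  have bI : b \in I.
    apply: hI; first by apply: (mem_subseq h2); rewrite !inE eqxx orbT.
    by apply: (mem_subseq h1); rewrite !inE eqxx orbT.
  have naI : - a \in I.
    apply: hI; first by apply: (mem_subseq h1); rewrite !inE eqxx.
    by rewrite opprK; apply: (mem_subseq h2); rewrite !inE eqxx.
  have nbI : - b \in I.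
    apply: hI; first by apply: (mem_subseq h1); rewrite !inE eqxx orbT.
    by rewrite opprK; apply: (mem_subseq h2); rewrite !inE eqxx orbT.
  have [lt|lt|e] := ltgtP a b; last by rewrite e eqxx in ab.
    by have := ord _ _ bI aI lt; rewrite h2.
  have := ord _ _ nbI naI; rewrite ltrN2 => /(_ lt); by rewrite h1.
- move=> h3 bh; have nbI : - b \in I.
    by apply: hI; rewrite ?opprK //; apply: (mem_subseq h3); rewrite !inE eqxx orbT.
  by move: h3; apply/negP; apply: (noncross_no_enclosed nc nbI); rewrite eqr_opp.
- by apply/negP; apply: nch; rewrite eqr_opp.
Qed.

Lemma nth_main_labels r j : (j < r)%N -> (main_labels r)`_j = main_label r j.
Proof. by move=> jr; rewrite (nth_map 0%N) ?size_iota // nth_iota. Qed.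

Lemma mem_take_main_labels r l : l \in take r./2 (main_labels r) -> ~~ odd r -> 2 <= l.
Proof.
move=> /(nthP 0)[i]; rewrite size_takel ?size_main_labels; last by lia.
by move=> ir; rewrite nth_take // nth_main_labels; [|lia] => <-; rewrite /main_label; lia.
Qed.

Lemma mem_drop_main_labels r l : l \in drop r./2 (main_labels r) -> ~~ odd r -> l <= -2.
Proof.
move=> /(nthP 0)[i]; rewrite size_drop size_main_labels => ir.
by rewrite nth_drop nth_main_labels; [|lia] => <-; rewrite /main_label; lia.
Qed.

Lemma sorted_nc_letters r R : is_alone R || ~~ odd r -> sorted >%R (nc_letters r R).
Proof.
have gt_trans : transitive (>%R : rel int) by move=> a b c /= ab bc; exact: lt_trans bc ab.
move=> par; have sm := sorted_main_labels r.
have [e0|ne0] := eqVneq (one_labels R) [::]; first by rewrite /nc_letters e0 cat_take_drop.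
have re : ~~ odd r by case: R par ne0.
rewrite /nc_letters (sorted_pairwise gt_trans) !pairwise_cat -!(sorted_pairwise gt_trans).
rewrite allrel_catr take_sorted // drop_sorted //.
have -> : sorted >%R (one_labels R) by case: (R).
have T1 l : l \in take r./2 (main_labels r) -> 2 <= l by move/mem_take_main_labels; apply.
have T2 l : l \in drop r./2 (main_labels r) -> l <= -2 by move/mem_drop_main_labels; apply.
have T3 l : l \in one_labels R -> -2 < l /\ l < 2 by move/one_labels_bound; lia.
have -> : allrel >%R (take r./2 (main_labels r)) (one_labels R).
  by apply/allrelP => a b /= /T1 h1 /T3 h2; lia.
have -> : allrel >%R (take r./2 (main_labels r)) (drop r./2 (main_labels r)).
  by apply/allrelP => a b /= /T1 h1 /T2 h2; lia.
have -> // : allrel >%R (one_labels R) (drop r./2 (main_labels r)).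
by apply/allrelP => a b /= /T3 h1 /T2 h2; lia.
Qed.

Variables (m r : nat) (R : one_type) (w : seq int).
Hypotheses (m0 : (0 < m)%N) (cw : canonical m r R w) (par : is_alone R || ~~ odd r).
Hypothesis nc : noncross (rev (nc_letters r R) ++ w).

Lemma nc_letters_order a b : a \in nc_letters r R -> b \in nc_letters r R -> b < a -> ~~ subseq [:: b; a] w.
Proof.
have gt_trans : transitive (>%R : rel int) by move=> c d e /= cd de; exact: lt_trans de cd.
have gt_irr : irreflexive (>%R : rel int) by move=> c /=; rewrite ltxx.
move=> aI bI ba.
have [s1 [s2 [eI bs2]]] := sorted_split gt_trans gt_irr (sorted_nc_letters par) aI bI ba.
by apply: noncross_order eI bs2 => //; exact: (nc_letters_uniq cw).
Qed.

Lemma canonical_dup T D e : w = T ++ e :: D -> noncross (sym (T ++ e :: e :: D)).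
Proof.
move=> ew; apply: (sym_noncross (sorted_nc_letters par)).
  by move: nc; rewrite ew !catA; exact: noncross_dup.
move=> l; have mw k : k \in T ++ e :: e :: D -> k \in w.
  by rewrite ew !(mem_cat, inE); case: (k \in T) => //; case: (k == e).
by move=> /mw lw /mw nlw; exact: (canonical_neg cw).
Qed.

(** The insertion point is explicit: the end of [w] if neither 1 nor -1 has a positive companion,
    right after the first 0 if 1 is in the zero block, and right after the last letter 1
    otherwise. *)
Lemma canonical_ncword : ncword (one_label R) w.
Proof.
have [sw sub _ _] := cw.
have one_notin : is_alone R || is_zero R -> (1 \notin w) && (-1 \notin w).
  move=> h; have nI l : (l == 1) || (l == -1) -> l \notin nc_letters r R.
    rewrite mem_nc_letters => hl; apply/negP => /orP[/main_labels_odd|]; first by move: hl; clear; lia.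
    by case: (R) h => //= _; rewrite inE; move: hl; clear; lia.
  apply/andP; split; apply/negP => lw; have := canonical_big cw lw; rewrite nI ?eqxx ?orbT //.
    by move/(_ isT); rewrite /opener_label; clear; lia.
  by move/(_ isT); rewrite /opener_label; clear; lia.
have insE T D e : w = T ++ D -> ins (size T) e w = T ++ e :: D.
  by move=> ->; rewrite /ins take_size_cat // drop_size_cat.
have fresh e : (1 \notin w) && (-1 \notin w) -> (e == 1) || (e == -1) -> is_alone R ->
    noncross (sym (ins m e w)).
  move=> /andP[n1 nn1] he rn; rewrite -sw (insE w [::] e) ?cats0 //.
  have ew : (e \notin w) && (- e \notin w).
    by case/orP: he => /eqP ->; rewrite ?opprK n1 nn1.
  have eI : e \notin nc_letters r R.
    rewrite mem_nc_letters; apply/negP => /orP[/main_labels_odd|]; first by move: he; clear; lia.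
    by case: (R) rn.
  case/andP: ew => ew new.
  apply: (sym_noncross (sorted_nc_letters par)).
    rewrite catA; apply: noncross_fresh; rewrite ?cats0 // mem_cat mem_rev negb_or eI ew //.
  have mw k : k \in w ++ [:: e] -> (k \in w) || (k == e) by rewrite mem_cat inE.
  move=> l /mw/orP[lw|/eqP ->] /mw/orP[nlw|].
  - exact: (canonical_neg cw).
  - by move/eqP => le; move: new; rewrite -le opprK lw.
  - by rewrite nlw in new.
  - by move: he; clear; lia.
have [rn|nrn] := boolP (is_alone R).
  have h := one_notin (introT orP (or_introl rn)).
  exists m; rewrite sw m0 leqnn; split=> //.
    by apply: fresh => //; case: (R) rn.
  by apply: fresh => //; case: (R) rn.
have [r0|nr0] := boolP (is_zero R).
  have y0 : one_label R = 0 by case: (R) r0.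
  have /split_first[T [D [ew _]]] : 0 \in w by apply: sub; rewrite mem_nc_letters; case: (R) r0 => //= _; rewrite inE orbT.
  have nc0 := canonical_dup ew.
  have ew' : w = (T ++ [:: 0]) ++ D by rewrite -catA.
  exists (size (T ++ [:: 0])); split.
  - by rewrite [X in (_ <= _ <= size X)%N]ew' !size_cat /= addn1 ltnS leq0n /= leq_addr.
  - by rewrite (insE _ _ _ ew') y0 -catA.
  - by rewrite (insE _ _ _ ew') y0 oppr0 -catA.
have IR1 : 1 \in one_labels R by case: (R) nrn nr0 => //= b; rewrite !inE.
have /split_last[T [D [ew oneD]]] : 1 \in w by apply: sub; rewrite mem_nc_letters IR1 orbT.
have ew' : w = (T ++ [:: 1]) ++ D by rewrite -catA.
have re : ~~ odd r by case/orP: par => // h; rewrite h in nrn.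
pose Up := take r./2 (main_labels r); pose Dn := drop r./2 (main_labels r).
have I2 : nc_letters r (OneTwoSided false) = Up ++ [:: 1; -1] ++ Dn by [].
have uI := nc_letters_uniq cw.
have odd1 l : (l == 1) || (l == -1) -> l \notin main_labels r.
  by move=> hl; apply/negP => /main_labels_odd; move: hl; clear; lia.
have nUp l : l \notin main_labels r -> l \notin Up by apply: contra => /mem_take.
have nDn l : l \notin main_labels r -> l \notin Dn by apply: contra => /mem_drop.
have ord a b : a \in nc_letters r R -> b \in nc_letters r R -> b < a -> ~~ subseq [:: b; a] w.
  exact: nc_letters_order.
have oneI : 1 \in nc_letters r R by rewrite mem_nc_letters IR1 orbT.
have before1 b : b \in T -> subseq [:: b; 1] w.
  by move=> bT; rewrite ew (cat_subseq (s1 := [:: b])) ?sub1seq ?mem_head.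
have negw : -1 \notin one_labels R -> -1 \notin w.
  move=> n1; apply/negP => lw; have := canonical_big cw lw.
  by rewrite mem_nc_letters negb_or odd1 // n1 => /(_ isT); rewrite /opener_label; clear; lia.
have nT : -1 \notin T.
  apply/negP => nT; have [n1|n1] := boolP (-1 \in one_labels R).
    by have := ord 1 (-1) oneI; rewrite mem_nc_letters n1 orbT before1 // => /(_ isT isT).
  by have := negw n1; rewrite ew mem_cat nT.
(* Both 1 and -1 are listed here even if only 1 occurs in [w]: an absent -1 enters as a fresh
   letter. *)
have nc2 : noncross (rev Dn ++ -1 :: (1 :: rev Up ++ T ++ [:: 1]) ++ D).
  have E : rev Up ++ w = (rev Up ++ T ++ [:: 1]) ++ D by rewrite ew' -!catA.
  rewrite cat_cons -E; have [n1|n1] := boolP (-1 \in one_labels R).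
    have eI : nc_letters r R = Up ++ [:: 1; -1] ++ Dn.
      by rewrite /nc_letters; case: (R) nrn nr0 n1 => //= b; rewrite inE.
    by move: nc; rewrite eI !rev_cat -!catA.
  have eI : nc_letters r R = Up ++ [:: 1] ++ Dn.
    by rewrite /nc_letters; case: (R) nrn nr0 n1 => //= b; rewrite !inE.
  apply: noncross_fresh; last by move: nc; rewrite eI !rev_cat -!catA.
  rewrite !(mem_cat, inE) !mem_rev !negb_or (negw n1).
  by rewrite (nUp (-1)) ?(nDn (-1)) ?odd1.
have nc3 : noncross (sym (T ++ 1 :: -1 :: D)).
  have sI : sorted >%R (nc_letters r (OneTwoSided false)) by apply: sorted_nc_letters; rewrite re orbT.
  apply: (sym_noncross sI).
    rewrite I2 !rev_cat -!catA /=.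
    have := @noncross_insert _ (rev Dn) (1 :: rev Up ++ T ++ [:: 1]) D (-1).
    rewrite /= -!catA /=; apply.
    - by rewrite mem_rev nDn // odd1.
    - by rewrite !(mem_cat, inE) mem_rev !negb_or nT (nUp (-1)) ?odd1.
    - by move: nc2; rewrite /= -!catA.
    (* Letters between the listed -1 and the insertion point must be absent from [D] and [Dn]. For
       [b = 1] this holds since the last 1 was chosen; letters of [Up] exceed 1 and cannot follow
       it; a letter of [T] can neither enclose 1 nor, if smaller, precede it. *)
    - move=> b b1; rewrite orbC -implybE; apply/implyP.
      rewrite !(mem_cat, inE) !mem_rev => hb.
      have bcase : [\/ b = 1, b \in Up | b \in T].
        case/or4P: hb => [/eqP -> |h|h|/eqP ->]; [by constructor 1|by constructor 2|by constructor 3|by constructor 1].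
      have [->|bn1] := eqVneq b 1; first by rewrite oneD nDn ?odd1.
      case: bcase => [e|bU|bT]; first by rewrite e eqxx in bn1.
        have b2 := mem_take_main_labels bU re; apply/andP; split; last first.
          by apply/negP => /mem_drop_main_labels/(_ re); move: b2; clear; lia.
        have b3 : 1 < b by move: b2; clear; lia.
        have bI : b \in nc_letters r R by rewrite mem_nc_letters (mem_take bU).
        have := ord _ _ bI oneI b3; apply: contra => bD.
        by rewrite ew (cat_subseq (s1 := [::])) ?sub0seq //= sub1seq.
      apply/andP; split.
        have := noncross_no_enclosed nc oneI bn1; apply: contra => bD.
        by rewrite ew (cat_subseq (s1 := [:: b])) ?sub1seq //= sub1seq.
      apply/negP => bD; have bm2 := mem_drop_main_labels bD re.
      have bI : b \in nc_letters r R by rewrite mem_nc_letters (mem_drop bD).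
      have b3 : b < 1 by move: bm2; clear; lia.
      by have := ord _ _ oneI bI b3; rewrite before1.
  have mw k : k \in T ++ 1 :: -1 :: D -> (k == 1) || (k == -1) || (k \in w).
    by rewrite ew !(mem_cat, inE); case: (k \in T); case: (k == 1); case: (k == -1); case: (k \in D).
  move=> l /mw hl /mw hnl.
  have [l1|l1] := boolP ((l == 1) || (l == -1)).
    by rewrite I2 !(mem_cat, inE); case/orP: l1 => ->; rewrite ?orbT.
  have nl1 : ((- l == 1) || (- l == -1)) = false by move: l1; clear; lia.
  rewrite (negbTE l1) /= in hl; rewrite nl1 /= in hnl.
  have := canonical_neg cw hl hnl; rewrite !mem_nc_letters => /orP[->//|].
  by case: (R) nrn nr0 => [||b|b] //= _ _; rewrite !inE; move: l1; clear; lia.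
have nc1 := canonical_dup ew.
exists (size (T ++ [:: 1])); split.
- by rewrite [X in (_ <= _ <= size X)%N]ew' !size_cat /= addn1 ltnS leq0n /= leq_addr.
- by rewrite (insE _ _ _ ew') -catA; case: (R) nrn nr0 => //= -[].
- by rewrite (insE _ _ _ ew') -catA; case: (R) nrn nr0 => //= -[]; rewrite ?opprK.
Qed.
End CanNoncrossing.

(** * Statistics *)

(** Strict sortedness of [s] excludes ties between least elements, so the sort has only one possible
    outcome. *)
Lemma ordered_blocksE n (q : pred {set Lam n}) (P : {set {set Lam n}}) s :
  (forall B, (B \in s) = (B \in P) && q B) ->
  sorted (relpre (@least_positive n) ltn) s -> ordered_blocks q P = s.
Proof.
move=> hs ss; have tr : transitive (relpre (@least_positive n) ltn).
  by move=> a b c /=; apply: ltn_trans.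
have ir : irreflexive (relpre (@least_positive n) ltn) by move=> a /=; rewrite ltnn.
have us := sorted_uniq tr ir ss.
have pe : perm_eq (ordered_blocks q P) s.
  rewrite /ordered_blocks perm_sort; apply: uniq_perm; rewrite ?enum_uniq // => B.
  by rewrite mem_enum inE hs.
apply: (irr_sorted_eq tr ir) => //; last exact: perm_mem.
rewrite -sorted_map ltn_sorted_uniq_leq (perm_uniq (perm_map _ pe)).
have := ss; rewrite -sorted_map ltn_sorted_uniq_leq => /andP[-> _].
by rewrite sorted_map; apply: sort_sorted => B C; apply: leq_total.
Qed.

Lemma bigminn_le (T : eqType) (r : seq T) (p : pred T) (F : T -> nat) n s :
  s \in r -> p s -> \big[minn/n]_(i <- r | p i) F i <= F s.
Proof.
elim: r => // a r IH; rewrite inE big_cons => /orP[/eqP <- -> |sr ps].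
  exact: geq_minl.
by case: ifP => _; rewrite ?geq_min IH // orbT.
Qed.

Section Stats.
Variable m : nat.
Local Notation n := m.+1.
Implicit Types (B : {set Lam n}) (P : {set {set Lam n}}).
Local Open Scope ring_scope.

Lemma pos_inj p q : (p < m)%N -> (q < m)%N -> epos m p = epos m q -> p = q.
Proof. by move=> pm qm /(congr1 (@ival n)); rewrite !ival_pos //; lia. Qed.

Lemma pos_positives p : (p < m)%N -> epos m p \in positives n.
Proof. by move=> pm; rewrite inE ival_pos. Qed.

Lemma neg_positives p : (p < m)%N -> eneg m p \notin positives n.
Proof. by move=> pm; rewrite inE ival_neg //; lia. Qed.

Lemma one_positives b : eone m b \notin positives n.
Proof. by rewrite inE ival_one; case: b. Qed.

Lemma none_positives : None \notin positives n.
Proof. by rewrite inE. Qed.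

Lemma onesP s : reflect (exists b, s = eone m b) (s \in ones n).
Proof.
apply: (iffP idP) => [|[b ->]]; last by rewrite inE ival_one; case: b.
case: (LamP s) => [|b|p pm|p pm]; rewrite inE //.
- by exists b.
- by rewrite ival_pos.
- by rewrite ival_neg //; lia.
Qed.

Section Block.
Variables (u : seq int) (B : {set Lam n}) (l : int).
Hypothesis su : size u = m.
Hypothesis hB : forall p, (p < m)%N -> (epos m p \in B) = (u`_p == l).

Lemma block_positivesP s : reflect (exists p, [/\ (p < m)%N, s = epos m p & u`_p = l])
  (s \in B :&: positives n).
Proof.
rewrite inE; apply: (iffP andP) => [[]|[p [pm -> e]]]; last first.
  by rewrite hB // e eqxx pos_positives.
case: (LamP s) => [|b|p pm|p pm]; rewrite ?(negbTE none_positives) ?(negbTE (one_positives _)) //.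
  by rewrite hB // => /eqP e _; exists p.
by rewrite (negbTE (neg_positives _)).
Qed.

(** The word [u] is kept apart from any labelling of the partition, so that the same computation
    serves the blocks of [CM], read from a merged word. *)
Lemma least_positiveE : l \in u -> least_positive B = (index l u).+2.
Proof.
move=> lu; have im : (index l u < m)%N by rewrite -su index_mem.
apply/eqP; rewrite eqn_leq; apply/andP; split.
  have -> : (index l u).+2 = `|ival (epos m (index l u))|%N by rewrite ival_pos.
  apply: bigminn_le; first by rewrite mem_index_enum.
  by apply/block_positivesP; exists (index l u); rewrite nth_index.
rewrite /least_positive; elim/big_ind: _ => //.
  by move=> a b ha hb; rewrite leq_min ha.
move=> s /block_positivesP[p [pm -> e]]; rewrite ival_pos //= !ltnS -e.
by apply: index_nth_le; rewrite su.
Qed.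

Lemma card_block_positives : #|B :&: positives n| = count_mem l u.
Proof.
have -> : B :&: positives n = [set epos m (val p) | p in [set p : 'I_m | u`_p == l]].
  apply/setP => s; apply/block_positivesP/imsetP => [[p [pm -> e]]|[p + ->]].
    by exists (Ordinal pm); rewrite // inE /= e.
  by rewrite inE => /eqP e; exists p.
rewrite card_in_imset; last by move=> p q _ _ /pos_inj e; apply: val_inj; exact: e (ltn_ord p) (ltn_ord q).
rewrite -{2}(mkseq_nth 0 u) su /mkseq count_map -val_enum_ord count_map.
rewrite -sum1_card -sum1_count big_enum_cond /=.
by apply: eq_bigl => p; rewrite !inE.
Qed.
End Block.

Section BlockList.
Variables (u : seq int) (f : int -> {set Lam n}) (I : seq int) (P : {set {set Lam n}})
  (q : pred {set Lam n}).
Hypothesis su : size u = m.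
Hypothesis hf : forall l p, l \in I -> (p < m)%N -> (epos m p \in f l) = (u`_p == l).
Hypothesis Iu : {subset I <= u}.
Hypothesis sI : sorted (relpre (index^~ u) ltn) I.
Hypothesis hP : forall B, B \in P -> q B -> exists2 l, l \in I & B = f l.
Hypothesis hI : forall l, l \in I -> f l \in P /\ q (f l).

Lemma ordered_blocks_map : ordered_blocks q P = map f I.
Proof.
apply: ordered_blocksE => [B|].
  apply/mapP/andP => [[l lI ->]|[BP qB]]; first by case: (hI lI).
  by have [l lI ->] := hP BP qB; exists l.
rewrite sorted_map; apply: (@sub_in_sorted _ (mem I) (relpre (index^~ u) ltn)) sI; last exact/allP.
move=> a b aI bI /=; have la := least_positiveE su (fun p => @hf a p aI) (Iu aI).
by have lb := least_positiveE su (fun p => @hf b p bI) (Iu bI); rewrite la lb !ltnS.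
Qed.

Lemma least_positive_map : [seq least_positive B | B <- map f I] = [seq (index l u).+2 | l <- I].
Proof.
rewrite -map_comp; apply/eq_in_map => l lI /=.
exact: least_positiveE su (fun p => @hf l p lI) (Iu lI).
Qed.

Lemma card_positives_map : [seq #|B :&: positives n| | B <- map f I] = [seq count_mem l u | l <- I].
Proof.
rewrite -map_comp; apply/eq_in_map => l lI /=.
exact: card_block_positives su (fun p => @hf l p lI).
Qed.
End BlockList.

Section Ker.
Variables (y1 : int) (w : seq int).
Hypothesis sw : size w = m.
Local Notation v := (y1 :: w).
Local Notation P := (ker_partition n v).

Definition block_of l : {set Lam n} := [set s | vval v s == l].

Lemma block_of_pos l p : (p < m)%N -> (epos m p \in block_of l) = (w`_p == l).
Proof. by move=> pm; rewrite inE vval_pos. Qed.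

Lemma block_of_in l s : s \in block_of l -> block_of l \in P.
Proof. by rewrite inE => /eqP <-; apply/ker_partitionP; exists s. Qed.

Lemma block_of_letter l : l \in w -> block_of l \in P.
Proof.
move=> lw; apply: (@block_of_in _ (epos m (index l w))).
have im : (index l w < m)%N by rewrite -sw index_mem.
by rewrite block_of_pos // nth_index.
Qed.

Lemma block_of_disjoint_positives l : [disjoint block_of l & positives n] = (l \notin w).
Proof.
rewrite finset.disjoints_subset; apply/fintype.subsetP/idP => [h|lw s].
  apply/negP => lw; have im : (index l w < m)%N by rewrite -sw index_mem.
  have := h (epos m (index l w)); rewrite block_of_pos // nth_index // eqxx => /(_ isT).
  by rewrite inE pos_positives.
rewrite inE => /eqP e; rewrite inE; case: (LamP s) e => [|b|p pm|p pm] e.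
- exact: none_positives.
- exact: one_positives.
- by move: lw; rewrite -e vval_pos // mem_nth ?sw.
- exact: neg_positives.
Qed.

Lemma block_of_disjoint_ones l : [disjoint block_of l & ones n] = (l != y1) && (l != - y1).
Proof.
rewrite finset.disjoints_subset; apply/fintype.subsetP/andP => [h|[h1 h2] s].
  split; apply/negP => /eqP e.
    have := h (eone m false); rewrite !inE vval_one expr0 mul1r e eqxx => /(_ isT).
    by rewrite ival_one.
  have := h (eone m true); rewrite !inE vval_one expr1 mulN1r e eqxx => /(_ isT).
  by rewrite ival_one.
rewrite inE => /eqP e; rewrite inE; apply/onesP => -[b es]; move: h1 h2; rewrite -e es.
by have := vval_oneE m y1 w b; case/orP=> ->; rewrite ?andbF.
Qed.

Lemma block_of_sub_positives l : l \in w ->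
  (block_of l \subset positives n) = ~~ (main_letter y1 w l || one_letter y1 w l).
Proof.
move=> lw; apply/fintype.subsetP/idP => [h|].
  apply/negP => /orP[/and4P[_ nlw _ _]|/andP[_ hl]].
    have im : (index (- l) w < m)%N by rewrite -sw index_mem.
    have := h (eneg m (index (- l) w)); rewrite (negbTE (neg_positives im)) inE.
    by rewrite vval_neg // nth_index // opprK eqxx => /(_ isT).
  have : ~~ [disjoint block_of l & ones n].
    by rewrite block_of_disjoint_ones; case/orP: hl => /eqP ->; rewrite eqxx ?andbF.
  case/pred0Pn => s /= /andP[sB /onesP[b es]].
  by have := h _ sB; rewrite es (negbTE (one_positives b)).
rewrite negb_or /main_letter /one_letter lw /= negb_or !negb_and !negbK.
move=> /andP[h1 /andP[l1 l2]] s; rewrite inE => /eqP e.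
rewrite (negbTE l1) (negbTE l2) !orbF in h1.
case: (LamP s) e => [|b|p pm|p pm] e.
- by move: h1; rewrite -e /= oppr0; move: lw; rewrite -e /= => ->.
- by have := vval_oneE m y1 w b; rewrite e (negbTE l1) (negbTE l2).
- exact: pos_positives.
- by move: h1; rewrite -e vval_neg // opprK mem_nth ?sw.
Qed.

Lemma switching_block_of l : switching (block_of l) =
  (main_letter y1 w l || one_letter y1 w l).
Proof.
rewrite /switching block_of_disjoint_positives negbK.
have [lw|lw] := boolP (l \in w); first by rewrite block_of_sub_positives // negbK.
by rewrite /main_letter /one_letter (negbTE lw).
Qed.

Lemma meeting_block_of l : meets_positives_and_ones (block_of l) = one_letter y1 w l.
Proof.
by rewrite /meets_positives_and_ones block_of_disjoint_positives block_of_disjoint_ones negbK negb_and !negbK.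
Qed.

Lemma ker_block_of B : B \in P -> exists l, B = block_of l.
Proof. by case/ker_partitionP => s ->; exists (vval v s). Qed.

Lemma pns_block_of B : B \in P -> positive_nonswitching B ->
  exists2 l, (l \in w) && ~~ (main_letter y1 w l || one_letter y1 w l) & B = block_of l.
Proof.
case/ker_partitionP => s eB; rewrite /positive_nonswitching => sub.
have sB : s \in B by rewrite eB inE.
have lw : vval v s \in w.
  have := fintype.subsetP sub _ sB; case: (LamP s) => [|b|p pm|p pm].
  - by rewrite (negbTE none_positives).
  - by rewrite (negbTE (one_positives b)).
  - by rewrite vval_pos // mem_nth ?sw.
  - by rewrite (negbTE (neg_positives pm)).
exists (vval v s) => //; rewrite lw -block_of_sub_positives //.
by rewrite /block_of -eB.
Qed.
End Ker.

(** The merged block contains 0, hence is not positive, and positive blocks avoid 1, -1 and 0, so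
    merging leaves them untouched. *)
Lemma pns_CM P : (exists2 B, B \in P & None \in B) ->
  [set B in CM P | positive_nonswitching B] = [set B in P | positive_nonswitching B].
Proof.
move=> [B0 B0P nB0]; apply/setP => B; rewrite !inE; apply/andP/andP.
  case=> /orP[/eqP ->|/andP[BP _]] // sub.
  case/negP: none_positives; apply: (fintype.subsetP sub).
  rewrite !inE /=; apply/finset.bigcupP; exists B0 => //.
  rewrite B0P; apply/pred0Pn; exists None; rewrite /= nB0 !inE //.
case=> BP sub; split=> //; apply/orP; right; rewrite BP /=.
rewrite finset.disjoints_subset; apply: fintype.subset_trans sub _; apply/fintype.subsetP => s.
by rewrite !inE; lia.
Qed.
End Stats.

Lemma sorted_of_split (T : eqType) (e : rel T) I :
  (forall I1 l I2 l', I = I1 ++ l :: I2 -> l' \in I2 -> e l l') -> sorted e I.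
Proof.
move=> h; apply: pairwise_sorted; elim: I h => //= a I IH h; apply/andP; split.
  by apply/allP => b bI; apply: (h [::] a I b).
by apply: IH => I1 l I2 l' eI; apply: (h (a :: I1)); rewrite eI.
Qed.

Lemma nonnest_sorted (T : eqType) (I w : seq T) : uniq I -> {subset I <= w} ->
  nonnest (I ++ w) -> sorted (relpre (index^~ w) ltn) I.
Proof.
move=> uI Iw nn; apply: sorted_of_split => I1 l I2 l' eI l'I /=.
exact: nonnest_index eI l'I.
Qed.

Lemma noncross_sorted (T : eqType) (I w : seq T) : uniq I -> {subset I <= w} ->
  noncross (rev I ++ w) -> sorted (relpre (index^~ w) ltn) I.
Proof.
move=> uI Iw nc; apply: sorted_of_split => I1 l I2 l' eI l'I /=.
have lw : l \in w by apply: Iw; rewrite eI mem_cat mem_head orbT.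
have lw' : l' \in w by apply: Iw; rewrite eI mem_cat inE l'I !orbT.
have := noncross_order uI nc eI l'I; rewrite ltnNge leq_eqVlt; apply: contra.
case/orP=> [/eqP/(index_inj l lw' lw) e|]; last exact: index_subseq2.
by move: uI; rewrite eI cat_uniq /= -e l'I !andbF.
Qed.

(** * Statistics of a canonical word *)

Section CanStats.
Local Open Scope ring_scope.
Variables (m r : nat) (R : one_type) (w : seq int).
Hypothesis cw : canonical m r R w.
Local Notation n := m.+1.
Local Notation P := (ker_partition n (one_label R :: w)).
Local Notation before := (relpre (index^~ w) ltn).
Local Notation B_ := (block_of m (one_label R) w).

Let sw : size w = m. Proof. by case: cw. Qed.
Let sub : {subset nc_letters r R <= w}. Proof. by case: cw. Qed.

(** On a canonical word, the positions of the least elements of the positive nonswitching blocks,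
    recognisable because such a letter encodes the position where it opens. *)
Definition openers (u : seq int) := [seq p <- iota 0 m | u`_p == opener_label m p].
Local Notation J := (map (opener_label m) (openers w)).

Lemma mem_openers (u : seq int) p : (p \in openers u) = (p < m)%N && (u`_p == opener_label m p).
Proof. by rewrite mem_filter mem_iota andbC. Qed.

Lemma opener_label_nc_letters p : opener_label m p \notin nc_letters r R.
Proof. by apply/negP => /(nc_letters_bound cw); rewrite /opener_label; clear; lia. Qed.

Lemma opener_label_inj : injective (opener_label m).
Proof. by move=> p q; rewrite /opener_label; clear; lia. Qed.

Lemma index_opener_label p : opener_label m p \in w -> index (opener_label m p) w = p.
Proof. by move=> pw; apply: opener_label_inj; rewrite -(canonical_big cw pw) // opener_label_nc_letters. Qed.

Lemma opener_in p : p \in openers w -> opener_label m p \in w.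
Proof. by rewrite mem_openers => /andP[pm /eqP <-]; rewrite mem_nth ?sw. Qed.

Lemma in_opener p : opener_label m p \in w -> p \in openers w.
Proof.
move=> pw; have ip := index_opener_label pw; rewrite mem_openers.
have pm : (p < m)%N by rewrite -sw -{1}ip index_mem.
by rewrite pm -{1}ip nth_index // eqxx.
Qed.

Lemma mem_J l : (l \in J) = (l \in w) && ~~ (main_letter (one_label R) w l || one_letter (one_label R) w l).
Proof.
rewrite (canonical_main_labels cw) (canonical_one_labels cw) -mem_nc_letters.
apply/mapP/andP => [[p pJ ->]|[lw lI]]; first by rewrite opener_in // opener_label_nc_letters.
by have e := canonical_big cw lw lI; exists (index l w) => //; apply: in_opener; rewrite -e.
Qed.

Lemma sorted_J : sorted before J.
Proof.
rewrite sorted_map; apply: (@sub_in_sorted _ (mem (openers w)) ltn).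
- by move=> p q pJ qJ /=; rewrite !index_opener_label ?opener_in.
- exact/allP.
- by apply: sorted_filter (iota_ltn_sorted 0 m); apply: ltn_trans.
Qed.

Lemma ordered_pns : ordered_blocks (@positive_nonswitching n) P = map B_ J.
Proof.
apply: (ordered_blocks_map sw); first 1 last.
- by move=> l; rewrite mem_J => /andP[].
- exact: sorted_J.
- by move=> B BP /(pns_block_of sw BP)[l hl ->]; exists l; rewrite ?mem_J.
- move=> l; rewrite mem_J => /andP[lw hl]; rewrite block_of_letter //.
  by rewrite /positive_nonswitching block_of_sub_positives.
- by move=> l p _; exact: block_of_pos.
Qed.

Lemma canonical_a_stat : a_stat P = [seq p.+2 | p <- openers w].
Proof.
rewrite /a_stat ordered_pns (least_positive_map sw); first last.
- by move=> l; rewrite mem_J => /andP[].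
- by move=> l p _; exact: block_of_pos.
rewrite -map_comp; apply/eq_in_map => p pJ /=.
by rewrite index_opener_label // opener_in.
Qed.

Lemma canonical_mu_stat : mu_stat P = [seq count_mem (opener_label m p) w | p <- openers w].
Proof.
have -> : mu_stat P = [seq #|B :&: positives n| | B <- map B_ J].
  rewrite /mu_stat ordered_pns; apply/eq_in_map => B /mapP[l].
  rewrite mem_J => /andP[lw hl] ->; rewrite (finset.setIidPl _) //.
  by rewrite block_of_sub_positives.
rewrite (card_positives_map sw); last by move=> l p _; exact: block_of_pos.
by rewrite -map_comp.
Qed.

Lemma ordered_switching I : I =i nc_letters r R -> sorted before I ->
  ordered_blocks (@switching n) P = map B_ I.
Proof.
move=> eI sI; apply: (ordered_blocks_map sw _ _ sI).
- by move=> l p _; exact: block_of_pos.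
- by move=> l; rewrite eI; apply: sub.
- move=> B /ker_block_of[l ->]; rewrite switching_block_of // (canonical_main_labels cw) (canonical_one_labels cw) -mem_nc_letters -eI => lI.
  by exists l.
- move=> l; rewrite eI => lI; rewrite block_of_letter // ?sub // switching_block_of //.
  by rewrite (canonical_main_labels cw) (canonical_one_labels cw) -mem_nc_letters.
Qed.

Lemma canonical_nu_stat I : I =i nc_letters r R -> sorted before I ->
  nu_stat P = [seq count_mem l w | l <- I].
Proof.
move=> eI sI; rewrite /nu_stat (ordered_switching eI sI) (card_positives_map sw) //.
by move=> l p _; exact: block_of_pos.
Qed.

Lemma ordered_meeting I : I =i one_labels R -> sorted before I ->
  ordered_blocks (@meets_positives_and_ones n) P = map B_ I.
Proof.
move=> eI sI; apply: (ordered_blocks_map sw _ _ sI).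
- by move=> l p _; exact: block_of_pos.
- by move=> l; rewrite eI => lI; apply: sub; rewrite mem_nc_letters lI orbT.
- move=> B /ker_block_of[l ->]; rewrite meeting_block_of // (canonical_one_labels cw) -eI => lI.
  by exists l.
- move=> l; rewrite eI => lI; rewrite meeting_block_of // (canonical_one_labels cw) lI block_of_letter //.
  by apply: sub; rewrite mem_nc_letters lI orbT.
Qed.

Lemma canonical_xi_stat I : I =i one_labels R -> sorted before I ->
  xi_stat P = [seq count_mem l w | l <- I].
Proof.
move=> eI sI; rewrite /xi_stat (ordered_meeting eI sI) (card_positives_map sw) //.
by move=> l p _; exact: block_of_pos.
Qed.

Definition ones_of (S : one_type) l : {set Lam n} := [set s in ones n | vval [:: one_label S] s == l].

Lemma canonical_c_stat I : I =i one_labels R -> sorted before I -> c_stat P = [seq ones_of R l | l <- I].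
Proof.
move=> eI sI; rewrite /c_stat (ordered_meeting eI sI) -map_comp; apply: eq_map => l /=.
apply/setP => s; rewrite !inE andbC; case: (boolP (_ || _)) => //= os.
have /onesP[b ->] : s \in ones n by rewrite inE.
by case: b.
Qed.

Definition letter_counts (u : seq int) (I : seq int) := [seq count_mem l u | l <- I].

Lemma nn_stats : nonnest (nn_letters r R ++ w) ->
  [/\ nu_stat P = letter_counts w (main_labels r) ++ rev (letter_counts w (one_labels R)) &
      c_stat P = rev (map (ones_of R) (one_labels R))].
Proof.
move=> nn; have sI : sorted before (nn_letters r R).
  apply: nonnest_sorted nn; first exact: nn_letters_uniq cw.
  by move=> l; rewrite mem_nn_letters; apply: sub.
split.
  by rewrite (canonical_nu_stat (mem_nn_letters r R) sI) /nn_letters map_cat map_rev.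
have [_ sR] := cat_sorted2 sI.
by rewrite (@canonical_c_stat (rev (one_labels R))) ?map_rev // => l; rewrite mem_rev.
Qed.

Section NC.
Hypothesis par : is_alone R || ~~ odd r.
Hypothesis nc : noncross (rev (nc_letters r R) ++ w).

Lemma nc_stats_one : xi_stat P = letter_counts w (one_labels R) /\ c_stat P = map (ones_of R) (one_labels R).
Proof.
have sI : sorted before (nc_letters r R) by apply: noncross_sorted nc; [exact: nc_letters_uniq cw|].
have sR : sorted before (one_labels R).
  apply: (subseq_sorted _ _ sI); first by move=> a b c /=; apply: ltn_trans.
  by apply: subseq_trans (suffix_subseq _ _); apply: prefix_subseq.
by rewrite (canonical_xi_stat _ sR) ?(canonical_c_stat _ sR).
Qed.

Lemma none_block : exists2 B, B \in P & None \in B.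
Proof. by exists (B_ 0); [apply: (@block_of_in _ _ _ _ None)|]; rewrite inE. Qed.

Lemma nc_a_mu : a_stat (CM P) = a_stat P /\ mu_stat (CM P) = mu_stat P.
Proof.
have h := pns_CM none_block.
by rewrite /a_stat /mu_stat /ordered_blocks h.
Qed.

(* [CM] identifies the labels 1 and -1 with 0. *)
Definition merge_label (l : int) : int := if (`|l| <= 1)%N then 0 else l.
Lemma cl0 l : (merge_label l == 0) = (`|l| <= 1)%N.
Proof. by rewrite /merge_label; case: ifP; clear; lia. Qed.

Lemma merge_label_eq x l : (1 < `|l|)%N -> (merge_label x == l) = (x == l).
Proof. by rewrite /merge_label; case: ifP; clear; lia. Qed.

Lemma merge_label_lt a b : merge_label a < merge_label b -> a < b.
Proof. by rewrite /merge_label; case: ifP; case: ifP; clear; lia. Qed.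

(** Merging turns the letters of 1 and -1 into the single letter 0 in the middle. In the case
    [OneAlone] the merged block has positive elements only if 0 is already a main letter, so nothing
    is added to the list. *)
Definition cm_type := if is_alone R then OneAlone else OneZero.
Local Notation cm_letters := (nc_letters r cm_type).
Local Notation u := (map merge_label w).

Lemma small_letter l : l \in w -> ~~ is_alone R -> (`|l| <= 1)%N = (l \in one_labels R).
Proof.
move=> lw nrn; apply/idP/idP => [l1|/one_labels_bound]; last by lia.
have lI : l \in nc_letters r R.
  by apply/negPn/negP => lI; have := canonical_big cw lw lI; rewrite /opener_label; move: l1; clear; lia.
move: lI; rewrite mem_nc_letters => /orP[lm|//].
have re : ~~ odd r by case/orP: par => // h; rewrite h in nrn.
have := main_labels_odd lm; have : l != 0 by apply: contraNneq re => l0; rewrite -mainl0 -l0.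
by move: l1; clear; lia.
Qed.

Lemma OneAlone_notin : is_alone R -> (1 \notin w) && (-1 \notin w).
Proof.
move=> rn; have h l : (l == 1) || (l == -1) -> l \notin w.
  move=> hl; have := canonical_one_labels cw l; rewrite /one_letter.
  by case: (R) rn => //= _; rewrite hl andbT => ->.
by rewrite !h.
Qed.

Lemma cm_letters_bound l : l \in cm_letters -> l != 0 -> (l \in main_labels r) && (1 < `|l|)%N.
Proof.
rewrite mem_nc_letters /cm_type => + l0; have -> : (l \in one_labels (if is_alone R then OneAlone else OneZero)) = false.
  by case: ifP => //= _; rewrite inE (negbTE l0).
rewrite orbF => lm; rewrite lm; have := main_labels_odd lm; move: l0; clear; lia.
Qed.

Lemma zero_letter l : l \in w -> (merge_label l == 0) = [|| l == 0, l == one_label R | l == - one_label R].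
Proof.
move=> lw; rewrite cl0; have [rn|nrn] := boolP (is_alone R).
  by case: (R) rn => //= _; clear; lia.
have := small_letter lw nrn.
by case: (R) nrn => [||[]|[]] //= _; rewrite ?inE; clear; lia.
Qed.

Definition merged : {set Lam n} :=
  (\bigcup_(B in P | ~~ [disjoint B & ones n :|: [set s | ival s == 0]]) B) :\: ones n.

Lemma block_of_disjoint_Z l : [disjoint B_ l & ones n :|: [set s | ival s == 0]]
  = ~~ [|| l == 0, l == one_label R | l == - one_label R].
Proof.
rewrite finset.disjoints_subset finset.setCU finset.subsetI -finset.disjoints_subset.
rewrite block_of_disjoint_ones orbC !negb_or -!andbA; congr andb; congr andb.
apply/fintype.subsetP/idP => [h|l0 s].
  by apply/negP => /eqP l0; have := h None; rewrite l0 !inE /= eqxx => /(_ isT).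
rewrite !inE => /eqP e; apply: contra l0; rewrite -e => /eqP s0.
by have -> : s = None by apply: ival_inj.
Qed.

Lemma mem_merged s : (s \in merged) = (s \notin ones n) &&
  [|| vval (one_label R :: w) s == 0, vval (one_label R :: w) s == one_label R | vval (one_label R :: w) s == - one_label R].
Proof.
rewrite inE; congr andb; apply/finset.bigcupP/idP => [[B /andP[/ker_block_of[l ->]]]|h].
  by rewrite block_of_disjoint_Z negbK inE => h /eqP ->.
exists (B_ (vval (one_label R :: w) s)); last by rewrite inE.
by rewrite block_of_disjoint_Z negbK h andbT; apply: (@block_of_in _ _ _ _ s); rewrite inE.
Qed.

Lemma CM_mem B : (B \in CM P) = (B == merged) ||
  (B \in P) && [disjoint B & ones n :|: [set s | ival s == 0]].
Proof. by rewrite !inE. Qed.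

Definition cm_block l := if l == 0 then merged else B_ l.

Lemma size_u : size u = m. Proof. by rewrite size_map. Qed.

Lemma nth_u p : (p < m)%N -> u`_p = merge_label w`_p.
Proof. by move=> pm; rewrite (nth_map 0) ?sw. Qed.

Lemma cm_block_pos l p : l \in cm_letters -> (p < m)%N -> (epos m p \in cm_block l) = (u`_p == l).
Proof.
move=> lI pm; rewrite nth_u // /cm_block; case: ifPn => [/eqP ->|l0].
  rewrite mem_merged vval_pos // zero_letter ?mem_nth ?sw //.
  rewrite (_ : epos m p \notin ones n) //; apply/negP => /onesP[b].
  by move/(congr1 (@ival n)); rewrite ival_pos // ival_one; case: b.
rewrite block_of_pos //; by have /andP[_ l1] := cm_letters_bound lI l0; rewrite merge_label_eq.
Qed.

Lemma cm_letters_u : {subset cm_letters <= u}.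
Proof.
move=> l lI; have [l0|l0] := eqVneq l 0; last first.
  have /andP[lm l1] := cm_letters_bound lI l0.
  have -> : l = merge_label l by rewrite /merge_label leqNgt l1.
  by apply: map_f; apply: sub; rewrite mem_nc_letters lm.
move: lI; rewrite l0 mem_nc_letters => /orP[zm|].
  by apply: (map_f merge_label (x := 0)); apply: sub; rewrite mem_nc_letters zm.
rewrite /cm_type; case: ifPn => // nrn _.
have [l' l'R] : exists l', l' \in one_labels R.
  by case: (R) nrn => [||b|b] //= _; [exists 0|exists 1|exists 1]; rewrite !inE.
have -> : 0 = merge_label l' by apply/esym/eqP; rewrite cl0 -ltnS (one_labels_bound l'R).
by apply: map_f; apply: sub; rewrite mem_nc_letters l'R orbT.
Qed.

Lemma parcm : is_alone cm_type || ~~ odd r.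
Proof. by move: par; rewrite /cm_type; case: (R). Qed.

Lemma merge_label_nc_letters l : l \in w -> merge_label l \in cm_letters -> l \in nc_letters r R.
Proof.
move=> lw cI; apply/negPn/negP => lI; have e := canonical_big cw lw lI.
have cll : merge_label l = l by apply/eqP; rewrite merge_label_eq //; move: e; rewrite /opener_label; clear; lia.
rewrite cll in cI.
have l0 : l != 0 by move: e; rewrite /opener_label; clear; lia.
by have /andP[lm _] := cm_letters_bound cI l0; rewrite mem_nc_letters lm in lI.
Qed.

(** [merge_label] is monotone and in [w] no smaller switching letter precedes a larger one, so
    merging keeps first occurrences in decreasing order. *)
Lemma sorted_cm_letters : sorted (relpre (index^~ u) ltn) cm_letters.
Proof.
apply: (@sub_in_sorted _ (mem cm_letters) >%R) (sorted_nc_letters parcm); last exact/allP.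
move=> a b aI bI /= ba; rewrite ltnNge leq_eqVlt; apply/negP.
have au := cm_letters_u aI; have bu := cm_letters_u bI.
case/orP=> [/eqP/(index_inj 0 bu au) e|lt]; first by rewrite e ltxx in ba.
have pm : (index a u < m)%N by rewrite -size_u index_mem.
have qm : (index b u < m)%N by rewrite -size_u index_mem.
set p := index a u in lt pm; set q := index b u in lt qm.
have ca : merge_label w`_p = a by rewrite -nth_u // nth_index.
have cb : merge_label w`_q = b by rewrite -nth_u // nth_index.
have pI : w`_p \in nc_letters r R by apply: merge_label_nc_letters; rewrite ?ca // mem_nth ?sw.
have qI : w`_q \in nc_letters r R by apply: merge_label_nc_letters; rewrite ?cb // mem_nth ?sw.
have lt2 : w`_q < w`_p by apply: merge_label_lt; rewrite ca cb.
have /negP[] := nc_letters_order cw par nc pI qI lt2.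
rewrite -[X in subseq _ X](cat_take_drop p w).
apply: (@cat_subseq _ [:: w`_q] [:: w`_p]).
  by rewrite sub1seq -(@nth_take p _ 0 q lt) mem_nth // size_takel // sw ltnW.
by rewrite (drop_nth 0) ?sw //= eqxx sub0seq.
Qed.

Lemma ordered_CM : ordered_blocks (@switching n) (CM P) = map cm_block cm_letters.
Proof.
apply: (ordered_blocks_map size_u cm_block_pos cm_letters_u sorted_cm_letters) => [B|l lI].
  rewrite CM_mem => /orP[/eqP -> /andP[/pred0Pn[s /= /andP[sM sP]] _]|].
    exists 0; last by rewrite /cm_block eqxx.
    rewrite mem_nc_letters /cm_type; case: ifPn => rn; last by rewrite /= inE eqxx orbT.
    move: sP sM; case: (LamP s) => [|b|p pm|p pm];
      rewrite ?(negbTE (none_positives _)) ?(negbTE (one_positives _ _)) //; last first.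
      by rewrite (negbTE (neg_positives _)).
    have pw : w`_p \in w by rewrite mem_nth ?sw.
    rewrite mem_merged vval_pos // => _ /andP[_ h].
    have w0 : w`_p = 0.
      have /andP[n1 nn1] := OneAlone_notin rn.
      move: h; rewrite (_ : one_label R = 1); last by case: (R) rn.
      by case/or3P=> /eqP e //; move: pw; rewrite e ?(negbTE n1) ?(negbTE nn1).
    have := @canonical_neg m r R w cw 0; rewrite oppr0 -{1 2}w0 pw mem_nc_letters => /(_ isT isT).
    by case: (R) rn => //= _; rewrite orbF => ->.
  move=> /andP[/ker_block_of[l ->]]; rewrite block_of_disjoint_Z !negb_or => /and3P[l0 h1 h2].
  rewrite switching_block_of // /one_letter (negbTE h1) (negbTE h2) andbF orbF (canonical_main_labels cw) => lm.
  by exists l; rewrite ?mem_nc_letters ?lm // /cm_block (negbTE l0).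
split.
  rewrite CM_mem /cm_block; case: ifPn => [_|l0]; first by rewrite eqxx.
  have /andP[lm _] := cm_letters_bound lI l0.
  have := lm; rewrite -(canonical_main_labels cw) => /and4P[lw _ h1 h2].
  by rewrite block_of_letter // block_of_disjoint_Z !negb_or l0 h1 h2 orbT.
rewrite /cm_block; case: ifPn => [/eqP l0|l0]; last first.
  by have /andP[lm _] := cm_letters_bound lI l0; rewrite switching_block_of // (canonical_main_labels cw) lm.
apply/andP; split.
  have := cm_letters_u lI; rewrite -index_mem size_u => pm.
  apply/pred0Pn; exists (epos m (index l u)); rewrite /= pos_positives // andbT.
  by have := cm_block_pos lI pm; rewrite /cm_block l0 eqxx nth_index ?eqxx // -l0; exact: cm_letters_u.
apply/negP => /fintype.subsetP/(_ None); rewrite (negbTE (none_positives m)) mem_merged.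
by rewrite /= inE => /(_ isT).
Qed.

(** The first component that [sigmaD] produces from the nonnesting counts; the letters of 1 and -1
    share one summed entry in the middle. *)
Definition nc_nu (S : one_type) (w' : seq int) := take r./2 (letter_counts w' (main_labels r)) ++
  (if is_alone S then [::] else [:: sumn (letter_counts w' (one_labels S))]) ++ drop r./2 (letter_counts w' (main_labels r)).

Lemma nc_nu_stat : nu_stat (CM P) = nc_nu R w.
Proof.
rewrite /nu_stat ordered_CM (card_positives_map size_u cm_block_pos).
have main l : l \in main_labels r -> count_mem l u = count_mem l w.
  move=> lm; rewrite count_map; apply: eq_in_count => x xw /=.
  have [l0|l0] := eqVneq l 0; last by rewrite merge_label_eq //; have := main_labels_odd lm; move: l0; clear; lia.
  rewrite l0 zero_letter //.
  have rn : is_alone R by case/orP: par => //; rewrite -mainl0 -l0 lm.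
  have /andP[n1 nn1] := OneAlone_notin rn.
  have x1 : (x != 1) && (x != -1) by rewrite !(contraTneq _ xw) // => ->.
  by case: (R) rn => //= _; move: x1; clear; lia.
have E s : {subset s <= main_labels r} -> [seq count_mem l u | l <- s] = letter_counts w s.
  by move=> h; apply/eq_in_map => l /h; exact: main.
rewrite /nc_letters !map_cat (E (take _ _)); last by move=> l; exact: mem_take.
rewrite (E (drop _ _)); last by move=> l; exact: mem_drop.
rewrite /nc_nu /letter_counts map_take map_drop; congr (_ ++ _ ++ _).
rewrite /cm_type; case: ifPn => // nrn /=; congr (_ :: _).
rewrite count_map (eq_in_count (a2 := mem (one_labels R))); last first.
  by move=> x xw /=; rewrite -small_letter // cl0.
case: (R) nrn => [||b|b] //= _; rewrite ?addn0.
- by apply: eq_count => x; rewrite /= inE.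
- by apply: eq_count => x; rewrite /= inE.
rewrite -count_predUI -[LHS]addn0; congr addn.
  by apply: eq_count => x /=; rewrite !inE.
by rewrite (eq_count (a2 := pred0)) ?count_pred0 // => x /=; clear; lia.
Qed.
End NC.
End CanStats.

(** * The correspondence *)

Section Final.
Variable m : nat.
Local Notation n := m.+1.
Implicit Types (r : nat) (S : one_type) (w : seq int) (P : {set {set Lam n}}).

Lemma size_letter_counts w I : size (letter_counts w I) = size I. Proof. exact: size_map. Qed.

Lemma size_nc_nu r S w : size (nc_nu r S w) = r + ~~ is_alone S.
Proof.
have h : r./2 <= size (letter_counts w (main_labels r)) by rewrite size_letter_counts size_main_labels; lia.
rewrite /nc_nu !size_cat size_takel // size_drop size_letter_counts size_main_labels.
by case: (is_alone S) => /=; lia.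
Qed.

(** Since [k = r + l], both parity tests in [sigmaD] say that [r] is even, and in both cases [h]
    equals [r./2]. *)
Lemma sigmaD_canonical r S w : is_alone S || ~~ odd r ->
  sigmaD (letter_counts w (main_labels r) ++ rev (letter_counts w (one_labels S))) (rev (map (ones_of m S) (one_labels S))) =
  Some (nc_nu r S w, letter_counts w (one_labels S), map (ones_of m S) (one_labels S)).
Proof.
move=> par; set rho := letter_counts w (main_labels r).
have sr : size rho = r by rewrite size_letter_counts size_main_labels.
have h2 : r./2 <= size rho by rewrite sr; lia.
have drop_r s : drop r (rho ++ s) = s by rewrite drop_size_cat.
have take_r s : take r (rho ++ s) = rho by rewrite take_size_cat.
case: S par => [||b|b] /= par; rewrite /sigmaD /nc_nu /= ?size_cat /= sr.
- by rewrite addn0 subn0 cats0 cat_take_drop drop_oversize // sr.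
- rewrite addn1 /= par /= subSS subn0 takel_cat // drop_r take_r nth_cat sr ltnn subnn /=.
  by rewrite addn0.
- rewrite addn1 /= par /= subSS subn0 takel_cat // drop_r take_r nth_cat sr ltnn subnn /=.
  by rewrite addn0.
- rewrite addn2 /= negbK par /= subSS subSS subn0 takel_cat // drop_r take_r.
  rewrite !nth_cat sr ltnn subnn ltnNge leqnSn /= subSnn /= addn0.
  by rewrite /rev /= addnC.
Qed.

(** Nonnesting alone does not give this parity: if 1 has label 1 and 2, 3, 4 have labels 0, 1, 0,
    the partition is nonnesting and the zero block is its only main block, so [r = 1]. *)
Lemma sigmaD_par r S w :
  isSome (sigmaD (letter_counts w (main_labels r) ++ rev (letter_counts w (one_labels S))) (rev (map (ones_of m S) (one_labels S)))) ->
  is_alone S || ~~ odd r.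
Proof.
case: S => [||b|b] //=; rewrite /sigmaD /= ?size_cat /= size_letter_counts size_main_labels.
- by rewrite addn1 /=; case: odd.
- by rewrite addn1 /=; case: odd.
- by rewrite addn2 /= negbK; case: odd.
Qed.

(** The first occurrence of an unlisted letter is determined by which prefixes contain it, so equal
    openers force equal first positions. *)
Lemma canonical_perm r S w w' I : I =i nc_letters r S -> canonical m r S w -> perm_eq w' w ->
  same_openers I w' w -> canonical m r S w' /\ openers m w' = openers m w.
Proof.
move=> eI cw pw ow; have [sw sub hl hr] := cw.
have idx l : l \in w -> l \notin nc_letters r S -> index l w' = index l w.
  move=> lw lI; have lw' : l \in w' by rewrite (perm_mem pw).
  have E p : (index l w' < p) = (index l w < p).
    rewrite -!in_take //; have := ow p l; rewrite !mem_cat eI (negbTE lI).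
    by [].
  by apply/eqP; rewrite eqn_leq -ltnS E ltnSn /= -ltnS -E ltnSn.
have cw' : canonical m r S w'.
  split=> //; first by rewrite (perm_size pw).
  - by move=> l /sub; rewrite (perm_mem pw).
  - move=> l; rewrite (perm_mem pw) => lw.
    have [//|lI] := boolP (l \in nc_letters r S).
    by rewrite idx //= -(canonical_big cw).
split=> //; apply: eq_in_filter => p; rewrite mem_iota add0n => /= pm.
have A u : canonical m r S u -> (u`_p == opener_label m p)%R = (opener_label m p \in u).
  move=> cu; apply/idP/idP => [h|/(in_opener cu)]; last by rewrite mem_openers => /andP[].
  by apply: (opener_in cu); rewrite mem_openers pm.
by rewrite !A // (perm_mem pw).
Qed.

(** An unlisted letter of a canonical word lies in a prefix exactly when the position it encodes is
    below the prefix length. *)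
Lemma openers_take r S w w' I p b : I =i nc_letters r S -> canonical m r S w -> canonical m r S w' ->
  openers m w = openers m w' -> b \in I ++ take p w -> b \in I ++ take p w'.
Proof.
move=> eI cw cw' eo; rewrite !mem_cat !eI; have [//|bI /= bt] := boolP (b \in nc_letters r S).
have bw : b \in w by apply: mem_take bt.
have eb := canonical_big cw bw bI; rewrite in_take // in bt.
have : index b w \in openers m w' by rewrite -eo; apply: (in_opener cw); rewrite -eb.
move/(opener_in cw'); rewrite -eb => bw'.
by rewrite in_take // eb (index_opener_label cw') -?eb.
Qed.

(** The length separates all cases except zero from one-sided; the elements of the first entry
    settle that and the sign. *)
Lemma ones_of_inj S S' : map (ones_of m S) (one_labels S) = map (ones_of m S') (one_labels S') -> S = S'.
Proof.
have mem_ones_of T (l : int) b : (eone m b \in ones_of m T l) = ((if b then - one_label T else one_label T) == l)%R.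
  rewrite /ones_of 2!inE.
  have -> : (ival (eone m b) == 1)%R || (ival (eone m b) == -1)%R by rewrite ival_one; case: b.
  by case: b.
move=> e.
have hd b : (0 < size (one_labels S)) -> (eone m b \in head finset.set0 (map (ones_of m S) (one_labels S))) =
   (eone m b \in head finset.set0 (map (ones_of m S') (one_labels S'))) by rewrite e.
have sz : size (one_labels S) = size (one_labels S').
  by have := congr1 size e; rewrite !size_map.
move: (hd true) (hd false) sz => {hd e}.
by case: S => [||[]|[]]; case: S' => [||[]|[]] //=; rewrite !mem_ones_of /= => h1 h2;
   have := h1 isT; have := h2 isT.
Qed.

Definition ncrep P r S w := [/\ canonical m r S w, is_alone S || ~~ odd r,
  count_mem 0%R (one_label S :: w) != 1, noncross (rev (nc_letters r S) ++ w) &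
  P = ker_partition n (one_label S :: w)].

Definition nnrep P r S w := [/\ canonical m r S w, is_alone S || ~~ odd r,
  count_mem 0%R (one_label S :: w) != 1, nonnest (nn_letters r S ++ w) &
  P = ker_partition n (one_label S :: w)].

Lemma ncrep_stats P r S w : ncrep P r S w ->
  [/\ a_stat (CM P) = [seq p.+2 | p <- openers m w],
      mu_stat (CM P) = [seq count_mem (opener_label m p) w | p <- openers m w],
      nu_stat (CM P) = nc_nu r S w, xi_stat P = letter_counts w (one_labels S) &
      c_stat P = map (ones_of m S) (one_labels S)].
Proof.
move=> [cw par c0 nc ->]; have [-> ->] := nc_a_mu m S w.
have [-> ->] := nc_stats_one cw nc.
by rewrite (canonical_a_stat cw) (canonical_mu_stat cw) (nc_nu_stat cw par nc).
Qed.

Lemma nnrep_stats P r S w : nnrep P r S w ->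
  [/\ a_stat P = [seq p.+2 | p <- openers m w],
      mu_stat P = [seq count_mem (opener_label m p) w | p <- openers m w] &
      sigmaD (nu_stat P) (c_stat P) =
        Some (nc_nu r S w, letter_counts w (one_labels S), map (ones_of m S) (one_labels S))].
Proof.
move=> [cw par c0 nn ->]; have [-> ->] := nn_stats cw nn.
by rewrite (canonical_a_stat cw) (canonical_mu_stat cw) (sigmaD_canonical _ par).
Qed.

Lemma corresponds_perm P P' r S w w' I : ncrep P r S w -> nnrep P' r S w' ->
  I =i nc_letters r S -> perm_eq w' w -> same_openers I w' w -> corresponds P P'.
Proof.
move=> hP hP' eI pw ow; have [cw _ _ _ _] := hP.
have [_ eo] := canonical_perm eI cw pw ow.
have cE l : count_mem l w' = count_mem l w by apply/seq.permP.
have sE I' : letter_counts w' I' = letter_counts w I' by apply: eq_map => l; exact: cE.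
have [a1 m1 n1 x1 c1] := ncrep_stats hP.
have [a2 m2 s2] := nnrep_stats hP'.
split; first by rewrite a2 a1 eo.
  by rewrite m2 m1 eo; apply: eq_map => p; rewrite cE.
by rewrite s2 n1 x1 c1 /nc_nu !sE.
Qed.

(** [c] gives the type, then the length of [nu] gives [r]. The entries of [nu] give the counts of
    main letters, [xi] those of the letters of 1 and -1, and [a] with [mu] those of the opener
    letters; there are no other letters. *)
Lemma corresponds_rep P P' r S w r' S' w' : ncrep P r S w -> nnrep P' r' S' w' ->
  corresponds P P' -> [/\ r' = r, S' = S, perm_eq w' w & openers m w' = openers m w].
Proof.
move=> hP hP' [].
have [a1 m1 n1 x1 c1] := ncrep_stats hP.
have [a2 m2 s2] := nnrep_stats hP'.
rewrite a1 a2 m1 m2 s2 n1 x1 c1 => ea em [en ex ec].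
have [cw par _ _ _] := hP; have [cw' par' _ _ _] := hP'.
have eS := ones_of_inj ec; subst S'.
have er : r' = r.
  by have := congr1 size en; rewrite !size_nc_nu => /addIn.
subst r'.
have eo : openers m w' = openers m w by apply: inj_map ea => p q [].
split=> //.
have e_main : letter_counts w' (main_labels r) = letter_counts w (main_labels r).
  move: en; rewrite /nc_nu => /eqP; rewrite eqseq_cat ?size_take ?size_letter_counts // => /andP[/eqP e1].
  rewrite eqseq_cat; last by case: ifP.
  move=> /andP[_ /eqP e2].
  by rewrite -(cat_take_drop r./2 (letter_counts w' _)) e1 e2 cat_take_drop.
have cE l : (l \in w) || (l \in w') -> count_mem l w' = count_mem l w.
  move=> lw; have [lI|lI] := boolP (l \in nc_letters r S).
    move: lI; rewrite mem_nc_letters => /orP[lm|lR].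
      by move/eq_in_map: e_main; apply.
    by move/eq_in_map: ex; apply.
  have [p ->pP] : exists2 p, l = opener_label m p & p \in openers m w.
    case/orP: lw => lw.
      have e := canonical_big cw lw lI; exists (index l w) => //.
      by apply: (in_opener cw); rewrite -e.
    have e := canonical_big cw' lw lI; exists (index l w') => //.
    by rewrite -eo; apply: (in_opener cw'); rewrite -e.
  by move: em; rewrite eo => /eq_in_map; apply.
by apply/allP => l; rewrite mem_cat => lw /=; rewrite cE // orbC.
Qed.

Section RealType.
Variable R : realType.
Hypothesis m0 : 0 < m.

Lemma classical_word P : classical_partition R P -> exists y1 w,
  [/\ size w = m, count_mem 0%R (y1 :: w) != 1 & P = ker_partition n (y1 :: w)].
Proof.
case/classical_ker_partition => -[|y1 w] [sv cv ->] //.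
by exists y1, w; split=> //; case: sv.
Qed.

Lemma noncrossing_rep P : classical_noncrossing R P -> exists r S w, ncrep P r S w.
Proof.
move=> [/classical_word[y1 [w [sw cv ->]]] /(@ncword_iff n y1 w sw) hw].
have [r [S [w' [c1 c2 c3 c4 c5]]]] := nc_structure sw cv hw.
by exists r, S, w'; split.
Qed.

Lemma rep_noncrossing P r S w : ncrep P r S w -> classical_noncrossing R P.
Proof.
move=> [cw par c0 nc ->]; have [sw _ _ _] := cw; split.
  by apply/classical_ker_partition; exists (one_label S :: w); rewrite /= sw.
by apply/ncword_iff => //; apply: canonical_ncword m0 cw par nc.
Qed.

(** The parity recorded in [nnrep] is read off from [sigmaD] being defined, whereas
    [noncrossing_rep] obtains it from the crossing condition. *)
Lemma nonnesting_rep P : classical_nonnesting R P ->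
  isSome (sigmaD (nu_stat P) (c_stat P)) -> exists r S w, nnrep P r S w.
Proof.
move=> [/classical_word[y1 [w [sw cv ->]]] /(@nnword_iff m y1 w sw) hw].
have [r [S [w' [c1 c2 c3 ->]]]] := nn_structure sw cv hw.
have [-> ->] := nn_stats c1 c2 => /sigmaD_par par.
by exists r, S, w'; split.
Qed.

Lemma rep_nonnesting P r S w : nnrep P r S w -> classical_nonnesting R P.
Proof.
move=> [cw par c0 nn ->]; have [sw _ _ _] := cw; split.
  by apply/classical_ker_partition; exists (one_label S :: w); rewrite /= sw.
by apply/nnword_iff => //; apply: canonical_nnword cw nn.
Qed.

Lemma count_perm S w w' : perm_eq w' w -> count_mem 0%R (one_label S :: w') = count_mem 0%R (one_label S :: w).
Proof. by move=> pw; apply/seq.permP; rewrite perm_cons. Qed.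

Lemma corresponds_same_type P P' : classical_noncrossing R P ->
  classical_nonnesting R P' -> corresponds P P' -> same_type R P P'.
Proof.
move=> /noncrossing_rep[r [S [w hP]]] hP' co.
have [|r' [S' [w' hP'']]] := nonnesting_rep hP'; first by case: co => _ _ ->.
have [e1 e2 pw _] := corresponds_rep hP hP'' co; subst r' S'.
have [[sw _ _ _] _ c0 _ ->] := hP; have [_ _ _ _ ->] := hP''.
by apply: perm_same_type; rewrite //= ?sw // perm_cons.
Qed.

Lemma noncrossing_partner P : classical_noncrossing R P ->
  exists! P', classical_nonnesting R P' /\ corresponds P P'.
Proof.
move=> /noncrossing_rep[r [S [w hP]]]; have [cw par c0 nc eP] := hP.
have [w' [nn pw ow]] := nonnest_exists w (nn_letters_uniq cw).
have [cw' eo] := canonical_perm (mem_nn_letters r S) cw pw ow.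
pose P' := ker_partition n (one_label S :: w').
have hP' : nnrep P' r S w' by split; rewrite // (count_perm _ pw).
exists P'; split.
  split; first exact: rep_nonnesting hP'.
  exact: corresponds_perm hP hP' (mem_nn_letters r S) pw ow.
move=> P2 [hP2 co].
have [|r2 [S2 [w2 hP2']]] := nonnesting_rep hP2; first by case: co => _ _ ->.
have [e1 e2 pw2 eo2] := corresponds_rep hP hP2' co; subst r2 S2.
have [cw2 _ _ nn2 ->] := hP2'.
suff ew : w' = w2 by rewrite /P' ew.
apply: (nonnest_uniq nn nn2).
  by rewrite (perm_trans pw) // perm_sym.
have eo' : openers m w' = openers m w2 by rewrite eo eo2.
by move=> p b; apply/idP/idP; [apply: (openers_take (mem_nn_letters r S) cw' cw2 eo')
  | apply: (openers_take (mem_nn_letters r S) cw2 cw' (esym eo'))].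
Qed.

Lemma nonnesting_partner P' : classical_nonnesting R P' ->
  isSome (sigmaD (nu_stat P') (c_stat P')) ->
  exists! P, classical_noncrossing R P /\ corresponds P P'.
Proof.
move=> + si => /nonnesting_rep/(_ si)[r [S [w hP']]]; have [cw par c0 nn eP] := hP'.
have uI : uniq (rev (nc_letters r S)) by rewrite rev_uniq (nc_letters_uniq cw).
have eI : rev (nc_letters r S) =i nc_letters r S by move=> l; rewrite mem_rev.
have [w' [nc pw ow]] := noncross_exists w uI.
have [cw' eo] := canonical_perm eI cw pw ow.
pose P := ker_partition n (one_label S :: w').
have hP : ncrep P r S w' by split; rewrite // (count_perm _ pw).
exists P; split.
  split; first exact: rep_noncrossing hP.
  apply: (corresponds_perm hP hP' eI); first by rewrite perm_sym.
  by move=> p b; rewrite ow.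
move=> P2 [hP2 co].
have [r2 [S2 [w2 hP2']]] := noncrossing_rep hP2.
have [e1 e2 pw2 eo2] := corresponds_rep hP2' hP' co; subst r2 S2.
have [cw2 _ _ nc2 ->] := hP2'.
suff ew : w' = w2 by rewrite /P ew.
apply: (noncross_uniq nc nc2).
  by rewrite (perm_trans pw).
have eo' : openers m w' = openers m w2 by rewrite eo eo2.
by move=> p b; apply/idP/idP; [apply: (openers_take eI cw' cw2 eo')
  | apply: (openers_take eI cw2 cw' (esym eo'))].
Qed.
End RealType.
End Final.

Theorem theorem2p12 (R : realType) (n : nat) (hn : 2 <= n) :
  [/\ forall pi : {set {set Lam n}}, classical_noncrossing R pi ->
        exists! pi' : {set {set Lam n}},
          classical_nonnesting R pi' /\ corresponds pi pi',
      forall pi' : {set {set Lam n}}, classical_nonnesting R pi' ->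
        isSome (sigmaD (nu_stat pi') (c_stat pi')) ->
        exists! pi : {set {set Lam n}},
          classical_noncrossing R pi /\ corresponds pi pi'
    & forall pi pi' : {set {set Lam n}},
        classical_noncrossing R pi -> classical_nonnesting R pi' ->
        corresponds pi pi' -> same_type R pi pi'].
Proof.
(* With [n = m.+1], the bound [0 < m] makes the end of [w] an admissible insertion point. *)
case: n hn => // m m0; split.
- exact: noncrossing_partner.
- exact: nonnesting_partner.
- exact: corresponds_same_type.
Qed.
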